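(* Let $d\ge1$. Every $f\in W^{\infty,1}(\mathbb{R}^d)$ is Fresnel integrable in the sense of the starred Fresnel integral $\widetilde{\int}^{*}$ (i.e. the limit defining it exists and does not depend on the choice of $\varphi,g,\gamma$), and for every $g,\gamma\in\mathcal{S}(\mathbb{R}^d)$ such that $\langle\gamma,g\rangle\ne0$ we have $$\widetilde{\int_{\mathbb{R}^d}}^{*} e^{\frac{i}{2\hbar}|x|^2}f(x)\,dx=\frac{1}{\langle\gamma,g\rangle}\int_{\mathbb{R}^{2d}}V_gF_+(x,\xi)\,\mathcal{V}_\gamma f(x,\xi)\,dx\,d\xi .$$
   Context: Fix $\hbar\in(0,1]$; $i^{s}=e^{i\pi s/2}$, so $(2\pi i\hbar)^{-d/2}=(2\pi\hbar)^{-d/2}e^{-i\pi d/4}$. $\langle f,g\rangle=\int_{\mathbb{R}^d} f\overline{g}\,dy$, extended to $f\in\mathcal{S}'(\mathbb{R}^d)$, $g\in\mathcal{S}(\mathbb{R}^d)$ by $\langle f,g\rangle=f(\overline g)$. For $g\in\mathcal{S}(\mathbb{R}^d)$ and $f\in\mathcal{S}'(\mathbb{R}^d)$, the Gabor transform is $V_gf(x,\xi)=\langle f,\pi(x,\xi)g\rangle$, where $\pi(x,\xi)g(y)=(2\pi\hbar)^{-d/2}e^{\frac{i}{\hbar}\xi\cdot y}g(y-x)$; and $\mathcal{V}_gf(x,\xi)=\overline{V_g\overline{f}(x,\xi)}$. The Fourier transform is $\hat f(\xi)=(2\pi\hbar)^{-d/2}\int e^{-\frac{i}{\hbar}\xi\cdot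 x}f(x)\,dx$, extended to tempered distributions. $W^{\infty,1}(\mathbb{R}^d)$ is the space of $f\in\mathcal{S}'(\mathbb{R}^d)$ with $\int_{\mathbb{R}^d}\sup_{\xi\in\mathbb{R}^d}|V_gf(x,\xi)|\,dx<\infty$ for some (equivalently every) $g\in\mathcal{S}(\mathbb{R}^d)\setminus\{0\}$; equivalently, it is the image under the Fourier transform of $M^{\infty,1}(\mathbb{R}^d)=\{f\in\mathcal{S}'(\mathbb{R}^d):\int\sup_{x}|V_gf(x,\xi)|\,d\xi<\infty\}$. $F_+(x)=(2\pi i\hbar)^{-d/2}e^{\frac{i}{2\hbar}|x|^2}$, $x\in\mathbb{R}^d$. For $f\in W^{\infty,1}(\mathbb{R}^d)$ the starred Fresnel integral is defined as follows: for all $\varphi\in\mathcal{S}(\mathbb{R}^d)$ with $\varphi(0)=1$ and $g,\gamma\in\mathcal{S}(\mathbb{R}^d)$ with $\langle\gamma,g\rangle\ne0$, writing $\varphi_\varepsilon(x)=\varphi(\varepsilon x)$, $$\widetilde{\int_{\mathbb{R}^d}}^{*}e^{\frac{i}{2\hbar}|x|^2}f(x)\,dx:=\lim_{\varepsilon\downarrow0}\frac1{\langle\gamma,g\rangle}\int_{\mathbb{R}^{2d}}V_gF_+(x,\xi)\,\mathcal{V}_\gamma(f\varphi_\varepsilon)(x,\xi)\,dx\,d\xi .$$ *)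

(* Defs.v *)
From HB Require Import structures.
From mathcomp Require Import all_boot all_order all_algebra.
From mathcomp Require Import complex.
From mathcomp Require Import all_classical all_reals all_analysis.
Set Implicit Arguments.
Unset Strict Implicit.
Unset Printing Implicit Defensive.
Import Order.TTheory GRing.Theory Num.Theory.
Import numFieldNormedType.Exports.
Local Open Scope classical_set_scope.
Local Open Scope ring_scope.

(** The library has Lebesgue measure on R and binary products only.  Row
    vectors get the sigma-algebra generated by the coordinates (the Borel
    sets of R^d), and the measure is built by recursion on d through
    R^(d+1) = R x R^d. *)

Definition rV_display : measure_display.
Proof. exact: default_measure_display. Qed.

Section rV_measurable.
Context {R : realType} {d : nat}.

Let coord (i : 'I_d) (x : 'rV[R]_d) : measurableTypeR R := x ord0 i.

Let rV_set0 : g_sigma_preimage coord set0.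
Proof. exact: sigma_algebra0. Qed.

Let rV_setC A : g_sigma_preimage coord A -> g_sigma_preimage coord (~` A).
Proof. exact: sigma_algebraC. Qed.

Let rV_bigcup (F : (set 'rV[R]_d)^nat) :
  (forall i, g_sigma_preimage coord (F i)) ->
  g_sigma_preimage coord (\bigcup_i F i).
Proof. exact: sigma_algebra_bigcup. Qed.

HB.instance Definition _ := @isMeasurable.Build rV_display 'rV[R]_d
  (g_sigma_preimage coord) rV_set0 rV_setC rV_bigcup.

Lemma measurable_coord (i : 'I_d) :
  measurable_fun setT (fun x : 'rV[R]_d => x ord0 i : measurableTypeR R).
Proof.
move=> _ Y mY; rewrite setTI; apply: sub_sigma_algebra => /=.
rewrite -bigcup_seq/=; exists i => /=; first by rewrite mem_index_enum.
by exists Y => //; rewrite setTI.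
Qed.

Lemma measurable_fun_coordP d1 (T : measurableType d1) (f : T -> 'rV[R]_d) :
  measurable_fun setT f <->
  forall i, measurable_fun setT (fun t => f t ord0 i : measurableTypeR R).
Proof.
split=> [mf i|mf _ Y mY].
  exact: measurableT_comp (measurable_coord i) mf.
rewrite setTI; pose G := [set B : set 'rV[R]_d | measurable (f @^-1` B)].
suff: g_sigma_preimage coord `<=` G by exact.
apply: smallest_sub.
  split; first by rewrite /G /= preimage_set0.
    move=> A mA; rewrite /G /= setTD preimage_setC; apply: measurableC; exact: mA.
  by move=> F mF; rewrite /G /= preimage_bigcup; apply: bigcup_measurable => k _; exact: mF.
move=> A; rewrite -bigcup_seq => -[i _ [B mB <-]]; rewrite /G /=.
by rewrite setTI; have := mf i measurableT B mB; rewrite setTI.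
Qed.

End rV_measurable.

Section rV_cons.
Context {R : realType} {n : nat}.

Definition rV_cons (p : measurableTypeR R * 'rV[R]_n) : 'rV[R]_n.+1 :=
  \row_i if unlift ord0 i is Some j then p.2 ord0 j else p.1.

Definition rV_uncons (x : 'rV[R]_n.+1) : measurableTypeR R * 'rV[R]_n :=
  (x ord0 ord0, \row_j x ord0 (lift ord0 j)).

Lemma rV_consK : cancel rV_cons rV_uncons.
Proof.
move=> [a x]; rewrite /rV_uncons mxE unlift_none /=; congr pair.
by apply/rowP => j; rewrite !mxE liftK.
Qed.

Lemma measurable_rV_cons : measurable_fun setT rV_cons.
Proof.
apply/measurable_fun_coordP => i; rewrite /rV_cons.
under eq_fun do rewrite mxE.
case: (unliftP ord0 i) => [j|] _ /=; last exact: measurable_fst.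
exact: measurableT_comp (measurable_coord j) measurable_snd.
Qed.

Lemma measurable_rV_uncons : measurable_fun setT rV_uncons.
Proof.
apply/measurable_fun_pairP; split; first exact: measurable_coord.
apply/measurable_fun_coordP => i /=.
rewrite (_ : (fun _ => _) =
  fun t : 'rV[R]_n.+1 => t ord0 (lift ord0 i) : measurableTypeR R).
  exact: measurable_coord.
by apply/funext => t; rewrite /= mxE.
Qed.

Variable m : {sigma_finite_measure set 'rV[R]_n -> \bar R}.

Definition leb_cons : set 'rV[R]_n.+1 -> \bar R :=
  pushforward (lebesgue_measure \x m)%E rV_cons.

Let leb_cons0 : leb_cons set0 = 0%E.
Proof. by rewrite /leb_cons /pushforward preimage_set0 measure0. Qed.

Let leb_cons_ge0 A : (0 <= leb_cons A)%E.
Proof. rewrite /leb_cons /pushforward; exact: measure_ge0. Qed.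

Let leb_cons_sigma_additive : semi_sigma_additive leb_cons.
Proof.
move=> F mF tF mUF; rewrite /leb_cons /pushforward preimage_bigcup.
apply: measure_semi_sigma_additive.
- by move=> k; rewrite -[X in measurable X]setTI; exact: measurable_rV_cons.
- apply/trivIsetP => /= i j _ _ ij; rewrite -preimage_setI.
  by move/trivIsetP : tF => /(_ _ _ _ _ ij) ->//; rewrite preimage_set0.
- by rewrite -preimage_bigcup -[X in measurable X]setTI; exact: measurable_rV_cons.
Qed.

HB.instance Definition _ := isMeasure.Build _ _ _ leb_cons
  leb_cons0 leb_cons_ge0 leb_cons_sigma_additive.

Let leb_cons_sigma_finite : sigma_finite setT leb_cons.
Proof.
have /sigma_finiteP[F [TF ndF Foo]] :=
  sigma_finiteT (lebesgue_measure : set (measurableTypeR R) -> \bar R).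
have /sigma_finiteP[G [TG ndG Goo]] := sigma_finiteT m.
have mFG k : measurable (F k `*` G k).
  by apply: measurableX; [have [] := Foo k|have [] := Goo k].
exists (fun k => rV_uncons @^-1` (F k `*` G k)).
  rewrite -preimage_bigcup (_ : \bigcup_k _ = setT) ?preimage_setT//.
  rewrite -setXTT TF TG predeqE => -[x y]; split; first by move=> [k _ []]; split; exists k.
  move=> [/= [k _ Fkx] [l _ Gly]]; exists (maxn k l) => //; split.
  - by move: x Fkx; exact/subsetPset/ndF/leq_maxl.
  - by move: y Gly; exact/subsetPset/ndG/leq_maxr.
move=> k; have [? ?] := Foo k; have [? ?] := Goo k; split.
  by rewrite -[X in measurable X]setTI; exact: measurable_rV_uncons.
rewrite /leb_cons /pushforward -comp_preimage.
rewrite (_ : rV_uncons \o rV_cons = id); last first.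
  by apply/funext => x; exact: rV_consK.
by rewrite preimage_id product_measure1E// lte_mul_pinfty// ge0_fin_numE.
Qed.

HB.instance Definition _ := Measure_isSigmaFinite.Build _ _ _ leb_cons
  leb_cons_sigma_finite.

End rV_cons.

Fixpoint leb (R : realType) (d : nat) :
    {sigma_finite_measure set 'rV[R]_d -> \bar R} :=
  match d with
  | 0 => \d_(0 : 'rV[R]_0)
  | n.+1 => leb_cons (leb R n)
  end.

Lemma leb_box (R : realType) (d : nat) (a b : 'I_d -> R) :
  (forall i, a i <= b i) ->
  leb R d [set x | forall i, a i < x ord0 i <= b i] =
  (\prod_(i < d) (b i - a i))%:E.
Proof.
elim: d a b => [|n IH] a b ab /=.
  rewrite big_ord0 diracE mem_set//=; by case.
rewrite /leb_cons /pushforward /=.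
rewrite (_ : rV_cons @^-1` _ =
  (`]a ord0, b ord0]%classic : set (measurableTypeR R)) `*`
  [set x : 'rV[R]_n |
     forall i, a (lift ord0 i) < x ord0 i <= b (lift ord0 i)]).
  rewrite product_measure1E//=; last first.
    rewrite (_ : [set x | _] = \bigcap_(i : 'I_n) ((fun x : 'rV[R]_n =>
        x ord0 i : measurableTypeR R) @^-1`
        `]a (lift ord0 i), b (lift ord0 i)]%classic)).
      apply: fin_bigcap_measurable; first exact: finite_finset.
      move=> i _; rewrite -[X in measurable X]setTI.
      by apply: measurable_coord => //; exact: measurable_itv.
    apply/seteqP; split=> x /= h i; first by move=> _; rewrite /= in_itv/= h.
    by have := h i I; rewrite /= in_itv.
  rewrite IH// lebesgue_measure_itv/= big_ord_recl EFinM lte_fin.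
  case: ifPn => //; rewrite -leNgt => ba.
  have -> : b ord0 = a ord0 by apply/eqP; rewrite eq_le ba ab.
  by rewrite subrr !mul0e.
apply/seteqP; split=> -[u x] /=.
  move=> h; split; first by have := h ord0; rewrite mxE unlift_none in_itv.
  by move=> i; have := h (lift ord0 i); rewrite mxE liftK.
rewrite in_itv/= => -[hu hx] i; rewrite mxE.
by case: (unliftP ord0 i) => [j ->|->].
Qed.

Section complex_integral.
Context {disp : measure_display} {T : measurableType disp} {R : realType}.
Variables (mu : {measure set T -> \bar R}) (h : T -> R[i]).

Definition integrableC : Prop :=
  mu.-integrable setT (fun x => (complex.Re (h x))%:E) /\
  mu.-integrable setT (fun x => (complex.Im (h x))%:E).

Definition integralC : R[i] :=
  @Complex R (\int[mu]_x complex.Re (h x)) (\int[mu]_x complex.Im (h x)).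

End complex_integral.

Definition cis {R : realType} (t : R) : R[i] := @Complex R (cos t) (sin t).

Section euclidean.
Context {R : realType} {d : nat}.
Implicit Types x y : 'rV[R]_d.

Definition dot x y : R := \sum_(i < d) x ord0 i * y ord0 i.

(* The library norm on 'rV[R]_d is the sup norm. *)
Definition enorm x : R := Num.sqrt (dot x x).

End euclidean.

Section schwartz.
Context {R : realType} {d : nat}.
Local Notation E := 'rV[R]_d.
Local Notation C := R[i].
Implicit Types (f g : E -> C) (u : (E -> C) -> C).

(* Derivatives are taken on real and imaginary parts, R[i] having no
   normed space structure over R in the library. *)
Definition pderiv (i : 'I_d) f : E -> C := fun x =>
  @Complex R ('D_('e_i) (fun y => complex.Re (f y)) x) ('D_('e_i) (fun y => complex.Im (f y)) x).

Definition pderivs (s : seq 'I_d) f : E -> C := foldr pderiv f s.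

(* C^oo: all iterated partial derivatives, in any order, exist everywhere
   and are continuous. *)
Definition smooth f : Prop := forall s : seq 'I_d,
  [/\ forall i x, derivable (fun y => complex.Re (pderivs s f y)) x 'e_i,
      forall i x, derivable (fun y => complex.Im (pderivs s f y)) x 'e_i,
      continuous (fun y => complex.Re (pderivs s f y)) &
      continuous (fun y => complex.Im (pderivs s f y))].

Definition seminorm (N : nat) f : \bar R :=
  ereal_sup [set r | exists (s : seq 'I_d) (x : E), (size s <= N)%N /\
    r = ((1 + enorm x) ^+ N * Normc.normc (pderivs s f x))%:E].

Definition schwartz f : Prop :=
  smooth f /\ forall N, (seminorm N f < +oo)%E.

(* A tempered distribution is represented by a total function of which only
   the values at Schwartz functions matter; linearity and continuity are
   required there only, and every use below evaluates it there.  Continuity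
   is domination by one of the (increasing) seminorms above. *)
Definition tempered u : Prop :=
  (forall (a : C) f g, schwartz f -> schwartz g ->
     u (fun y => a * f y + g y) = a * u f + u g) /\
  (exists (N : nat) (c : R), forall f, schwartz f ->
     ((Normc.normc (u f))%:E <= c%:E * seminorm N f)%E).

Definition inner f g : C := integralC (leb R d) (fun y => f y * conjc (g y)).

Definition bracket u g : C := u (fun y => conjc (g y)).

Definition regular f : (E -> C) -> C :=
  fun g => integralC (leb R d) (fun y => f y * g y).

Definition conj_distr u : (E -> C) -> C :=
  fun g => conjc (u (fun y => conjc (g y))).

Definition mul_distr u f : (E -> C) -> C :=
  fun g => u (fun y => f y * g y).

End schwartz.

Section fresnel.
Context {R : realType} {d : nat}.
Local Notation E := 'rV[R]_d.
Local Notation C := R[i].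
Variable hbar : R.
Implicit Types (g gamma phi : E -> C) (u f : (E -> C) -> C).

Definition tf_shift (x xi : E) g : E -> C := fun y =>
  ((2 * pi * hbar) `^ (- (d%:R / 2)))%:C%C * cis (dot xi y / hbar) * g (y - x).

Definition gabor g u (x xi : E) : C := bracket u (tf_shift x xi g).

Definition gabor_conj g u (x xi : E) : C := conjc (gabor g (conj_distr u) x xi).

Definition W_infty_1 f : Prop :=
  tempered f /\
  exists g, [/\ schwartz g, exists y, g y != 0 &
    (\int[leb R d]_x
       ereal_sup [set (Normc.normc (gabor g f x xi))%:E | xi in setT]
     < +oo)%E].

(* (2 pi i hbar)^(-d/2) = (2 pi hbar)^(-d/2) e^(-i pi d/4) *)
Definition Fplus : E -> C := fun x =>
  ((2 * pi * hbar) `^ (- (d%:R / 2)))%:C%C * cis (- (pi * d%:R / 4)) *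
  cis (dot x x / (2 * hbar)).

Definition gabor_integrand g gamma f : E * E -> C := fun z =>
  gabor g (regular Fplus) z.1 z.2 * gabor_conj gamma f z.1 z.2.

Definition gabor_pairing g gamma f : C :=
  (inner gamma g)^-1 *
  integralC (leb R d \x leb R d)%E (gabor_integrand g gamma f).

Definition dilate (eps : R) phi : E -> C := fun x => phi (eps *: x).

(* The limit is L for every admissible phi, g, gamma; the integrals under the
   limit are required to be absolutely convergent, since integralC is total. *)
Definition has_fresnel_integral f (L : C) : Prop :=
  forall phi g gamma, schwartz phi -> phi 0 = 1 ->
    schwartz g -> schwartz gamma -> inner gamma g != 0 ->
    (forall eps : R, 0 < eps ->
       integrableC (leb R d \x leb R d)%E
         (gabor_integrand g gamma (mul_distr f (dilate eps phi)))) /\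
    (Normc.normc (gabor_pairing g gamma (mul_distr f (dilate eps phi)) - L)
       @[eps --> 0^'+] --> (0 : R)).

Definition fresnel_integrable f : Prop := exists L, has_fresnel_integral f L.

(* Junk value 0 when f is not Fresnel integrable. *)
Definition fresnel_integral f : C := xget 0 [set L | has_fresnel_integral f L].

End fresnel.

(* Main.v *)
(** Completing the square, [V_g F_+ (x, xi)] is, up to a unimodular factor, the
    Fourier transform at [xi - x] of the Schwartz function [F_+ * conj g]; so it is
    integrable in [xi], uniformly in [x], and pairs absolutely with any [V f] whose
    supremum over [xi] is integrable in [x].  That this property of [f] does not
    depend on the window follows from [u (m * h) = K^-1 \int FT m (p) u (e_p h) dp],
    which also gives
    [sup_xi |V (f phi_eps)| <= C * ||FT phi_eps||_1 * sup_xi |V f|], where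
    [||FT phi_eps||_1] does not depend on [eps]; dominated convergence then lets
    [eps] tend to 0.

    The limit is independent of the windows because the regularised pairing of [f]
    is [c^2 * K * f (F_+ * phi_eps)] for all of them, by Fourier inversion in [xi]
    and translation invariance in [x].  Fourier inversion is only needed up to a
    nonzero constant [K]. *)

Require Import Defs.
From mathcomp Require Import all_boot all_order all_algebra.
From mathcomp Require Import complex.
From mathcomp Require Import ring lra.
From mathcomp Require Import all_classical all_reals all_analysis measurable_realfun.
Import Order.TTheory GRing.Theory Num.Theory.
Import numFieldNormedType.Exports.
Local Open Scope classical_set_scope.
Local Open Scope ring_scope.
Set Implicit Arguments.
Unset Strict Implicit.
Unset Printing Implicit Defensive.

(** The obstacle is that f acts on Schwartz functions only through finitely many seminorms, while
    the argument keeps needing f of an average: over modulations, to multiply by m, and over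
    translations, to change windows. Both exchanges come from one quadrature estimate whose error is
    uniform over a class of integrands; applied to every partial derivative at every point, it gives
    convergence in a seminorm. It asks of the family a bound and a Lipschitz bound in the parameter,
    with a common integrable majorant. This is why estimates are kept as explicit majorants ([dle]),
    why a mean value inequality with decay is proved early, and why one derivative or one power of
    decay is regularly given away. Constants are generous: complex integrals are bounded through
    their real and imaginary parts, and only finiteness matters. The cutoff makes F_+ phi_eps a
    Schwartz function, on which f has a value, and it costs nothing in the limit, since phi_eps - 1
    is O(eps) at the price of one power of the weight. *)

Local Notation nrm := (@Normc.normc _).

(** * Complex-valued integrals *)

Section complex_norm.
Context {R : realType}.
Implicit Types z w : R[i].

Lemma nrm_ge0 z : 0 <= nrm z.
Proof. by case: z => a b; rewrite /= sqrtr_ge0. Qed.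

Lemma nrmM z w : nrm (z * w) = nrm z * nrm w.
Proof. exact: Normc.normcM. Qed.

Lemma nrmD z w : nrm (z + w) <= nrm z + nrm w.
Proof. exact: le_normcD. Qed.

Lemma nrmN z : nrm (- z) = nrm z.
Proof. by case: z => a b /=; rewrite !sqrrN. Qed.

Lemma nrm_distC z w : nrm (z - w) = nrm (w - z).
Proof. by rewrite -nrmN opprB. Qed.

Lemma nrm_conj z : nrm (conjc z) = nrm z.
Proof. by case: z => a b /=; rewrite sqrrN. Qed.

Lemma nrm0 : nrm (0 : R[i]) = 0.
Proof. exact: Normc.normc0. Qed.

Lemma nrm1 : nrm (1 : R[i]) = 1.
Proof. exact: Normc.normc1. Qed.

Lemma nrm_eq0 z : (nrm z == 0) = (z == 0).
Proof.
apply/eqP/eqP => [|->]; last exact: nrm0.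
exact: Normc.eq0_normc.
Qed.

Lemma nrm_real (r : R) : nrm r%:C%C = `|r|.
Proof. by rewrite /= expr0n /= addr0 sqrtr_sqr. Qed.

Lemma nrm_cis (t : R) : nrm (cis t) = 1.
Proof. by rewrite /= cos2Dsin2 sqrtr1. Qed.

Lemma Re_le_nrm z : `|complex.Re z| <= nrm z.
Proof.
by case: z => a b /=; rewrite -sqrtr_sqr ler_wsqrtr// lerDl sqr_ge0.
Qed.

Lemma Im_le_nrm z : `|complex.Im z| <= nrm z.
Proof.
by case: z => a b /=; rewrite -sqrtr_sqr ler_wsqrtr// lerDr sqr_ge0.
Qed.

Lemma nrm_le_ReIm z : nrm z <= `|complex.Re z| + `|complex.Im z|.
Proof.
case: z => a b /=; rewrite -[leRHS]ger0_norm ?addr_ge0//.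
rewrite -sqrtr_sqr ler_wsqrtr// -(real_normK (num_real a)).
rewrite -(real_normK (num_real b)) sqrrD lerD2r lerDl.
by rewrite mulrn_wge0 ?mulr_ge0.
Qed.

Lemma ReD z w : complex.Re (z + w) = complex.Re z + complex.Re w.
Proof. by case: z; case: w. Qed.

Lemma ImD z w : complex.Im (z + w) = complex.Im z + complex.Im w.
Proof. by case: z; case: w. Qed.

Lemma ReM z w : complex.Re (z * w) =
  complex.Re z * complex.Re w - complex.Im z * complex.Im w.
Proof. by case: z; case: w. Qed.

Lemma ImM z w : complex.Im (z * w) =
  complex.Re z * complex.Im w + complex.Im z * complex.Re w.
Proof. by case: z; case: w. Qed.

Lemma ReN z : complex.Re (- z) = - complex.Re z.
Proof. by case: z. Qed.

Lemma ImN z : complex.Im (- z) = - complex.Im z.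
Proof. by case: z. Qed.

Lemma complexP z w : complex.Re z = complex.Re w -> complex.Im z = complex.Im w ->
  z = w.
Proof. by case: z; case: w => a b c d /= -> ->. Qed.

Lemma cisD (s t : R) : cis (s + t) = cis s * cis t.
Proof. by rewrite /cis cosD sinD; apply: complexP => //=; rewrite addrC. Qed.

Lemma cis0 : cis (0 : R) = 1.
Proof. by rewrite /cis cos0 sin0. Qed.

Lemma conj_cis (t : R) : conjc (cis t) = cis (- t).
Proof. by rewrite /cis cosN sinN. Qed.

Lemma conjM z w : conjc (z * w) = conjc z * conjc w.
Proof. exact: rmorphM. Qed.

Lemma conj_realc (r : R) : conjc r%:C%C = r%:C%C.
Proof. by rewrite /= oppr0. Qed.

Lemma mul_conjc z : z * conjc z = (nrm z ^+ 2)%:C%C.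
Proof.
case: z => a b; rewrite /= sqr_sqrtr ?addr_ge0 ?sqr_ge0//.
by apply: complexP => /=; ring.
Qed.

End complex_norm.

Section complex_integrals.
Context {d0 : measure_display} {T : measurableType d0} {R : realType}.
Implicit Types h k : T -> R[i].

Definition measC h := measurable_fun setT (fun x => complex.Re (h x)) /\
  measurable_fun setT (fun x => complex.Im (h x)).

Lemma measC_cst (c : R[i]) : measC (fun=> c).
Proof. by split; exact: measurable_cst. Qed.

Lemma measCD h k : measC h -> measC k -> measC (fun x => h x + k x).
Proof.
move=> [h1 h2] [k1 k2]; split.
  by under eq_fun do rewrite ReD; exact: measurable_funD.
by under eq_fun do rewrite ImD; exact: measurable_funD.
Qed.

Lemma measCN h : measC h -> measC (fun x => - h x).
Proof.
move=> [h1 h2]; split.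
  by under eq_fun do rewrite ReN; exact: measurableT_comp.
by under eq_fun do rewrite ImN; exact: measurableT_comp.
Qed.

Lemma measCB h k : measC h -> measC k -> measC (fun x => h x - k x).
Proof. by move=> mh mk; apply: measCD => //; exact: measCN. Qed.

Lemma measCM h k : measC h -> measC k -> measC (fun x => h x * k x).
Proof.
move=> [h1 h2] [k1 k2]; split.
  by under eq_fun do rewrite ReM; apply: measurable_funB; exact: measurable_funM.
by under eq_fun do rewrite ImM; apply: measurable_funD; exact: measurable_funM.
Qed.

Lemma measC_conj h : measC h -> measC (fun x => conjc (h x)).
Proof.
move=> [h1 h2]; split.
  by apply: eq_measurable_fun h1 => x _; case: (h x).
rewrite (_ : (fun x => _) = (fun x => - complex.Im (h x))).
  exact: measurableT_comp.
by apply/funext => x; case: (h x).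
Qed.

Lemma measC_real (f : T -> R) : measurable_fun setT f ->
  measC (fun x => (f x)%:C%C).
Proof. by move=> mf; split => //=; exact: measurable_cst. Qed.

Lemma measurable_nrm h : measC h -> measurable_fun setT (fun x => nrm (h x)).
Proof.
move=> [h1 h2].
rewrite (_ : (fun x => _) = (fun x =>
   Num.sqrt (complex.Re (h x) ^+ 2 + complex.Im (h x) ^+ 2))); last first.
  by apply/funext => x; case: (h x).
apply: (measurableT_comp (measurable_funTS _)).
  by apply: continuous_measurable_fun; exact: sqrt_continuous.
by apply: measurable_funD; exact: measurable_funX.
Qed.

Variable mu : {measure set T -> \bar R}.

Lemma integrableC_dom h (W : T -> \bar R) : measC h -> mu.-integrable setT W ->
  (forall x, ((nrm (h x))%:E <= W x)%E) -> integrableC mu h.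
Proof.
move=> [h1 h2] iW hW; split.
  apply: le_integrable iW => //; first exact/measurable_EFinP.
  move=> x _; apply: le_trans (le_trans (hW x) (lee_abs _)).
  by rewrite /= lee_fin Re_le_nrm.
apply: le_integrable iW => //; first exact/measurable_EFinP.
move=> x _; apply: le_trans (le_trans (hW x) (lee_abs _)).
by rewrite /= lee_fin Im_le_nrm.
Qed.

Lemma integrableC_measC h : integrableC mu h -> measC h.
Proof.
by move=> [/integrableP[h1 _] /integrableP[h2 _]]; split; apply/measurable_EFinP.
Qed.

Lemma integrable_nrm h : integrableC mu h ->
  mu.-integrable setT (fun x => (nrm (h x))%:E).
Proof.
move=> ih; have [h1 h2] := ih.
apply: le_integrable (integrableD _ (integrable_abse h1) (integrable_abse h2)) => //.
  by apply/measurable_EFinP; apply: measurable_nrm; exact: integrableC_measC.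
move=> x _; rewrite /= lee_fin ger0_norm ?nrm_ge0//.
by rewrite [leRHS]ger0_norm ?addr_ge0// nrm_le_ReIm.
Qed.

Lemma integrableC_lty h : measC h ->
  (\int[mu]_x (nrm (h x))%:E < +oo)%E -> integrableC mu h.
Proof.
move=> mh hoo; apply: (integrableC_dom (W := fun x => (nrm (h x))%:E)) => //.
apply/integrableP; split; first by apply/measurable_EFinP; exact: measurable_nrm.
under eq_integral do rewrite gee0_abs ?lee_fin ?nrm_ge0//.
by [].
Qed.

Lemma integrableCD h k : integrableC mu h -> integrableC mu k ->
  integrableC mu (fun x => h x + k x).
Proof.
move=> [h1 h2] [k1 k2]; split.
  rewrite (_ : (fun x => _) = ((fun x => (complex.Re (h x))%:E) \+
    (fun x => (complex.Re (k x))%:E))%E); first exact: integrableD.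
  by apply/funext => x; rewrite ReD.
rewrite (_ : (fun x => _) = ((fun x => (complex.Im (h x))%:E) \+
  (fun x => (complex.Im (k x))%:E))%E); first exact: integrableD.
by apply/funext => x; rewrite ImD.
Qed.

Lemma integrableCZ (c : R[i]) h : integrableC mu h ->
  integrableC mu (fun x => c * h x).
Proof.
move=> ih.
apply: (integrableC_dom _ (integrableZl measurableT (nrm c) (integrable_nrm ih))).
  exact: (measCM (measC_cst _) (integrableC_measC ih)).
by move=> x; rewrite nrmM EFinM.
Qed.

Lemma integrableC0 : integrableC mu (fun=> 0).
Proof. by split; exact: integrable0. Qed.

Lemma integrableC_sum (I : Type) (s : seq I) (F : I -> T -> R[i]) :
  (forall i, integrableC mu (F i)) ->
  integrableC mu (fun x => \sum_(i <- s) F i x).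
Proof.
move=> mF; elim: s => [|i s IH].
  by under eq_fun do rewrite big_nil; exact: integrableC0.
by under eq_fun do rewrite big_cons; exact: integrableCD.
Qed.

Lemma integrableC_conj h : integrableC mu h ->
  integrableC mu (fun x => conjc (h x)).
Proof.
move=> ih; apply: (integrableC_dom _ (integrable_nrm ih)).
  exact/measC_conj/integrableC_measC.
by move=> x; rewrite nrm_conj.
Qed.

Lemma eq_integralC h k : h =1 k -> integralC mu h = integralC mu k.
Proof. by move=> /funext ->. Qed.

Lemma integralCD h k : integrableC mu h -> integrableC mu k ->
  integralC mu (fun x => h x + k x) = integralC mu h + integralC mu k.
Proof.
move=> [h1 h2] [k1 k2]; apply: complexP; rewrite ?ReD ?ImD /=.
  by under eq_Rintegral do rewrite ReD; exact: RintegralD.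
by under eq_Rintegral do rewrite ImD; exact: RintegralD.
Qed.

Lemma integralCZ (c : R[i]) h : integrableC mu h ->
  integralC mu (fun x => c * h x) = c * integralC mu h.
Proof.
move=> [h1 h2].
have Zl (a : R) (f : T -> R) : mu.-integrable setT (EFin \o f) ->
    mu.-integrable setT (EFin \o (fun x => a * f x)).
  by move=> /(integrableZl measurableT a).
apply: complexP; rewrite ?ReM ?ImM /=.
  under eq_Rintegral do rewrite ReM.
  by rewrite RintegralB ?RintegralZl//; exact: Zl.
under eq_Rintegral do rewrite ImM.
by rewrite RintegralD ?RintegralZl//; exact: Zl.
Qed.

Lemma integralCB h k : integrableC mu h -> integrableC mu k ->
  integralC mu (fun x => h x - k x) = integralC mu h - integralC mu k.
Proof.
move=> ih ik; have ik' := integrableCZ (-1) ik.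
rewrite -[X in _ = _ + X]mulN1r -integralCZ// -integralCD//.
by apply: eq_integralC => x; rewrite mulN1r.
Qed.

Lemma integrableCB h k : integrableC mu h -> integrableC mu k ->
  integrableC mu (fun x => h x - k x).
Proof.
move=> ih ik; have := integrableCD ih (integrableCZ (-1) ik).
by under eq_fun do rewrite mulN1r.
Qed.

Lemma integralC0 : integralC mu (fun=> 0) = 0.
Proof. by apply: complexP => /=; rewrite /Rintegral integral0. Qed.

Lemma integralC_sum (I : Type) (s : seq I) (F : I -> T -> R[i]) :
  (forall i, integrableC mu (F i)) ->
  integralC mu (fun x => \sum_(i <- s) F i x) = \sum_(i <- s) integralC mu (F i).
Proof.
move=> mF; elim: s => [|i s IH].
  by under eq_integralC do rewrite big_nil; rewrite big_nil integralC0.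
under eq_integralC do rewrite big_cons.
by rewrite big_cons integralCD ?IH//; exact: integrableC_sum.
Qed.

Lemma integralC_conj h : integrableC mu h ->
  integralC mu (fun x => conjc (h x)) = conjc (integralC mu h).
Proof.
move=> [h1 h2]; apply: complexP => /=.
  by apply: eq_Rintegral => x _; case: (h x).
rewrite -mulN1r -RintegralZl//; apply: eq_Rintegral => x _.
by case: (h x) => a b; rewrite /= mulN1r.
Qed.

(** The factor 2 comes from bounding the real and imaginary parts separately. *)
Lemma nrm_integralC_le h (W : T -> R) : integrableC mu h ->
  mu.-integrable setT (EFin \o W) -> (forall x, nrm (h x) <= W x) ->
  nrm (integralC mu h) <= 2 * \int[mu]_x W x.
Proof.
move=> [h1 h2] iW hW; apply: (le_trans (nrm_le_ReIm _)) => /=.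
rewrite mulr_natl mulr2n; apply: lerD.
  apply: (le_trans (le_normr_Rintegral _ _)) => //; apply: le_Rintegral => //.
    exact: (integrable_abse h1).
  by move=> x _; exact: le_trans (Re_le_nrm _) (hW x).
apply: (le_trans (le_normr_Rintegral _ _)) => //; apply: le_Rintegral => //.
  exact: (integrable_abse h2).
by move=> x _; exact: le_trans (Im_le_nrm _) (hW x).
Qed.

(** Extended-real majorants are needed because W will be built from [stft_sup], which may be
    infinite at some points. *)
Lemma nrm_integralC_lee h (W : T -> \bar R) : integrableC mu h ->
  measurable_fun setT W -> (forall x, ((nrm (h x))%:E <= W x)%E) ->
  ((nrm (integralC mu h))%:E <= 2%:E * \int[mu]_x W x)%E.
Proof.
move=> ih mW hW.
have := nrm_integralC_le ih (integrable_nrm ih) (fun x => lexx _).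
rewrite -lee_fin EFinM => /le_trans; apply.
apply: lee_pmul => //.
  by rewrite lee_fin Rintegral_ge0// => x _; exact: nrm_ge0.
rewrite /Rintegral fineK; last exact/integrable_fin_num/integrable_nrm.
apply: ge0_le_integral => //.
- by move=> x _; rewrite lee_fin nrm_ge0.
- by apply/measurable_EFinP; apply: measurable_nrm; exact: integrableC_measC.
Qed.

(** Dominated convergence. Limits in R[i] are expressed throughout as a norm tending to 0 in R; one
    argument, abstract in the projection p, serves both real and imaginary parts. *)
Lemma nrm_integralC_cvg (h_ : (T -> R[i])^nat) h (W : T -> \bar R) :
  (forall n, measC (h_ n)) -> measC h ->
  (forall x, nrm (h_ n x - h x) @[n --> \oo] --> (0 : R)) ->
  mu.-integrable setT W ->
  (forall n x, ((nrm (h_ n x))%:E <= W x)%E) ->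
  nrm (integralC mu (h_ n) - integralC mu h) @[n --> \oo] --> (0 : R).
Proof.
move=> mh_ mh cvgh iW hW.
have part (p : R[i] -> R) : (forall z, `|p z| <= nrm z) ->
    (forall z w, p (z - w) = p z - p w) ->
    (forall n, measurable_fun setT (fun x => p (h_ n x))) ->
    measurable_fun setT (fun x => p (h x)) ->
    \int[mu]_x p (h_ n x) @[n --> \oo] --> \int[mu]_x p (h x).
  move=> pn pB mp_ mp.
  have [] := @dominated_convergence _ _ _ mu setT measurableT
    (fun n x => (p (h_ n x))%:E) (fun x => (p (h x))%:E) W.
  - by move=> n; exact/measurable_EFinP.
  - exact/measurable_EFinP.
  - apply/aeW => x _; apply: cvg_EFin; first by near=> n.
    apply/cvgrPdist_le => e e0.
    have /cvgrPdist_le/(_ _ e0) := cvgh x; apply: filterS => n /=.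
    rewrite sub0r normrN (ger0_norm (nrm_ge0 _)); apply: le_trans.
    by rewrite distrC -pB pn.
  - exact: iW.
  - apply/aeW => x n _; apply: le_trans (hW n x).
    by rewrite abse_EFin lee_fin.
  move=> i1 _; rewrite /Rintegral.
  rewrite -[X in _ --> X -> _]fineK ?integrable_fin_num//.
  by move/fine_cvg; exact.
have cR := part (@complex.Re R) Re_le_nrm
  (fun z w => etrans (ReD _ _) (congr1 _ (ReN _))) (fun n => (mh_ n).1) mh.1.
have cI := part (@complex.Im R) Im_le_nrm
  (fun z w => etrans (ImD _ _) (congr1 _ (ImN _))) (fun n => (mh_ n).2) mh.2.
apply: (@squeeze_cvgr _ _ _ _ (fun=> 0)
  (fun n => `|\int[mu]_x complex.Re (h_ n x) - \int[mu]_x complex.Re (h x)| +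
   `|\int[mu]_x complex.Im (h_ n x) - \int[mu]_x complex.Im (h x)|)).
- near=> n; rewrite nrm_ge0 andTb; apply: (le_trans (nrm_le_ReIm _)).
  by rewrite ReD ReN ImD ImN.
- exact: cvg_cst.
- rewrite -[X in _ --> X]addr0; apply: cvgD.
    by apply/norm_cvg0P; apply/subr_cvg0.
  by apply/norm_cvg0P; apply/subr_cvg0.
Unshelve. all: by end_near. Qed.

End complex_integrals.

Lemma measC_comp d1 d2 (T1 : measurableType d1) (T2 : measurableType d2)
    (R : realType) (f : T1 -> T2) (h : T2 -> R[i]) :
  measurable_fun setT f -> measC h -> measC (fun x => h (f x)).
Proof. by move=> mf [h1 h2]; split; [exact: measurableT_comp h1 mf|exact: measurableT_comp h2 mf]. Qed.

(** * Iterated integrals of complex functions *)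

Section complex_fubini.
Context d1 d2 (T1 : measurableType d1) (T2 : measurableType d2) (R : realType).
Variables (m1 : {sigma_finite_measure set T1 -> \bar R}).
Variables (m2 : {sigma_finite_measure set T2 -> \bar R}).
Variable h : T1 * T2 -> R[i].

Lemma integrableC_prod1 : measC h ->
  (\int[m1]_x \int[m2]_y (nrm (h (x, y)))%:E < +oo)%E ->
  integrableC (m1 \x m2)%E h.
Proof.
move=> mh hoo; apply: integrableC_lty => //; rewrite fubini_tonelli1//=.
  by apply/measurable_EFinP; exact: measurable_nrm.
by move=> z; rewrite lee_fin nrm_ge0.
Qed.

Hypothesis ih : integrableC (m1 \x m2)%E h.

(** Integrability on the product only makes almost every section integrable; asking it of every
    section lets [fine] be undone pointwise in the inner integral. *)
Lemma integralC_prod1 : (forall x, integrableC m2 (fun y => h (x, y))) ->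
  integralC (m1 \x m2)%E h = integralC m1 (fun x => integralC m2 (fun y => h (x, y))).
Proof.
move=> ihx; apply: complexP; rewrite /= /Rintegral; congr fine.
  rewrite -integral12_prod_meas1; last exact: ih.1.
  by apply: eq_integral => x _; rewrite fineK// integrable_fin_num//; exact: (ihx x).1.
rewrite -integral12_prod_meas1; last exact: ih.2.
by apply: eq_integral => x _; rewrite fineK// integrable_fin_num//; exact: (ihx x).2.
Qed.

Lemma integralC_prod2 : (forall y, integrableC m1 (fun x => h (x, y))) ->
  integralC (m1 \x m2)%E h = integralC m2 (fun y => integralC m1 (fun x => h (x, y))).
Proof.
move=> ihx; apply: complexP; rewrite /= /Rintegral; congr fine.
  rewrite -integral21_prod_meas1; last exact: ih.1.
  by apply: eq_integral => x _; rewrite fineK// integrable_fin_num//; exact: (ihx x).1.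
rewrite -integral21_prod_meas1; last exact: ih.2.
by apply: eq_integral => x _; rewrite fineK// integrable_fin_num//; exact: (ihx x).2.
Qed.

End complex_fubini.

(** * Affine changes of variables *)

Section affine_line.
Context {R : realType}.
Variables (a c : R) (c0 : c != 0).
Let phi : measurableTypeR R -> measurableTypeR R := fun t => a + c * t.

Let mphi : measurable_fun setT phi.
Proof. by apply: measurable_funD => //; exact: measurable_funM. Qed.

Let image_measure : {measure set (measurableTypeR R) -> \bar R} :=
  measure_function_pushforward__canonical__measure_function_Measure
    lebesgue_measure mphi.

Let c_ge0 : 0 <= `|c|. Proof. exact: normr_ge0. Qed.

Let nu : {measure set (measurableTypeR R) -> \bar R} :=
  mscale (NngNum c_ge0) image_measure.

(** Half-open intervals determine Lebesgue measure. For c < 0 the preimage of such an interval is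
    half-open on the other side, which leaves its length unchanged. *)
Let nuE A : measurable A -> lebesgue_measure A = nu A.
Proof.
apply: lebesgue_measure_unique => _ [[u v]] _ <-; rewrite /nu /= /mscale /= /pushforward /=.
have c1 : 0 < `|c| by rewrite normr_gt0.
have [c2|c2|/eqP] := ltgtP c 0; last by rewrite (negbTE c0).
- rewrite (_ : _ @^-1` _ = `[(v - a) / c, (u - a) / c[%classic); last first.
    apply/seteqP; split=> t /=; rewrite !in_itv /= /phi.
      by rewrite ler_ndivrMr// ltr_ndivlMr// [t * c]mulrC; lra.
    by rewrite ler_ndivrMr// ltr_ndivlMr// [t * c]mulrC; lra.
  rewrite !lebesgue_measure_itv/= !lte_fin ltr_nM2r ?invr_lt0// ltrD2r.
  case: ifP => _; last by rewrite mule0.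
  rewrite -!EFinB -EFinM ltr0_norm//; congr EFin.
  by rewrite -mulrBl mulNr mulrCA divff// mulr1; ring.
- rewrite (_ : _ @^-1` _ = `](u - a) / c, (v - a) / c]%classic); last first.
    apply/seteqP; split=> t /=; rewrite !in_itv /= /phi.
      by rewrite ler_pdivlMr// ltr_pdivrMr// [t * c]mulrC; lra.
    by rewrite ler_pdivlMr// ltr_pdivrMr// [t * c]mulrC; lra.
  rewrite !lebesgue_measure_itv/= !lte_fin ltr_pM2r ?invr_gt0// ltrD2r.
  case: ifP => _; last by rewrite mule0.
  rewrite -!EFinB -EFinM gtr0_norm//; congr EFin.
  by rewrite -mulrBl mulrCA divff// mulr1; ring.
Qed.

Lemma ge0_integral_affine1 (f : measurableTypeR R -> \bar R) :
  measurable_fun setT f -> (forall t, 0 <= f t)%E ->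
  (\int[lebesgue_measure]_t f t =
   `|c|%:E * \int[lebesgue_measure]_t f (a + c * t)%R)%E.
Proof.
move=> mf f0; rewrite (eq_measure_integral nu); last by move=> A mA _; exact: nuE.
rewrite (ge0_integral_mscale image_measure measurableT (NngNum c_ge0))//.
by rewrite (ge0_integral_pushforward mphi).
Qed.

End affine_line.

Section leb_integral.
Context {R : realType}.

Lemma ge0_integral_lebS n (f : 'rV[R]_n.+1 -> \bar R) :
  measurable_fun setT f -> (forall x, 0 <= f x)%E ->
  (\int[leb R n.+1]_x f x =
   \int[lebesgue_measure]_t \int[leb R n]_x f (rV_cons (t, x)))%E.
Proof.
move=> mf f0.
transitivity (\int[lebesgue_measure \x leb R n]_z f (rV_cons z))%E.
  by rewrite /= (ge0_integral_pushforward measurable_rV_cons).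
rewrite (fubini_tonelli1 (f \o rV_cons))//.
  exact: (measurableT_comp mf measurable_rV_cons).
by move=> z; exact: f0.
Qed.

Lemma measurable_affine d (a : 'rV[R]_d) (c : R) :
  measurable_fun setT (fun x : 'rV[R]_d => a + c *: x).
Proof.
apply/measurable_fun_coordP => i; under eq_fun do rewrite !mxE.
apply: measurable_funD => //; apply: measurable_funM => //.
exact: measurable_coord.
Qed.

(** Induction on the dimension: the first coordinate contributes one factor |c| by the
    one-dimensional case, the remaining ones, with offset a', the other n. *)
Lemma ge0_integral_affine d (a : 'rV[R]_d) (c : R) (f : 'rV[R]_d -> \bar R) :
  c != 0 -> measurable_fun setT f -> (forall x, 0 <= f x)%E ->
  (\int[leb R d]_x f x = (`|c| ^+ d)%:E * \int[leb R d]_x f (a + c *: x)%R)%E.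
Proof.
move=> c0; elim: d a f => [|n IH] a f mf f0.
  rewrite expr0 mul1e; apply: eq_integral => x _; congr f.
  by apply/rowP; case.
have mfa : measurable_fun setT (fun x : 'rV[R]_n.+1 => f (a + c *: x)).
  exact: (measurableT_comp mf (measurable_affine _ _)).
pose a' : 'rV[R]_n := \row_j a ord0 (lift ord0 j).
have consE t x : a + c *: rV_cons (t, x) = rV_cons (a ord0 ord0 + c * t, a' + c *: x).
  by apply/rowP => i; rewrite !mxE; case: unliftP => [j ->|->] //=; rewrite !mxE.
rewrite !ge0_integral_lebS//.
have mF : measurable_fun setT (fun z => f (rV_cons z)).
  exact: (measurableT_comp mf measurable_rV_cons).
rewrite (ge0_integral_affine1 (a ord0 ord0) c0); last 2 first.
- by apply: (measurable_fun_fubini_tonelli_F (f \o rV_cons)) => //= z; exact: f0.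
- by move=> t; exact: integral_ge0.
rewrite exprS EFinM -muleA; congr (_ * _)%E.
rewrite -ge0_integralZl//; last 2 first.
- apply: (measurable_fun_fubini_tonelli_F
    (fun z : measurableTypeR R * 'rV[R]_n => f (a + c *: rV_cons z))) => //=.
  exact: (measurableT_comp mfa measurable_rV_cons).
- by move=> t _; exact: integral_ge0.
apply: eq_integral => t _.
under [in RHS]eq_integral do rewrite consE.
rewrite -(IH a' (fun x => f (rV_cons (a ord0 ord0 + c * t, x))))//.
exact: (measurable_fun_pair2 _ mF).
Qed.

Lemma integrableC_affine d (a : 'rV[R]_d) (c : R) (h : 'rV[R]_d -> R[i]) :
  c != 0 -> integrableC (leb R d) h -> integrableC (leb R d) (fun x => h (a + c *: x)).
Proof.
move=> c0 ih; have mh := integrableC_measC ih; apply: integrableC_lty.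
  exact: (measC_comp (measurable_affine _ _)).
have /integrableP[_] := integrable_nrm ih.
under eq_integral do rewrite gee0_abs ?lee_fin ?nrm_ge0//.
rewrite (ge0_integral_affine a c0); last 2 first.
- by apply/measurable_EFinP; exact: measurable_nrm.
- by move=> x; rewrite lee_fin nrm_ge0.
set I := (\int[_]_x _)%E => h1; rewrite ltey; apply/eqP => Iy; move: h1.
by rewrite Iy gt0_muley// ?ltxx// lte_fin exprn_gt0// normr_gt0.
Qed.


Lemma integralC_affine d (a : 'rV[R]_d) (c : R) (h : 'rV[R]_d -> R[i]) :
  c != 0 -> integrableC (leb R d) h ->
  integralC (leb R d) h =
  (`|c| ^+ d)%:C%C * integralC (leb R d) (fun x => h (a + c *: x)).
Proof.
move=> c0 ih; have ih' := integrableC_affine a c0 ih.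
have part (f : 'rV[R]_d -> R) : (leb R d).-integrable setT (EFin \o f) ->
    (leb R d).-integrable setT (fun x : 'rV[R]_d => (f (a + c *: x))%:E) ->
    \int[leb R d]_x f x = `|c| ^+ d * \int[leb R d]_x f (a + c *: x).
  move=> i1 i2; rewrite -RintegralZl//; congr fine.
  rewrite [RHS](_ : _ = (\int[leb R d]_x ((`|c| ^+ d)%:E * (f (a + c *: x))%:E))%E)//.
  rewrite integralZl//.
  have mf := measurable_int _ i1.
  have -> : (\int[leb R d]_x (f x)%:E = \int[leb R d]_x ((EFin \o f)^\+ x) -
    \int[leb R d]_x ((EFin \o f)^\- x))%E by exact: integralE.
  have -> : (\int[leb R d]_x (f (a + c *: x)%R)%:E =
    \int[leb R d]_x ((EFin \o f)^\+ (a + c *: x)%R) -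
    \int[leb R d]_x ((EFin \o f)^\- (a + c *: x)%R))%E.
    rewrite [LHS]integralE; congr (_ - _)%E; apply: eq_integral => x _.
      by rewrite !funeposE.
    by rewrite !funenegE.
  rewrite (@ge0_integral_affine _ a c)//; last exact: measurable_funepos.
  rewrite [X in (_ - X)%E](@ge0_integral_affine _ a c)//; last exact: measurable_funeneg.
  (* Distributing the scalar over the difference of positive and negative parts requires one of them
     to have finite integral. *)
  apply/esym/muleBr => //; apply: fin_num_adde_defl; rewrite fin_numN.
  have := integrable_neg_fin_num measurableT i2.
  by congr (_ \is a fin_num); apply: eq_integral => x _; rewrite !funenegE.
apply: complexP; rewrite ?ReM ?ImM /= mul0r ?subr0 ?addr0.
  by apply: part; [exact: ih.1|exact: ih'.1].
by apply: part; [exact: ih.2|exact: ih'.2].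
Qed.

End leb_integral.

(** * Topology and weights on row vectors *)

Section row_topology.
Context {R : realType} {d : nat}.
Local Notation E := 'rV[R]_d.
Implicit Types x y : E.

(** The sup-norm ball in coordinates, so that its measurability and volume reduce to intervals. *)
Definition cube x (e : R) : set E := [set y | forall i, `|x ord0 i - y ord0 i| < e].

Lemma nbhs_cubeP x (A : set E) :
  nbhs x A <-> exists2 e, 0 < e & cube x e `<=` A.
Proof.
split=> [/nbhs_ballP[e e0 xA]|[e e0 xA]].
  exists e => // y xy; apply: xA; split => // i j; rewrite !(ord1 i).
  exact: xy.
apply/nbhs_ballP; exists e => // y [_ xy]; apply: xA => i.
exact: xy.
Qed.

Lemma measurable_cube x e : measurable (cube x e).
Proof.
rewrite (_ : cube x e = \bigcap_(i : 'I_d) ((fun y : E =>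
    y ord0 i : measurableTypeR R) @^-1` `]x ord0 i - e, x ord0 i + e[%classic)).
  apply: fin_bigcap_measurable; first exact: finite_finset.
  move=> i _; rewrite -[X in measurable X]setTI.
  by apply: measurable_coord => //; exact: measurable_itv.
apply/seteqP; split=> y /= h i.
  by move=> _; have := h i; rewrite /= in_itv/= distrC ltr_distl.
by have := h i I; rewrite /= in_itv/= distrC ltr_distl.
Qed.

Lemma measurable_box (a b : 'I_d -> R) :
  measurable [set y : E | forall i, a i < y ord0 i <= b i].
Proof.
rewrite (_ : [set y | _] = \bigcap_(i : 'I_d) ((fun y : E =>
    y ord0 i : measurableTypeR R) @^-1` `]a i, b i]%classic)).
  apply: fin_bigcap_measurable; first exact: finite_finset.
  move=> i _; rewrite -[X in measurable X]setTI.
  by apply: measurable_coord => //; exact: measurable_itv.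
apply/seteqP; split=> y /= h i; first by move=> _; have := h i; rewrite /= in_itv.
by have := h i I; rewrite /= in_itv.
Qed.

(** These points are the centres of a countable base of cubes, and later the sample points of the
    Riemann sums. Codes that decode to nothing are sent to 0. *)
Definition rational_row (k : nat) : E :=
  map_mx ratr (odflt (0 : 'rV[rat]_d) (unpickle k)).

Lemma rational_row_dense x e : 0 < e -> exists k, cube (rational_row k) e x.
Proof.
move=> e0.
have q i : {q : rat | ratr q \in `]x ord0 i - e, x ord0 i + e[}.
  by apply/cid/rat_in_itvoo; lra.
exists (pickle (\row_i sval (q i) : 'rV[rat]_d)) => i.
rewrite /rational_row pickleK /= !mxE; case: (q i) => r /=.
by rewrite in_itv/= ltr_distl.
Qed.

Lemma natSinv_lt (e : R) : 0 < e -> exists n, n.+1%:R^-1 < e.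
Proof.
move=> e0; have [n _ h] := near_infty_natSinv_lt (PosNum e0).
by exists n; exact: (h n (leqnn n)).
Qed.

Lemma cube_shrink x e : 0 < e -> exists k n,
  cube (rational_row k) n.+1%:R^-1 x /\
  cube (rational_row k) n.+1%:R^-1 `<=` cube x e.
Proof.
move=> e0; have [n ne] := natSinv_lt (divr_gt0 e0 (ltr0n R 2)).
have n0 : (0 : R) < n.+1%:R^-1 by rewrite invr_gt0 ltr0n.
have [k kx] := rational_row_dense x n0.
exists k, n; split => // y ky i; rewrite [e]splitr.
rewrite (le_lt_trans (ler_distD (rational_row k ord0 i) _ _))// ltrD//.
  by rewrite distrC; exact: lt_trans (kx i) ne.
exact: lt_trans (ky i) ne.
Qed.

(** The sigma-algebra is generated by the coordinates, so second countability is what links it to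
    the topology: an open set is the union of the rational cubes it contains. *)
Lemma open_measurable_row (U : set E) : open U -> measurable U.
Proof.
move=> oU; pose V (kn : nat * nat) : set E := cube (rational_row kn.1) kn.2.+1%:R^-1.
rewrite (_ : U = \bigcup_kn (if `[< V kn `<=` U >] then V kn else set0)).
  apply: countable_bigcupT_measurable => [|kn]; first exact: countableP.
  by case: ifP => _ //; exact: measurable_cube.
apply/seteqP; split=> [x Ux|x [kn _]]; last by case: ifPn => // /asboolP; exact.
have /nbhs_cubeP[e e0 xU] : nbhs x U by exact: open_nbhs_nbhs.
have [k [n [kx ksub]]] := cube_shrink x e0.
exists (k, n) => //; rewrite asboolT//.
exact: subset_trans xU.
Qed.

(** The same with products of cubes; it turns joint continuity of the transform into measurability
    on the product space. *)
Lemma open_measurable_row2 (U : set (E * E)) : open U -> measurable U.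
Proof.
move=> oU; pose V (k : (nat * nat) * (nat * nat)) : set (E * E) :=
  cube (rational_row k.1.1) k.1.2.+1%:R^-1 `*` cube (rational_row k.2.1) k.2.2.+1%:R^-1.
rewrite (_ : U = \bigcup_k (if `[< V k `<=` U >] then V k else set0)).
  apply: countable_bigcupT_measurable => [|k]; first exact: countableP.
  by case: ifP => _ //; apply: measurableX; exact: measurable_cube.
apply/seteqP; split=> [[x y] Uxy|x [k _]]; last by case: ifPn => // /asboolP; exact.
have [[A B] /= [xA yB] ABU] : nbhs (x, y) U by exact: open_nbhs_nbhs.
have /nbhs_cubeP[e e0 xA'] := xA; have /nbhs_cubeP[e' e'0 yB'] := yB.
have [k [n [kx ksub]]] := cube_shrink x e0.
have [k' [n' [ky k'sub]]] := cube_shrink y e'0.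
exists ((k, n), (k', n')) => //; rewrite asboolT// => -[u v] [/= hu hv].
by apply: ABU; split => /=; [exact/xA'/ksub|exact/yB'/k'sub].
Qed.

Lemma continuous_measurable_row (f : E -> R) : continuous f ->
  measurable_fun setT (f : E -> measurableTypeR R).
Proof.
move=> /continuousP cf; apply: (measurability _ (RGenOpens.measurableE R)).
move=> _ [_ [a [b ->] <-]]; rewrite setTI.
exact: (open_measurable_row (cf `]a, b[%classic (@interval_open _ (BRight a) (BLeft b) isT isT))).
Qed.

Lemma continuous_measurable_row2 (f : E * E -> R) : continuous f ->
  measurable_fun setT (f : E * E -> measurableTypeR R).
Proof.
move=> /continuousP cf; apply: (measurability _ (RGenOpens.measurableE R)).
move=> _ [_ [a [b ->] <-]]; rewrite setTI.
exact: (open_measurable_row2 (cf `]a, b[%classic (@interval_open _ (BRight a) (BLeft b) isT isT))).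
Qed.

Lemma continuous_cubeP (f : E -> R) : continuous f <->
  forall x e, 0 < e -> exists2 r, 0 < r & forall y, cube x r y -> `|f x - f y| < e.
Proof.
split=> [cf x e e0|h x].
  have := cf x => /cvgrPdist_lt/(_ _ e0)/nbhs_cubeP[r r0 hr].
  by exists r => // y /hr.
apply/(@cvgrPdist_lt _ _ _ (nbhs x) (nbhs_filter x)) => e e0; apply/nbhs_cubeP.
by have [r r0 hr] := h x _ e0; exists r.
Qed.

End row_topology.

(** * Polynomial weights *)

Section weight.
Context {R : realType} {d : nat}.
Local Notation E := 'rV[R]_d.
Implicit Types x y : E.

(* Equivalent to [1 + enorm x] up to a factor [d.+1], with a triangle inequality
   that needs no Cauchy-Schwarz. *)
Definition weight x : R := 1 + \sum_i `|x ord0 i|.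
Local Notation w := weight.

Lemma weight_ge1 x : 1 <= w x.
Proof. by rewrite lerDl sumr_ge0. Qed.

Lemma weight_gt0 x : 0 < w x.
Proof. exact: lt_le_trans ltr01 (weight_ge1 x). Qed.

Lemma weight_ge0 x : 0 <= w x.
Proof. exact/ltW/weight_gt0. Qed.

Lemma weight_neq0 x : w x != 0.
Proof. by rewrite gt_eqF// weight_gt0. Qed.

Lemma weightX_gt0 n x : 0 < w x ^+ n.
Proof. by rewrite exprn_gt0// weight_gt0. Qed.

Lemma weightX_ge1 n x : 1 <= w x ^+ n.
Proof. by rewrite exprn_ege1// weight_ge1. Qed.

Lemma weightX_le m n x : (m <= n)%N -> w x ^+ m <= w x ^+ n.
Proof. by move=> mn; rewrite ler_weXn2l// weight_ge1. Qed.

Lemma weightN x : w (- x) = w x.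
Proof. by congr (_ + _); apply: eq_bigr => i _; rewrite mxE normrN. Qed.

Lemma coord_le_weight x i : `|x ord0 i| <= w x.
Proof.
rewrite /w (bigD1 i)//= addrCA lerDl addr_ge0// sumr_ge0//.
Qed.

Lemma weightD x y : w (x + y) <= w x * w y.
Proof.
have h : \sum_i `|(x + y) ord0 i| <= \sum_i `|x ord0 i| + \sum_i `|y ord0 i|.
  by rewrite -big_split/= ler_sum// => i _; rewrite mxE ler_normD.
have X0 : 0 <= \sum_i `|x ord0 i| by rewrite sumr_ge0.
have Y0 : 0 <= \sum_i `|y ord0 i| by rewrite sumr_ge0.
by rewrite /w; nra.
Qed.

Lemma weightB x y : w (x - y) <= w x * w y.
Proof. by rewrite -(weightN y) weightD. Qed.

Lemma weight_le_shift x y : w x <= w (x - y) * w y.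
Proof. by rewrite -{1}(subrK y x) weightD. Qed.

Lemma enorm_le_weight x : 1 + enorm x <= w x.
Proof.
rewrite /w lerD2l /enorm -[leRHS]ger0_norm ?sumr_ge0// -sqrtr_sqr ler_wsqrtr//.
rewrite /dot expr2 mulr_suml ler_sum// => i _.
rewrite (le_trans (ler_norm _))// normrM ler_wpM2l//.
by rewrite (bigD1 i)//= lerDl sumr_ge0.
Qed.

Lemma weight_le_enorm x : w x <= d.+1%:R * (1 + enorm x).
Proof.
have en i : `|x ord0 i| <= enorm x.
  rewrite /enorm -sqrtr_sqr ler_wsqrtr// /dot (bigD1 i)//= expr2 lerDl sumr_ge0//.
  by move=> j _; rewrite -expr2 sqr_ge0.
have e0 : 0 <= enorm x by exact: sqrtr_ge0.
apply: (@le_trans _ _ (1 + d%:R * enorm x)).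
  rewrite lerD2l (le_trans (ler_sum _ (fun i _ => en i)))//.
  by rewrite sumr_const card_ord mulr_natl.
by rewrite -addn1 natrD; have := ler0n R d; nra.
Qed.

Lemma continuous_weight : continuous (w : E -> R).
Proof.
apply/continuous_cubeP => x e e0; exists (e / d.+1%:R).
  by rewrite divr_gt0.
move=> y xy; rewrite /w opprD addrACA subrr add0r -sumrB.
rewrite (le_lt_trans (ler_norm_sum _ _ _))//.
apply: (@le_lt_trans _ _ (\sum_(i < d) (e / d.+1%:R))).
  by apply: ler_sum => i _; rewrite (le_trans (ler_dist_dist _ _))// ltW.
rewrite sumr_const card_ord -[_ *+ d]mulr_natr mulrAC -mulrA gtr_pMr//.
by rewrite ltr_pdivrMr// mul1r ltr_nat.
Qed.

(** The reference integrable function: two powers of the weight for each coordinate suffice, by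
    [wint_le_prod]. *)
Definition wint x : R := w x ^- (2 * d).

Lemma wint_gt0 x : 0 < wint x.
Proof. by rewrite invr_gt0 weightX_gt0. Qed.

Lemma wint_ge0 x : 0 <= wint x.
Proof. exact/ltW/wint_gt0. Qed.

Lemma continuous_weightX n : continuous (fun x => w x ^+ n : R).
Proof.
by move=> x; exact: (@continuous_comp _ _ _ w (fun t : R => t ^+ n) x (@continuous_weight x) (@exprn_continuous _ _ _)).
Qed.

Lemma continuous_weightXV n : continuous (fun x => w x ^- n : R).
Proof.
by move=> x; exact: (cvgV (lt0r_neq0 (weightX_gt0 n x)) (@continuous_weightX n x)).
Qed.

(** A Peetre inequality: translating a negative power of the weight costs the same positive power at
    the translation. *)
Lemma weightXV_mulD n x y : w (x + y) ^- n <= w x ^+ n * w y ^- n.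
Proof.
rewrite ler_pdivlMr ?weightX_gt0// mulrC ler_pdivrMr ?weightX_gt0//.
rewrite mulrC -exprMn lerXn2r ?nnegrE ?mulr_ge0 ?weight_ge0//.
by have := weight_le_shift y (- x); rewrite opprK weightN addrC mulrC.
Qed.

(** Each of the d factors w x ^ 2 dominates (1 + |x_i|) ^ 2, hence 1 + x_i ^ 2. The right-hand side
    integrates coordinate by coordinate. *)
Lemma wint_le_prod x : wint x <= \prod_i (1 + x ord0 i ^+ 2)^-1.
Proof.
rewrite /wint prodfV lef_pV2 ?posrE; last 2 first.
- exact: weightX_gt0.
- by apply: prodr_gt0 => i _; rewrite ltr_pwDl// sqr_ge0.
rewrite mulnC exprM [leRHS](_ : _ = \prod_(i < d) (w x ^+ 2)); last first.
  by rewrite prodr_const card_ord -!exprM mulnC.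
apply: ler_prod => i _; rewrite addr_ge0 ?sqr_ge0//=.
apply: (@le_trans _ _ ((1 + `|x ord0 i|) ^+ 2)).
  by rewrite -(real_normK (num_real (x ord0 i))) sqrrD expr1n; have := normr_ge0 (x ord0 i); nra.
rewrite lerXn2r ?nnegrE ?addr_ge0 ?weight_ge0// ?sumr_ge0//.
by rewrite /w (bigD1 i)//= addrA lerDl sumr_ge0.
Qed.

End weight.

Section weight_integrable.
Context {R : realType}.

Lemma integral_oneDsqrV_lty :
  (\int[@lebesgue_measure R]_x ((1 + x ^+ 2)^-1)%:E < +oo)%E.
Proof.
rewrite (ge0_symfun_integralT (f := fun x => (1 + x ^+ 2)^-1)); last 3 first.
- by move=> x; rewrite invr_ge0 addr_ge0// sqr_ge0.
- exact: continuous_oneDsqrV.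
- by move=> x /=; rewrite sqrrN.
rewrite (_ : [set x | _] = `[0, +oo[%classic); last first.
  by apply/seteqP; split => x /=; rewrite in_itv/= andbT.
by rewrite integral0y_oneDsqr -EFinM ltry.
Qed.

Lemma integral_prod_oneDsqrV_lty d :
  (\int[leb R d]_x (\prod_i (1 + x ord0 i ^+ 2)^-1)%:E < +oo)%E.
Proof.
elim: d => [|n IH].
  under eq_integral do rewrite big_ord0.
  by rewrite integral_cst// mul1e /= diracT ltry.
have mf m : measurable_fun setT (fun x : 'rV[R]_m =>
    (\prod_i (1 + x ord0 i ^+ 2)^-1)%:E).
  apply/measurable_EFinP; apply: measurable_prod => i _.
  apply: (measurableT_comp (f := fun t : R => (1 + t ^+ 2)^-1)).
    by apply: continuous_measurable_fun; exact: continuous_oneDsqrV.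
  exact: measurable_coord.
have f0 (t : R) : 0 <= (1 + t ^+ 2)^-1 by rewrite invr_ge0 addr_ge0// sqr_ge0.
rewrite ge0_integral_lebS//; last by move=> x; rewrite lee_fin prodr_ge0.
have consE t : (\int[leb R n]_x (\prod_i (1 + rV_cons (t, x) ord0 i ^+ 2)^-1)%:E =
    ((1 + t ^+ 2)^-1)%:E * \int[leb R n]_x (\prod_i (1 + x ord0 i ^+ 2)^-1)%:E)%E.
  rewrite -ge0_integralZl//; last 2 first.
  - by move=> x _; rewrite lee_fin prodr_ge0.
  - by rewrite lee_fin.
  2: exact: mf.
  apply: eq_integral => x _; rewrite big_ord_recl mxE unlift_none/= EFinM.
  by congr (_ * _%:E)%E; apply: eq_bigr => i _; rewrite mxE liftK.
under eq_integral do rewrite consE.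
rewrite ge0_integralZr//; last 3 first.
- apply/measurable_EFinP.
  by apply: continuous_measurable_fun; exact: continuous_oneDsqrV.
- by move=> t _; rewrite lee_fin.
- by apply: integral_ge0 => x _; rewrite lee_fin prodr_ge0.
rewrite lte_mul_pinfty//.
- by apply: integral_ge0 => x _; rewrite lee_fin.
- rewrite ge0_fin_numE ?integral_oneDsqrV_lty//.
  by apply: integral_ge0 => x _; rewrite lee_fin.
Qed.

Lemma integrable_wint d : (leb R d).-integrable setT (EFin \o @wint R d).
Proof.
apply: (@le_integrable _ _ _ (leb R d) setT measurableT (EFin \o @wint R d)
    (fun x : 'rV[R]_d => (\prod_i (1 + x ord0 i ^+ 2)^-1)%:E)).
- apply/measurable_EFinP; apply: continuous_measurable_row.
  exact: continuous_weightXV.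
- move=> x _.
  change (`|wint x|%:E <= `|\prod_i (1 + x ord0 i ^+ 2)^-1|%:E)%E.
  rewrite lee_fin ger0_norm ?wint_ge0// ger0_norm ?wint_le_prod//.
  by rewrite prodr_ge0// => i _; rewrite invr_ge0 addr_ge0// sqr_ge0.
apply/integrableP; split.
  apply/measurable_EFinP; apply: measurable_prod => i _.
  apply: (measurableT_comp (f := fun t : R => (1 + t ^+ 2)^-1)).
    by apply: continuous_measurable_fun; exact: continuous_oneDsqrV.
  exact: measurable_coord.
have f0 (x : 'rV[R]_d) : 0 <= \prod_i (1 + x ord0 i ^+ 2)^-1.
  by rewrite prodr_ge0// => i _; rewrite invr_ge0 addr_ge0// sqr_ge0.
under eq_integral do rewrite gee0_abs ?lee_fin ?f0//.
exact: integral_prod_oneDsqrV_lty.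
Qed.

Lemma leb_cube_gt0 d (x : 'rV[R]_d) e : 0 < e -> (0 < leb R d (cube x e))%E.
Proof.
move=> e0; pose B := [set y : 'rV[R]_d | forall i,
  x ord0 i - e / 2 < y ord0 i <= x ord0 i + e / 2].
have mB : measurable B by exact: measurable_box.
apply: (@lt_le_trans _ _ (leb R d B)).
  rewrite leb_box; last by move=> i; lra.
  by rewrite lte_fin; apply: prodr_gt0 => i _; lra.
apply: le_measure; rewrite ?inE//; first exact: measurable_cube.
by move=> y /= h i; have := h i; rewrite ltr_distlC; lra.
Qed.

(** Where h is positive, continuity keeps it above half its value on a whole cube, and cubes have
    positive measure. *)
Lemma continuous_integral_eq0 d (h : 'rV[R]_d -> R) : continuous h ->
  (forall x, 0 <= h x) -> (\int[leb R d]_x (h x)%:E = 0)%E -> forall x, h x = 0.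
Proof.
move=> ch h0 ih x; apply/eqP; rewrite eq_le h0 andbT leNgt; apply/negP => hx.
have := (continuous_cubeP h).1 ch x _ (divr_gt0 hx (ltr0n R 2)) => -[r r0 hr].
have : (0 < \int[leb R d]_x (h x)%:E)%E; last by rewrite ih ltxx.
apply: (@lt_le_trans _ _ (\int[leb R d]_(y in cube x r) (h x / 2)%:E)%E).
  rewrite integral_cst//; last exact: measurable_cube.
  by rewrite mule_gt0// ?leb_cube_gt0// lte_fin divr_gt0.
apply: (@le_trans _ _ (\int[leb R d]_(y in cube x r) (h y)%:E)%E).
  apply: ge0_le_integral => //.
  - exact: measurable_cube.
  - by move=> y _; rewrite lee_fin divr_ge0.
  - apply/measurable_EFinP; apply: measurable_funTS.
    exact: continuous_measurable_row.
  - by move=> y /hr; rewrite lee_fin ltr_distlC; lra.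
apply: ge0_subset_integral => //.
- exact: measurable_cube.
- by apply/measurable_EFinP; exact: continuous_measurable_row.
- by move=> y _; rewrite lee_fin.
Qed.

End weight_integrable.

(** * Partial derivatives *)

Section complex_derivative.
Context {R : realType} {d : nat}.
Local Notation E := 'rV[R]_d.
Implicit Types (x y v : E) (f g : E -> R[i]).

(** The two difference quotients are the same function of the increment. One-variable chain rules
    and the mean value theorem thus become available for partial derivatives. *)
Lemma is_derive_line (f : E -> R) x v (t l : R) :
  is_derive (t *: v + x) v f l <-> is_derive t 1 (fun h : R => f (h *: v + x)) l.
Proof.
have eqf : (fun h : R => h^-1 *: ((f \o shift (t *: v + x)) (h *: v) - f (t *: v + x))) =
    (fun h : R => h^-1 *: (((fun h => f (h *: v + x)) \o shift t) (h *: (1 : R)) -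
       f (t *: v + x))).
  apply/funext => h /=; congr (_ *: (f _ - _)).
  by rewrite scalerDl addrA; congr (_ *: _ + _ + _); rewrite /GRing.scale /= mulr1.
have ed : derivable f (t *: v + x) v = derivable (fun h : R => f (h *: v + x)) t 1.
  by rewrite /derivable eqf.
have eD : 'D_v f (t *: v + x) = 'D_1 (fun h : R => f (h *: v + x)) t.
  by rewrite /derive eqf.
split=> -[h1 h2]; split.
- by rewrite -ed.
- by rewrite -eD.
- by rewrite ed.
- by rewrite eD.
Qed.

Lemma is_derive_line0 (f : E -> R) x v (l : R) :
  is_derive x v f l <-> is_derive (0 : R) 1 (fun h : R => f (h *: v + x)) l.
Proof. by have := is_derive_line f x v 0 l; rewrite scale0r add0r. Qed.

Definition isdC (i : 'I_d) f x (z : R[i]) :=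
  is_derive x 'e_i (fun y => complex.Re (f y)) (complex.Re z) /\
  is_derive x 'e_i (fun y => complex.Im (f y)) (complex.Im z).

Definition derC (i : 'I_d) f := forall x,
  derivable (fun y => complex.Re (f y)) x 'e_i /\
  derivable (fun y => complex.Im (f y)) x 'e_i.

Lemma isdC_derC i f (f' : E -> R[i]) : (forall x, isdC i f x (f' x)) ->
  derC i f /\ pderiv i f = f'.
Proof.
move=> h; split=> [x|]; first by have [[h1 _] [h2 _]] := h x.
apply/funext => x; have [[_ h1] [_ h2]] := h x.
by apply: complexP; rewrite /pderiv/=.
Qed.

Lemma derC_isdC i f x : derC i f -> isdC i f x (pderiv i f x).
Proof. by move=> /(_ x)[h1 h2]; split; apply: derivableP. Qed.

Lemma isdC_cst i (c : R[i]) x : isdC i (fun=> c) x 0.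
Proof. by split; exact: is_derive_cst. Qed.

Lemma isdCD i f g x z w : isdC i f x z -> isdC i g x w ->
  isdC i (fun y => f y + g y) x (z + w).
Proof.
move=> [f1 f2] [g1 g2]; split; rewrite ?ReD ?ImD.
  by under eq_fun do rewrite ReD; exact: is_deriveD.
by under eq_fun do rewrite ImD; exact: is_deriveD.
Qed.

Lemma isdCM i f g x z w : isdC i f x z -> isdC i g x w ->
  isdC i (fun y => f y * g y) x (z * g x + f x * w).
Proof.
move=> [f1 f2] [g1 g2]; split; rewrite ?ReD ?ImD.
  under eq_fun do rewrite ReM.
  apply: (is_derive_eq (is_deriveB (is_deriveM f1 g1) (is_deriveM f2 g2))).
  by rewrite !ReM /GRing.scale /=; ring.
under eq_fun do rewrite ImM.
apply: (is_derive_eq (is_deriveD (is_deriveM f1 g2) (is_deriveM f2 g1))).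
by rewrite !ImM /GRing.scale /=; ring.
Qed.

Lemma isdC_conj i f x z : isdC i f x z ->
  isdC i (fun y => conjc (f y)) x (conjc z).
Proof.
move=> [f1 f2]; split.
  rewrite (_ : (fun y => _) = (fun y => complex.Re (f y))); last first.
    by apply/funext => y; case: (f y).
  by apply: (is_derive_eq f1); case: z {f1 f2}.
rewrite (_ : (fun y => _) = - (fun y => complex.Im (f y))); last first.
  by apply/funext => y; rewrite /GRing.opp/=; case: (f y).
by apply: (is_derive_eq (is_deriveN f2)); case: z {f1 f2}.
Qed.

Let is_derive_affine i (f : E -> R) (a : E) (c : R) x (l : R) :
  is_derive (a + c *: x) 'e_i f l ->
  is_derive x 'e_i (fun y => f (a + c *: y)) (c * l).
Proof.
move=> h; apply/is_derive_line0.
rewrite (_ : (fun h => _) = (fun h => f (h *: 'e_i + (a + c *: x))) \o ( *%R c)).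
  have h' : is_derive (c * 0) 1 (fun h : R => f (h *: 'e_i + (a + c *: x))) l.
    by rewrite mulr0; exact/is_derive_line0.
  have h'' : is_derive (0 : R) (1 : R) ( *%R c) c.
    have := is_deriveZ c (is_derive_id (0 : R) (1 : R)).
    by move/is_derive_eq; apply; rewrite /GRing.scale/= mulr1.
  by apply: (is_derive_eq (is_derive1_comp h' h'')); rewrite mulrC.
apply/funext => t /=; congr f.
by rewrite scalerDr scalerA addrCA.
Qed.

Lemma isdC_affine i f (a : E) (c : R) x z : isdC i f (a + c *: x) z ->
  isdC i (fun y => f (a + c *: y)) x (c%:C%C * z).
Proof.
move=> [f1 f2]; split.
  by apply: (is_derive_eq (is_derive_affine f1)); rewrite ReM/= mul0r subr0.
by apply: (is_derive_eq (is_derive_affine f2)); rewrite ImM/= mul0r addr0.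
Qed.

Lemma isdC_cis i (L : E -> R) x l : is_derive x 'e_i L l ->
  isdC i (fun y => cis (L y)) x (Complex 0 l * cis (L x)).
Proof.
move=> h; have h' : is_derive (0 : R) 1 (fun h : R => L (h *: 'e_i + x)) l.
  exact/is_derive_line0.
have L0 : L (0 *: 'e_i + x) = L x by rewrite scale0r add0r.
split=> /=; apply/is_derive_line0.
  apply: (is_derive_eq (is_derive1_comp (is_derive_cos _) h')).
  by rewrite L0; ring.
apply: (is_derive_eq (is_derive1_comp (is_derive_sin _) h')).
by rewrite L0; ring.
Qed.

Lemma is_derive_dotr i (a x : E) : is_derive x 'e_i (fun y => dot a y) (a ord0 i).
Proof.
apply/is_derive_line0.
rewrite (_ : (fun h => _) = cst (dot a x) + (a ord0 i) \*: id).
  apply: (is_derive_eq (is_deriveD (is_derive_cst _ _ _) (is_deriveZ _ (is_derive_id _ _)))).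
  by rewrite add0r /GRing.scale/= mulr1.
apply/funext => t; transitivity (dot a x + a ord0 i * t) => //.
rewrite /dot [RHS]addrC.
under eq_bigr do rewrite !mxE eqxx mulrDr /=.
rewrite big_split/=; congr (_ + _); rewrite (bigD1 i)//= eqxx mulr1.
by rewrite big1 ?addr0// => j /negbTE ->; rewrite !mulr0.
Qed.

Lemma is_derive_coord i j (x : E) :
  is_derive x 'e_i (fun y : E => y ord0 j) (i == j)%:R.
Proof.
have := is_derive_dotr i ('e_j) x; rewrite mxE eqxx /=.
rewrite (_ : (fun y : E => dot _ y) = (fun y : E => y ord0 j)) // .
apply/funext => y; rewrite /dot (bigD1 j)//= mxE !eqxx mul1r.
by rewrite big1 ?addr0// => k /negbTE kj; rewrite mxE kj andbF mul0r.
Qed.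

Lemma is_derive_dotd i (x : E) :
  is_derive x 'e_i (fun y => dot y y) (2 * x ord0 i).
Proof.
have h j : is_derive x 'e_i (fun y : E => y ord0 j * y ord0 j)
    (2 * x ord0 j * (i == j)%:R).
  apply: (is_derive_eq (is_deriveM (is_derive_coord i j x) (is_derive_coord i j x))).
  by rewrite /GRing.scale/=; ring.
have := is_derive_sum h.
rewrite (_ : \sum_(j < d) _ = fun y => dot y y); last first.
  by apply/funext => y; rewrite fct_sumE.
move/is_derive_eq; apply; rewrite (bigD1 i)//= eqxx mulr1 big1 ?addr0//.
by move=> j; rewrite eq_sym => /negbTE ->; rewrite mulr0.
Qed.

Lemma isdC_real i (L : E -> R) x l : is_derive x 'e_i L l ->
  isdC i (fun y => (L y)%:C%C) x l%:C%C.
Proof. by move=> h; split => //=; exact: is_derive_cst. Qed.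

End complex_derivative.

(** * Mean value inequalities *)

Section mean_value.
Context {R : realType} {d : nat}.
Local Notation E := 'rV[R]_d.

Lemma line_bound (f df : R -> R) (B t : R) :
  (forall s : R, is_derive s 1 f (df s)) ->
  (forall s : R, `|s| <= `|t| -> `|df s| <= B) -> `|f t - f 0| <= `|t| * B.
Proof.
move=> fdf fB.
have cf (a b : R) : {within `[a, b], continuous f}.
  apply: continuous_subspaceT => s; apply: differentiable_continuous.
  by apply/derivable1_diffP; have [] := fdf s.
have [t0|t0] := leP 0 t.
  have [c + ->] := MVT_segment t0 (fun s _ => fdf s) (cf _ _).
  rewrite in_itv /= => /andP[c0 ct]; rewrite subr0 normrM mulrC ler_wpM2l//.
  by apply: fB; rewrite !ger0_norm.
have [c + h] := MVT_segment (ltW t0) (fun s _ => fdf s) (cf _ _).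
rewrite in_itv /= => /andP[c0 ct]; rewrite distrC h sub0r normrM normrN mulrC.
by rewrite ler_wpM2l//; apply: fB; rewrite (ler0_norm ct) (ltr0_norm t0); lra.
Qed.

Lemma coord_mean_value (f : E -> R) x (i : 'I_d) (B t : R) :
  (forall z : E, derivable f z 'e_i) ->
  (forall s : R, `|s| <= `|t| -> `|'D_('e_i) f (s *: 'e_i + x)| <= B) ->
  `|f (t *: 'e_i + x) - f x| <= `|t| * B.
Proof.
move=> df fB.
have := @line_bound (fun s => f (s *: 'e_i + x)) (fun s => 'D_('e_i) f (s *: 'e_i + x)) B t.
rewrite scale0r add0r; apply => // s.
by apply/is_derive_line; exact: derivableP.
Qed.

(** The path from x to y changes one coordinate at a time, z k agreeing with y in the first k
    coordinates. So partial derivatives suffice, without total differentiability, and only their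
    values in the box spanned by x and y count. *)
Lemma mean_value (f : E -> R) (x y : E) (B : R) :
  (forall (i : 'I_d) (z : E), derivable f z 'e_i) ->
  (forall (i : 'I_d) (z : E), (forall j, `|z ord0 j - x ord0 j| <= `|y ord0 j - x ord0 j|) ->
     `|'D_('e_i) f z| <= B) ->
  `|f y - f x| <= (\sum_i `|y ord0 i - x ord0 i|) * B.
Proof.
move=> df fB.
pose z k : E := \row_j (if (j < k)%N then y ord0 j else x ord0 j).
have zd : z d = y by apply/rowP => j; rewrite mxE ltn_ord.
have z0 : z 0%N = x by apply/rowP => j; rewrite mxE.
suff h k : (k <= d)%N -> `|f (z k) - f x| <=
    (\sum_(i < d | (i < k)%N) `|y ord0 i - x ord0 i|) * B.
  by have := h d (leqnn d); rewrite zd (eq_bigl xpredT)// => i; rewrite ltn_ord.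
elim: k => [_|k IH kd].
  by rewrite z0 subrr normr0 big_pred0 ?mul0r.
rewrite (le_trans (ler_distD (f (z k)) _ _))//.
pose i := Ordinal kd.
have zk : z k.+1 = (y ord0 i - x ord0 i) *: 'e_i + z k.
  apply/rowP => j; rewrite !mxE eqxx/=.
  have [->|ji] := eqVneq j i; first by rewrite /= ltnSn ltnn mulr1 subrK.
  rewrite mulr0 add0r ltnS leq_eqVlt.
  by have /negbTE -> : nat_of_ord j != k by apply: contra ji => /eqP jk; apply/eqP/val_inj.
have step : `|f (z k.+1) - f (z k)| <= `|y ord0 i - x ord0 i| * B.
  rewrite zk; apply: coord_mean_value => // s hs; apply: fB => j.
  rewrite !mxE eqxx/=; have [->|ji] := eqVneq j i.
    by rewrite /= ltnn mulr1 addrK.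
  by rewrite mulr0 add0r; case: ifP => // _; rewrite subrr normr0.
rewrite (le_trans (lerD step (IH (ltnW kd))))// -mulrDl.
rewrite [X in _ <= X * _](bigD1 i)//= (_ : \sum_(_ < _ | _ && _) _ =
  \sum_(i0 < d | (i0 < k)%N) `|y ord0 i0 - x ord0 i0|)//.
apply: eq_bigl => j; rewrite ltnS -val_eqE/=.
by case: ltngtP.
Qed.

End mean_value.

(** * Majorants of partial derivatives *)

Section derivative_bounds.
Context {R : realType} {d : nat}.
Local Notation E := 'rV[R]_d.
Local Notation w := (@weight R d).
Implicit Types (f g : E -> R[i]) (W : E -> R).

Definition contC (T : topologicalType) (f : T -> R[i]) :=
  continuous (fun x => complex.Re (f x)) /\ continuous (fun x => complex.Im (f x)).

(* [dle n f W]: f is of class C^n and W dominates its partial derivatives of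
   order at most n; the recursion peels off the derivative applied first. *)
Fixpoint dle n f W : Prop := contC f /\ (forall x, nrm (f x) <= W x) /\
  (if n is m.+1 then forall i, derC i f /\ dle m (pderiv i f) W else True).

Lemma contC_measC f : contC f -> measC f.
Proof. by move=> [f1 f2]; split; exact: continuous_measurable_row. Qed.

Lemma dle_cont n f W : dle n f W -> contC f.
Proof. by case: n => [|n] []. Qed.

Lemma dle_nrm n f W : dle n f W -> forall x, nrm (f x) <= W x.
Proof. by case: n => [|n] [_ []]. Qed.

Lemma dle_pderiv n f W i : dle n.+1 f W -> derC i f /\ dle n (pderiv i f) W.
Proof. by case=> _ [_ /(_ i)]. Qed.

Lemma dle_mono n f W W' : (forall x, W x <= W' x) -> dle n f W -> dle n f W'.
Proof.
move=> WW'; elim: n f => [|n IH] f [cf [Wf h]]; split=> //; split=> //.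
- by move=> x; exact: le_trans (Wf x) (WW' x).
- by move=> x; exact: le_trans (Wf x) (WW' x).
- by move=> i; have [h1 h2] := h i; split=> //; exact: IH.
Qed.

Lemma dle_leq m n f W : (m <= n)%N -> dle n f W -> dle m f W.
Proof.
elim: m n f => [|m IH] [|n] f // mn [cf [Wf h]]; split=> //; split=> //.
by move=> i; have [h1 h2] := h i; split=> //; exact: IH h2.
Qed.

Lemma contC_cst (T : topologicalType) (c : R[i]) : contC (fun _ : T => c).
Proof. by split; exact: cst_continuous. Qed.

Lemma contCD (T : topologicalType) (f g : T -> R[i]) :
  contC f -> contC g -> contC (fun x => f x + g x).
Proof.
move=> [f1 f2] [g1 g2]; split.
  by under eq_fun do rewrite ReD; move=> x; exact: cvgD (f1 x) (g1 x).
by under eq_fun do rewrite ImD; move=> x; exact: cvgD (f2 x) (g2 x).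
Qed.

Lemma contCM (T : topologicalType) (f g : T -> R[i]) :
  contC f -> contC g -> contC (fun x => f x * g x).
Proof.
move=> [f1 f2] [g1 g2]; split.
  under eq_fun do rewrite ReM.
  by move=> x; exact: cvgB (cvgM (f1 x) (g1 x)) (cvgM (f2 x) (g2 x)).
under eq_fun do rewrite ImM.
by move=> x; exact: cvgD (cvgM (f1 x) (g2 x)) (cvgM (f2 x) (g1 x)).
Qed.

Lemma contC_conj (T : topologicalType) (f : T -> R[i]) :
  contC f -> contC (fun x => conjc (f x)).
Proof.
move=> [f1 f2]; split.
  rewrite (_ : (fun x => _) = (fun x => complex.Re (f x)))//.
  by apply/funext => x; case: (f x).
rewrite (_ : (fun x => _) = (fun x => - complex.Im (f x))).
  by move=> x; exact: cvgN (f2 x).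
by apply/funext => x; case: (f x).
Qed.

Lemma contC_comp (T U : topologicalType) (L : T -> U) (f : U -> R[i]) :
  continuous L -> contC f -> contC (fun x => f (L x)).
Proof.
move=> cL [f1 f2]; split=> x.
  exact: (@continuous_comp _ _ _ L (fun y => complex.Re (f y)) x (cL x) (f1 _)).
exact: (@continuous_comp _ _ _ L (fun y => complex.Im (f y)) x (cL x) (f2 _)).
Qed.

Lemma contC_cis (T : topologicalType) (L : T -> R) : continuous L ->
  contC (fun x => cis (L x)).
Proof.
move=> cL; split=> x /=.
  exact: (@continuous_comp _ _ _ L cos x (cL x) (@continuous_cos _ _)).
exact: (@continuous_comp _ _ _ L sin x (cL x) (@continuous_sin _ _)).
Qed.

Lemma contC_nrm (T : topologicalType) (f : T -> R[i]) : contC f ->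
  continuous (fun x => nrm (f x)).
Proof.
move=> [f1 f2]; pose q t := complex.Re (f t) * complex.Re (f t) +
  complex.Im (f t) * complex.Im (f t).
rewrite (_ : (fun x => _) = Num.sqrt \o q); last first.
  by apply/funext => t; rewrite /q /= -!expr2; case: (f t).
move=> t; apply: continuous_comp; last exact: sqrt_continuous.
exact: cvgD (cvgM (f1 t) (f1 t)) (cvgM (f2 t) (f2 t)).
Qed.

Lemma continuous_affine (a : E) (c : R) : continuous (fun x : E => a + c *: x).
Proof. by move=> x; exact: (cvgD (cvg_cst a) (cvgZ (cvg_cst c) (@cvg_id _ _))). Qed.

Lemma pderivD i f g : derC i f -> derC i g ->
  derC i (fun y => f y + g y) /\
  pderiv i (fun y => f y + g y) = (fun y => pderiv i f y + pderiv i g y).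
Proof. by move=> hf hg; apply: isdC_derC => x; apply: isdCD; exact: derC_isdC. Qed.

Lemma pderivM i f g : derC i f -> derC i g ->
  derC i (fun y => f y * g y) /\
  pderiv i (fun y => f y * g y) = (fun y => pderiv i f y * g y + f y * pderiv i g y).
Proof. by move=> hf hg; apply: isdC_derC => x; apply: isdCM; exact: derC_isdC. Qed.

Lemma pderiv_cst i (c : R[i]) : derC i (fun _ : E => c) /\
  pderiv i (fun _ : E => c) = fun=> 0.
Proof. by apply: isdC_derC => x; exact: isdC_cst. Qed.

Lemma pderivZ i (c : R[i]) f : derC i f ->
  derC i (fun y => c * f y) /\ pderiv i (fun y => c * f y) = (fun y => c * pderiv i f y).
Proof.
move=> hf; apply: isdC_derC => x; rewrite -[X in isdC _ _ _ X]add0r -(mul0r (f x)).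
by apply: isdCM; [exact: isdC_cst|exact: derC_isdC].
Qed.

Lemma pderiv_conj i f : derC i f -> derC i (fun y => conjc (f y)) /\
  pderiv i (fun y => conjc (f y)) = (fun y => conjc (pderiv i f y)).
Proof. by move=> hf; apply: isdC_derC => x; apply: isdC_conj; exact: derC_isdC. Qed.

Lemma pderiv_affine i f a (c : R) : derC i f ->
  derC i (fun y => f (a + c *: y)) /\
  pderiv i (fun y => f (a + c *: y)) = (fun y => c%:C%C * pderiv i f (a + c *: y)).
Proof. by move=> hf; apply: isdC_derC => x; apply: isdC_affine; exact: derC_isdC. Qed.

Lemma pderiv_translate i f (x : E) : derC i f ->
  derC i (fun y => f (y - x)) /\
  pderiv i (fun y => f (y - x)) = (fun y => pderiv i f (y - x)).
Proof.
move=> df; have [h1 h2] := pderiv_affine (- x) 1 df; split.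
  by move: h1; congr derC; apply/funext => y; rewrite scale1r addrC.
transitivity (pderiv i (fun y => f (- x + 1 *: y))).
  by congr pderiv; apply/funext => y; rewrite scale1r addrC.
by rewrite h2; apply/funext => y; rewrite mul1r scale1r addrC.
Qed.

Lemma dleD n f g W1 W2 : dle n f W1 -> dle n g W2 ->
  dle n (fun x => f x + g x) (fun x => W1 x + W2 x).
Proof.
elim: n f g => [|n IH] f g [cf [Wf hf]] [cg [Wg hg]];
  (split; [exact: contCD|split=> [x|]//]; first by rewrite (le_trans (nrmD _ _)) ?lerD).
move=> i; have [f1 f2] := hf i; have [g1 g2] := hg i.
by have [h ->] := pderivD f1 g1; split=> //; exact: IH.
Qed.

Lemma dle_cst n (c : R[i]) : dle n (fun=> c) (fun=> nrm c).
Proof.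
suff h m (c' : R[i]) : nrm c' <= nrm c -> dle m (fun=> c') (fun=> nrm c) by exact: h.
elim: m c' => [|m IH] c' cc'; (split; [exact: contC_cst|split=> //]).
by move=> i; have [h ->] := pderiv_cst i c'; split=> //; apply: IH; rewrite nrm0 nrm_ge0.
Qed.

(** By the Leibniz rule each differentiation doubles the number of terms, whence 2 ^ n. *)
Lemma dleM n f g W1 W2 : dle n f W1 -> dle n g W2 ->
  dle n (fun x => f x * g x) (fun x => 2 ^+ n * (W1 x * W2 x)).
Proof.
elim: n f g => [|n IH] f g hf hg; have [cf [Wf hf']] := hf; have [cg [Wg hg']] := hg.
  split; first exact: contCM.
  by split=> // x; rewrite expr0 mul1r nrmM ler_pM ?nrm_ge0.
have W10 x : 0 <= W1 x by exact: le_trans (nrm_ge0 _) (Wf x).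
have W20 x : 0 <= W2 x by exact: le_trans (nrm_ge0 _) (Wg x).
split; first exact: contCM.
split=> [x|i].
  rewrite nrmM; apply: (@le_trans _ _ (W1 x * W2 x)); first by rewrite ler_pM ?nrm_ge0.
  by rewrite ler_peMl ?mulr_ge0// exprn_ege1// ler1n.
have [f1 f2] := hf' i; have [g1 g2] := hg' i.
have [h ->] := pderivM f1 g1; split=> //.
apply: dle_mono (dleD (IH _ _ f2 (dle_leq (leqnSn n) hg))
  (IH _ _ (dle_leq (leqnSn n) hf) g2)) => x.
by rewrite exprS -mulrDl mulrC -!mulrA [X in _ <= _ * X]mulrCA; lra.
Qed.

Lemma dleZ n (c : R[i]) f W : dle n f W ->
  dle n (fun x => c * f x) (fun x => nrm c * W x).
Proof.
elim: n f => [|n IH] f [cf [Wf hf]];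
  (split; [by apply: contCM => //; exact: contC_cst|split=> [x|]//];
    first by rewrite nrmM ler_wpM2l ?nrm_ge0).
by move=> i; have [f1 f2] := hf i; have [h ->] := pderivZ c f1; split=> //; exact: IH.
Qed.

Lemma dle_conj n f W : dle n f W -> dle n (fun x => conjc (f x)) W.
Proof.
elim: n f => [|n IH] f [cf [Wf hf]];
  (split; [exact: contC_conj|split=> [x|]//]; first by rewrite nrm_conj).
by move=> i; have [f1 f2] := hf i; have [h ->] := pderiv_conj f1; split=> //; exact: IH.
Qed.

(** The chain rule produces powers of |c| up to n; all of them are at most (1 + |c|) ^ n. *)
Lemma dle_affine n f W (a : E) (c : R) : dle n f W ->
  dle n (fun x => f (a + c *: x)) (fun x => (1 + `|c|) ^+ n * W (a + c *: x)).
Proof.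
elim: n f => [|n IH] f [cf [Wf hf]].
  split; first by apply: contC_comp => //; exact: continuous_affine.
  by split=> // x; rewrite expr0 mul1r.
have W0 x : 0 <= W x by exact: le_trans (nrm_ge0 _) (Wf x).
split; first by apply: contC_comp => //; exact: continuous_affine.
split=> [x|i].
  by rewrite (le_trans (Wf _))// ler_peMl// exprn_ege1// lerDl.
have [f1 f2] := hf i; have [h ->] := pderiv_affine a c f1; split=> //.
apply: dle_mono (dleZ c%:C%C (IH _ f2)) => x.
rewrite nrm_real exprS -mulrA ler_wpM2r// ?lerDr//.
by rewrite mulr_ge0// exprn_ge0// addr_ge0.
Qed.

(** Kept apart from [dle_affine], whose constant at c = 1 would be 2 ^ n instead of 1. *)
Lemma dle_translate n f W (a : E) : dle n f W ->
  dle n (fun x => f (x - a)) (fun x => W (x - a)).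
Proof.
elim: n f => [|n IH] f [cf [Wf hf]];
  (split; [by apply: contC_comp => // x; exact: (cvgB (@cvg_id _ _) (cvg_cst a))|split=> [x|]//]).
move=> i; have [f1 f2] := hf i; have [h ->] := pderiv_translate a f1.
by split=> //; exact: IH.
Qed.

Lemma dle_coord n i : dle n (fun x : E => (x ord0 i)%:C%C) w.
Proof.
case: n => [|n].
  split; first by split => /=; [exact: coord_continuous|exact: cst_continuous].
  by split=> // x; rewrite nrm_real coord_le_weight.
split; first by split => /=; [exact: coord_continuous|exact: cst_continuous].
split=> [x|j]; first by rewrite nrm_real coord_le_weight.
have [h ->] := @isdC_derC _ _ j (fun x : E => (x ord0 i)%:C%C)
  (fun=> ((j == i)%:R)%:C%C) (fun x => isdC_real (is_derive_coord j i x)).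
split=> //; apply: (@dle_mono n _ _ _ _ (dle_cst n ((j == i)%:R)%:C%C)) => x.
rewrite nrm_real (le_trans _ (weight_ge1 x))// ger0_norm ?ler0n//.
by case: eqP.
Qed.

End derivative_bounds.

(** * Schwartz functions *)

Section schwartz_bounds.
Context {R : realType} {d : nat}.
Local Notation E := 'rV[R]_d.
Local Notation w := (@weight R d).
Implicit Types (f g : E -> R[i]) (W : E -> R).

(** Equivalent to [schwartz] by [schwartz_rapid] and [rapid_schwartz], with the order of
    differentiation and the rate of decay as independent parameters and the bound available as a
    function majorant. *)
Definition rapid f := forall n k, exists2 A, 0 <= A &
  dle n f (fun x => A * w x ^- k).

(** The smooth functions of polynomial growth with all derivatives, which multiply Schwartz
    functions into Schwartz functions. *)
Definition slow f := forall n, exists A k, 0 <= A /\ dle n f (fun x => A * w x ^+ k).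

(** The last index of s is differentiated first, in agreement with the recursion of [dle]; this is
    why inductions on s run from the right. *)
Lemma pderivs_rcons (s : seq 'I_d) i f :
  pderivs (rcons s i) f = pderivs s (pderiv i f).
Proof. by rewrite /pderivs foldr_rcons. Qed.

Lemma dle_pderivs n s f W : dle (n + size s) f W -> dle n (pderivs s f) W.
Proof.
elim/last_ind: s n f => [|s i IH] n f; first by rewrite addn0.
rewrite size_rcons addnS => /(dle_pderiv i)[_ h]; rewrite pderivs_rcons; exact: IH.
Qed.

Lemma dle_pderivs_nrm n s f W x : dle n f W -> (size s <= n)%N ->
  nrm (pderivs s f x) <= W x.
Proof. by move=> h sn; apply: (dle_nrm (@dle_pderivs 0 s f W _)); exact: dle_leq h. Qed.

Lemma pderivs_linear s (a : R[i]) f g W1 W2 : dle (size s) f W1 -> dle (size s) g W2 ->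
  pderivs s (fun y => a * f y + g y) = (fun y => a * pderivs s f y + pderivs s g y).
Proof.
elim/last_ind: s f g => [//|s i IH] f g.
rewrite size_rcons => /(dle_pderiv i)[f1 f2] /(dle_pderiv i)[g1 g2].
have [h1 h2] := pderivZ a f1; have [_ h3] := pderivD h1 g1.
by rewrite !pderivs_rcons h3 h2 IH.
Qed.

Lemma schwartz_rapid f : schwartz f -> rapid f.
Proof.
move=> [sf bf] n k; pose N := maxn n k.
have [c cs] : exists c : R, forall s x, (size s <= N)%N ->
    (1 + enorm x) ^+ N * nrm (pderivs s f x) <= c.
  have := bf N; have : (seminorm N f <= seminorm N f)%E by [].
  case: {2 3}(seminorm N f) => [c|//|]; last first.
    rewrite leeNy_eq => /eqP h _; exists 0 => s x sN.
    have : (((1 + enorm x) ^+ N * nrm (pderivs s f x))%:E <= seminorm N f)%E.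
      by apply: ereal_sup_ubound; exists s, x.
    by rewrite h leeNy_eq.
  move=> h _; exists c => s x sN; rewrite -lee_fin (le_trans _ h)//.
  by apply: ereal_sup_ubound; exists s, x.
have e0 (x : E) : 0 < 1 + enorm x by rewrite ltr_pwDl// sqrtr_ge0.
have c0 : 0 <= c.
  apply: le_trans (cs [::] 0 (leq0n _)).
  by rewrite mulr_ge0 ?nrm_ge0// exprn_ge0// ltW.
(* The power of d.+1 pays for replacing 1 + [enorm] by the weight, and N is large enough for both
   the order n and the decay k. *)
exists (c * d.+1%:R ^+ N); first by rewrite mulr_ge0// exprn_ge0.
have bs s x : (size s <= N)%N -> nrm (pderivs s f x) <= c * d.+1%:R ^+ N * w x ^- k.
  move=> sN; rewrite ler_pdivlMr ?weightX_gt0//.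
  apply: (@le_trans _ _ (nrm (pderivs s f x) * w x ^+ N)).
    by rewrite ler_wpM2l ?nrm_ge0// weightX_le// leq_maxr.
  apply: (@le_trans _ _ (nrm (pderivs s f x) * (d.+1%:R * (1 + enorm x)) ^+ N)).
    rewrite ler_wpM2l ?nrm_ge0// lerXn2r ?nnegrE ?weight_ge0 ?weight_le_enorm//.
    by rewrite mulr_ge0// ltW.
  by rewrite exprMn mulrCA mulrC ler_wpM2r ?exprn_ge0// mulrC cs.
have dn m s : (m + size s <= N)%N ->
    dle m (pderivs s f) (fun x => c * d.+1%:R ^+ N * w x ^- k).
  elim: m s => [|m IH] s ms; have [h1 h2 h3 h4] := sf s; split=> //; split=> //.
  - by move=> x; exact: bs.
  - by move=> x; apply: bs; apply: leq_trans ms; rewrite leq_addl.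
  - move=> i; split=> //; have := IH (i :: s); rewrite /= addnS; exact.
by apply: (dn n [::]); rewrite addn0 leq_maxl.
Qed.

Lemma rapid_schwartz f : rapid f -> schwartz f.
Proof.
move=> h; split=> [s|N].
  have [A A0 hA] := h (1 + size s)%N 0%N.
  have [cs [_ hi]] := dle_pderivs hA.
  by split; [move=> i x; exact: ((hi i).1 x).1|move=> i x; exact: ((hi i).1 x).2|exact: cs.1|exact: cs.2].
have [A A0 hA] := h N N.
apply: (@le_lt_trans _ _ A%:E); last exact: ltry.
apply: ge_ereal_sup => _ [s [x [sN ->]]]; rewrite lee_fin.
apply: (@le_trans _ _ (w x ^+ N * nrm (pderivs s f x))).
  rewrite ler_wpM2r ?nrm_ge0// lerXn2r ?nnegrE ?weight_ge0 ?enorm_le_weight//.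
  by rewrite addr_ge0// sqrtr_ge0.
rewrite mulrC -ler_pdivlMr ?weightX_gt0//; exact: dle_pderivs_nrm hA sN.
Qed.

Lemma rapid_cont f : rapid f -> contC f.
Proof. by move=> /(_ 0%N 0%N)[A _ /dle_cont]. Qed.

Lemma rapid_integrable f : rapid f -> integrableC (leb R d) f.
Proof.
move=> hf; have [A A0 hA] := hf 0%N (2 * d)%N.
apply: (integrableC_dom _ (integrableZl measurableT A (integrable_wint d))).
  exact/contC_measC/rapid_cont.
by move=> x; rewrite /= -EFinM lee_fin; exact: (dle_nrm hA).
Qed.

Lemma rapidD f g : rapid f -> rapid g -> rapid (fun x => f x + g x).
Proof.
move=> hf hg n k; have [A A0 hA] := hf n k; have [B B0 hB] := hg n k.
exists (A + B); first by rewrite addr_ge0.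
by apply: dle_mono (dleD hA hB) => x; rewrite mulrDl.
Qed.

Lemma rapidZ (c : R[i]) f : rapid f -> rapid (fun x => c * f x).
Proof.
move=> hf n k; have [A A0 hA] := hf n k.
exists (nrm c * A); first by rewrite mulr_ge0 ?nrm_ge0.
by apply: dle_mono (dleZ c hA) => x; rewrite mulrA.
Qed.

Lemma rapidB f g : rapid f -> rapid g -> rapid (fun x => f x - g x).
Proof.
move=> hf hg; have := rapidD hf (rapidZ (-1) hg).
by congr rapid; apply/funext => x; rewrite mulN1r.
Qed.

Lemma rapid0 : rapid (fun _ : E => 0 : R[i]).
Proof.
move=> n k; exists 0 => //; apply: dle_mono (dle_cst n 0) => x.
by rewrite nrm0 mul0r.
Qed.

Lemma rapid_slowM f g : rapid f -> slow g -> rapid (fun x => f x * g x).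
Proof.
move=> hf hg n k; have [B [m [B0 hB]]] := hg n.
have [A A0 hA] := hf n (k + m)%N.
exists (2 ^+ n * (A * B)); first by rewrite mulr_ge0 ?exprn_ge0 ?mulr_ge0.
apply: dle_mono (dleM hA hB) => x.
by rewrite exprD invfM -!mulrA [w x ^- m * _]mulrCA mulVf ?mulr1 ?gt_eqF ?weightX_gt0 //;
  rewrite [B * _]mulrC.
Qed.

Lemma rapid_slow f : rapid f -> slow f.
Proof.
move=> hf n; have [A A0 hA] := hf n 0%N; exists A, 0%N; split=> //.
by apply: dle_mono hA => x; rewrite invr1.
Qed.

Lemma rapidM f g : rapid f -> rapid g -> rapid (fun x => f x * g x).
Proof. by move=> hf hg; exact/rapid_slowM/rapid_slow. Qed.

Lemma rapid_conj f : rapid f -> rapid (fun x => conjc (f x)).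
Proof. by move=> hf n k; have [A A0 hA] := hf n k; exists A => //; exact: dle_conj. Qed.

Lemma rapid_pderiv i f : rapid f -> derC i f /\ rapid (pderiv i f).
Proof.
move=> hf; split; first by have [A _ /(dle_pderiv i)[]] := hf 1%N 0%N.
by move=> n k; have [A A0 /(dle_pderiv i)[_ h]] := hf n.+1 k; exists A.
Qed.

Lemma weightXV_shift k (x a : E) : w (x - a) ^- k <= w a ^+ k * w x ^- k.
Proof. by have := weightXV_mulD k (- a) x; rewrite weightN addrC. Qed.

Lemma rapid_translate f (a : E) : rapid f -> rapid (fun x => f (x - a)).
Proof.
move=> hf n k; have [A A0 hA] := hf n k; exists (A * w a ^+ k).
  by rewrite mulr_ge0// exprn_ge0// weight_ge0.
apply: dle_mono (dle_translate a hA) => x.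
by rewrite -mulrA ler_wpM2l// weightXV_shift.
Qed.

Lemma weight_scale (c : R) (x : E) : w (c *: x) <= (1 + `|c|) * w x.
Proof.
have X0 : 0 <= \sum_i `|x ord0 i| by rewrite sumr_ge0.
rewrite /w (eq_bigr (fun i => `|c| * `|x ord0 i|)); last first.
  by move=> i _; rewrite mxE normrM.
by rewrite -mulr_sumr; have := normr_ge0 c; nra.
Qed.

Lemma rapid_dilate (c : R) f : 0 < c -> rapid f -> rapid (dilate c f).
Proof.
move=> c0 hf n k; have [A A0 hA] := hf n k.
(* The last factor restores decay in x from decay in c x, since w x is at most (1 + |1/c|) w (c
   x). *)
exists ((1 + `|c|) ^+ n * A * (1 + `|c^-1|) ^+ k).
  by rewrite !mulr_ge0// exprn_ge0// addr_ge0.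
have := dle_affine (0 : E) c hA.
rewrite (_ : (fun x => f _) = dilate c f); last first.
  by apply/funext => x; rewrite add0r.
apply: dle_mono => x; rewrite add0r -!mulrA ler_wpM2l ?exprn_ge0 ?addr_ge0//.
rewrite ler_wpM2l// ler_pdivlMr ?weightX_gt0// mulrC ler_pdivrMr ?weightX_gt0//.
rewrite -exprMn lerXn2r ?nnegrE ?mulr_ge0 ?weight_ge0 ?addr_ge0//.
by have := weight_scale c^-1 (c *: x); rewrite scalerK ?lt0r_neq0.
Qed.

(** On the box spanned by x and y, decay can be measured at x alone, up to a power of w (y - x).
    This lets a decaying bound pass through [mean_value]. *)
Let box_weight (x y z : E) k : (forall j, `|z ord0 j - x ord0 j| <= `|y ord0 j - x ord0 j|) ->
  w z ^- k <= w (y - x) ^+ k * w x ^- k.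
Proof.
move=> h; have -> : z = (z - x) + x by rewrite subrK.
rewrite (le_trans (weightXV_mulD _ _ _))// ler_wpM2r ?invr_ge0 ?exprn_ge0 ?weight_ge0//.
rewrite lerXn2r ?nnegrE ?weight_ge0// lerD2l ler_sum// => j _.
by rewrite !mxE.
Qed.

(** Here w (y - x) - 1 is the l1 distance between x and y, and the factor 2 adds the real and
    imaginary parts. *)
Lemma dle_mean_value f A k (x y : E) : 0 <= A -> dle 1 f (fun x => A * w x ^- k) ->
  nrm (f y - f x) <= 2 * (w (y - x) - 1) * w (y - x) ^+ k * (A * w x ^- k).
Proof.
move=> A0 hf; have wE : w (y - x) - 1 = \sum_i `|y ord0 i - x ord0 i|.
  by rewrite /w addrAC subrr add0r; apply: eq_bigr => i _; rewrite !mxE.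
have B i (z : E) : (forall j, `|z ord0 j - x ord0 j| <= `|y ord0 j - x ord0 j|) ->
    nrm (pderiv i f z) <= A * (w (y - x) ^+ k * w x ^- k).
  move=> h; have [_ h'] := dle_pderiv i hf; rewrite (le_trans (dle_nrm h' z))//.
  by rewrite ler_wpM2l// box_weight.
have part (p : R[i] -> R) : (forall z, `|p z| <= nrm z) ->
    (forall i x, derivable (fun y => p (f y)) x 'e_i) ->
    (forall i z, 'D_('e_i) (fun y => p (f y)) z = p (pderiv i f z)) ->
    `|p (f y) - p (f x)| <= (w (y - x) - 1) * (A * (w (y - x) ^+ k * w x ^- k)).
  move=> pn df pE; rewrite wE; apply: (@mean_value _ _ (fun u : E => p (f u)) x y) => // i z h.
  by rewrite pE (le_trans (pn _))// B.
have h1 := part (@complex.Re R) Re_le_nrm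
  (fun i x => ((dle_pderiv i hf).1 x).1) (fun i z => erefl).
have h2 := part (@complex.Im R) Im_le_nrm
  (fun i x => ((dle_pderiv i hf).1 x).2) (fun i z => erefl).
rewrite (le_trans (nrm_le_ReIm _))// ReD ReN ImD ImN (le_trans (lerD h1 h2))//.
by rewrite le_eqVlt; apply/orP; left; apply/eqP; ring.
Qed.

(** Differentiation commutes with translation, so the mean value inequality applies to every
    derivative; it consumes one order of smoothness. *)
Lemma dle_translateB n f A k (p q : E) : 0 <= A ->
  dle n.+1 f (fun x => A * w x ^- k) ->
  dle n (fun x => f (x - p) - f (x - q))
    (fun x => 2 * (w (q - p) - 1) * w (q - p) ^+ k * (A * w (x - q) ^- k)).
Proof.
move=> A0; elim: n f => [|n IH] f hf.
  split.
    have [c _] := dle_translate p hf; have [c' _] := dle_translate q hf.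
    have [c'' _] := dleZ (-1) (dle_translate q hf).
    have := contCD c c''; congr contC; apply/funext => x; by rewrite mulN1r.
  split=> // x.
  have := dle_mean_value (x - q) (x - p) A0 hf.
  have -> : x - p - (x - q) = q - p by apply/rowP => j; rewrite !mxE; ring.
  exact.
have h0 := IH f (dle_leq (leqnSn _) hf).
split; first exact: dle_cont h0.
split; first exact: dle_nrm h0.
move=> i; have [_ hp] := dle_pderiv i hf.
have df := (dle_pderiv i hf).1.
have [d1 e1] := pderiv_translate p df; have [d2 e2] := pderiv_translate q df.
have [d3 e3] := pderivZ (-1) d2; have [d4 e4] := pderivD d1 d3.
have e (F : E -> R[i]) : (fun x => F (x - p) + - 1 * F (x - q)) =
    (fun x => F (x - p) - F (x - q)) by apply/funext => x; rewrite mulN1r.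
rewrite e1 e3 e2 !e in e4; rewrite e in d4.
by rewrite e4; split=> //; exact: IH.
Qed.

End schwartz_bounds.

(** * Characters, the chirp and tempered distributions *)

Lemma nrm_cis_sub1 (R : realType) (t : R) : nrm (cis t - 1) <= 2 * `|t|.
Proof.
have h1 : `|cos t - cos 0| <= `|t| * 1.
  apply: (@line_bound _ cos (fun s => - sin s)) => s.
  by move=> _; rewrite normrN ler_norml sin_geN1 sin_le1.
have h2 : `|sin t - sin 0| <= `|t| * 1.
  apply: (@line_bound _ sin cos) => s.
  by move=> _; rewrite ler_norml cos_geN1 cos_le1.
rewrite cos0 mulr1 in h1; rewrite sin0 subr0 mulr1 in h2.
rewrite (le_trans (nrm_le_ReIm _))// ReD ReN ImD ImN /= subr0.
by rewrite (_ : 2 * `|t| = `|t| + `|t|) ?lerD//; ring.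
Qed.

Section phases.
Context {R : realType} {d : nat}.
Local Notation E := 'rV[R]_d.
Local Notation w := (@weight R d).
Variable hbar : R.
Hypothesis hbar01 : 0 < hbar <= 1.
Implicit Types (f g : E -> R[i]) (a b x y : E).

Let h0 : 0 < hbar. Proof. by case/andP: hbar01. Qed.
Let h1 : hbar <= 1. Proof. by case/andP: hbar01. Qed.
Let hV0 : 0 <= hbar^-1. Proof. by rewrite invr_ge0 ltW. Qed.
Let hV1 : 1 <= hbar^-1. Proof. by rewrite invf_ge1. Qed.

Lemma dotDl a b x : dot (a + b) x = dot a x + dot b x.
Proof. by rewrite /dot -big_split; apply: eq_bigr => i _; rewrite mxE mulrDl. Qed.

Lemma dotC a b : dot a b = dot b a.
Proof. by apply: eq_bigr => i _; rewrite mulrC. Qed.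

Lemma dotDr a x y : dot a (x + y) = dot a x + dot a y.
Proof. by rewrite dotC dotDl !(dotC a). Qed.

Lemma dotZl (c : R) a x : dot (c *: a) x = c * dot a x.
Proof. by rewrite /dot mulr_sumr; apply: eq_bigr => i _; rewrite mxE mulrA. Qed.

Lemma dotZr (c : R) a x : dot a (c *: x) = c * dot a x.
Proof. by rewrite dotC dotZl dotC. Qed.

Lemma dotNl a x : dot (- a) x = - dot a x.
Proof. by rewrite -scaleN1r dotZl mulN1r. Qed.

Lemma dotNr a x : dot a (- x) = - dot a x.
Proof. by rewrite dotC dotNl dotC. Qed.

Definition chr a x : R[i] := cis (dot a x / hbar).

Lemma chrC a x : chr a x = chr x a.
Proof. by rewrite /chr dotC. Qed.

Lemma chrDl a b x : chr (a + b) x = chr a x * chr b x.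
Proof. by rewrite /chr dotDl mulrDl cisD. Qed.

Lemma chrDr a x y : chr a (x + y) = chr a x * chr a y.
Proof. by rewrite /chr dotDr mulrDl cisD. Qed.

Lemma chr0 x : chr 0 x = 1.
Proof. by rewrite /chr -(scale0r 0) dotZl mul0r mul0r cis0. Qed.

Lemma conj_chr a x : conjc (chr a x) = chr (- a) x.
Proof. by rewrite /chr conj_cis dotNl mulNr. Qed.

Lemma chrNr a x : chr a (- x) = chr (- a) x.
Proof. by rewrite /chr dotNr dotNl. Qed.

Lemma nrm_chr a x : nrm (chr a x) = 1.
Proof. exact: nrm_cis. Qed.

Lemma pderiv_chr i a : derC i (chr a) /\
  pderiv i (chr a) = (fun x => Complex 0 (a ord0 i / hbar) * chr a x).
Proof.
apply: isdC_derC => x; apply: isdC_cis.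
rewrite (_ : (fun y => _) = hbar^-1 \*: (fun y => dot a y)).
  apply: (is_derive_eq (is_deriveZ _ (is_derive_dotr i a x))).
  by rewrite /GRing.scale/= mulrC.
by apply/funext => y; rewrite /= mulrC.
Qed.

Lemma nrm_imag (t : R) : nrm (Complex 0 t) = `|t|.
Proof. by rewrite /= expr0n /= add0r sqrtr_sqr. Qed.

Lemma nrm_imag_div (t : R) : nrm (Complex 0 (t / hbar)) = `|t| / hbar.
Proof. by rewrite nrm_imag normrM (@ger0_norm _ hbar^-1)// hV0. Qed.

Lemma continuous_dot a : continuous (fun x => dot a x).
Proof.
apply/continuous_cubeP => x e e0; exists (e / (w a)); first by rewrite divr_gt0 ?weight_gt0.
move=> y xy; have -> : dot a x - dot a y = dot a (x - y) by rewrite dotDr dotNr.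
rewrite (le_lt_trans (ler_norm_sum _ _ _))//.
apply: (@le_lt_trans _ _ (\sum_i `|a ord0 i| * (e / w a))).
  by apply: ler_sum => i _; rewrite normrM ler_wpM2l// !mxE ltW.
rewrite -mulr_suml mulrCA -ltr_pdivlMl// mulVf ?gt_eqF//.
by rewrite ltr_pdivrMr ?weight_gt0// mul1r /w ltrDr ltr01.
Qed.

Lemma contC_chr a : contC (chr a).
Proof.
apply: contC_cis => x; exact: (cvgM (@continuous_dot a x) (cvg_cst hbar^-1)).
Qed.

(** Each derivative brings a factor a_i / hbar. Because hbar is at most 1, w a / hbar is at least 1,
    so the top power also covers the lower orders. *)
Lemma dle_chr n a : dle n (chr a) (fun=> (w a / hbar) ^+ n).
Proof.
have wh : 1 <= w a / hbar by rewrite -[leLHS]mulr1 ler_pM// weight_ge1.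
have wh0 : 0 <= w a / hbar by exact: le_trans ler01 wh.
elim: n => [|n IH]; first by split; [exact: contC_chr|split=> // x; rewrite nrm_chr].
split; first exact: contC_chr.
split=> [x|i]; first by rewrite nrm_chr exprn_ege1.
have [h ->] := pderiv_chr i a; split=> //.
apply: dle_mono (dleZ _ IH) => x.
rewrite nrm_imag_div exprS ler_wpM2r ?exprn_ge0//.
by rewrite ler_wpM2r ?coord_le_weight// hV0.
Qed.

Lemma slow_chr a : slow (chr a).
Proof.
move=> n; exists ((w a / hbar) ^+ n), 0%N; split.
  by rewrite exprn_ge0// mulr_ge0 ?weight_ge0// hV0.
by apply: dle_mono (dle_chr n a) => x; rewrite expr0 mulr1.
Qed.

Lemma dot_le_weight1 a x : `|dot a x| <= (w a - 1) * w x.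
Proof.
rewrite /w addrAC subrr add0r (le_trans (ler_norm_sum _ _ _))// mulr_suml.
apply: ler_sum => i _; rewrite normrM ler_wpM2l//; exact: coord_le_weight.
Qed.

(** A Lipschitz bound at frequency 0 for all derivatives at once: the value is at most twice the
    phase, which costs one power of w x, and every derivative already carries a factor a_i. *)
Lemma dle_chr_sub1 n a : dle n (fun x => chr a x - 1)
  (fun x => 2 * (w a - 1) / hbar * (w a / hbar) ^+ n * w x).
Proof.
have wh : 1 <= w a / hbar by rewrite -[leLHS]mulr1 ler_pM// weight_ge1.
have wh0 : 0 <= w a / hbar by exact: le_trans ler01 wh.
have wa0 : 0 <= w a - 1 by rewrite subr_ge0 weight_ge1.
have cc : contC (fun x => chr a x - 1) by exact: contCD (contC_chr a) (contC_cst _ _).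
have b m x : nrm (chr a x - 1) <= 2 * (w a - 1) / hbar * (w a / hbar) ^+ m * w x.
  rewrite (le_trans (nrm_cis_sub1 _))// -!mulrA ler_wpM2l// normrM.
  rewrite (ger0_norm (_ : 0 <= hbar^-1)) ?hV0//.
  rewrite (@le_trans _ _ ((w a - 1) * w x / hbar))//.
    by rewrite ler_wpM2r ?dot_le_weight1// hV0.
  rewrite -mulrA ler_wpM2l// mulrC ler_wpM2l ?hV0//.
  by rewrite ler_peMl ?weight_ge0// exprn_ege1.
case: n => [|n]; first by split=> //; split=> // x; exact: b.
split=> //; split=> [x|i]; first exact: b.
have [h ->] : derC i (fun x => chr a x + -1) /\ pderiv i (fun x => chr a x + -1) =
    (fun x => Complex 0 (a ord0 i / hbar) * chr a x).
  have [h e] := pderiv_chr i a; have [h' e'] := pderiv_cst i (-1 : R[i]).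
  have [h'' e''] := pderivD h h'.
  by split=> //; rewrite e'' e e'; apply/funext => x; rewrite addr0.
split=> //; apply: dle_mono (dleZ _ (dle_chr n a)) => x.
rewrite nrm_imag_div.
have ai : `|a ord0 i| <= w a - 1.
  by rewrite /w addrAC subrr add0r (bigD1 i)//= lerDl sumr_ge0.
rewrite (@le_trans _ _ (2 * (w a - 1) / hbar * (w a / hbar) ^+ n.+1))//; last first.
  rewrite ler_peMr ?weight_ge1// mulr_ge0 ?exprn_ge0//.
  by rewrite mulr_ge0 ?mulr_ge0// hV0.
rewrite ler_pM ?exprn_ge0//.
- by rewrite mulr_ge0// hV0.
- by rewrite ler_wpM2r ?hV0//; lra.
- by rewrite exprS ler_peMl// exprn_ge0.
Qed.

Definition chirp x : R[i] := cis (dot x x / (2 * hbar)).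

Lemma pderiv_chirp i : derC i chirp /\
  pderiv i chirp = (fun x => Complex 0 hbar^-1 * ((x ord0 i)%:C%C * chirp x)).
Proof.
apply: isdC_derC => x; rewrite mulrA.
have -> : Complex 0 hbar^-1 * (x ord0 i)%:C%C = Complex 0 (x ord0 i / hbar).
  by apply: complexP => /=; ring.
apply: isdC_cis.
rewrite (_ : (fun y => _) = (2 * hbar)^-1 \*: (fun y => dot y y)).
  apply: (is_derive_eq (is_deriveZ _ (is_derive_dotd i x))).
  by rewrite /GRing.scale/=; field; rewrite gt_eqF.
by apply/funext => y; rewrite /= mulrC.
Qed.

Lemma continuous_dotd : continuous (fun x => dot x x).
Proof.
rewrite (_ : (fun x => _) = \sum_(j < d) (fun x : E => x ord0 j * x ord0 j)); last first.
  by apply/funext => y; rewrite fct_sumE.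
elim/big_ind: _ => [|u v hu hv|j _].
- exact: cst_continuous.
- by move=> x; exact: cvgD (hu x) (hv x).
- move=> x; exact: (cvgM (@coord_continuous R 1 d ord0 j x) (@coord_continuous R 1 d ord0 j x)).
Qed.

Lemma contC_chirp : contC chirp.
Proof.
apply: contC_cis => x; exact: (cvgM (@continuous_dotd x) (cvg_cst (2 * hbar)^-1)).
Qed.

(** Each derivative multiplies by x_i / hbar up to a unit, so order n costs w ^ n. Keeping A at
    least 1 covers the undifferentiated chirp, of modulus 1. *)
Lemma slow_chirp : slow chirp.
Proof.
suff h n : exists2 A, 1 <= A & dle n chirp (fun x => A * w x ^+ n).
  move=> n; have [A A1 hA] := h n; exists A, n; split=> //.
  exact: le_trans ler01 A1.
elim: n => [|n [A A1 IH]].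
  exists 1 => //; split; first exact: contC_chirp.
  by split=> // x; rewrite nrm_cis mulr1.
have A0 : 0 <= A by exact: le_trans ler01 A1.
pose B := hbar^-1 * (2 ^+ n * A).
have B1 : 1 <= B.
  by rewrite /B -[leLHS]mulr1 ler_pM// -[leLHS]mulr1 ler_pM// exprn_ege1// ler1n.
exists B => //; split; first exact: contC_chirp.
split=> [x|i].
  by rewrite nrm_cis -[leLHS]mulr1 ler_pM// weightX_ge1.
have [h ->] := pderiv_chirp i; split=> //.
apply: dle_mono (dleZ _ (dleM (dle_coord n i) IH)) => x.
rewrite nrm_imag ger0_norm ?hV0// /B exprS -!mulrA.
by rewrite ler_wpM2l ?hV0// ler_wpM2l ?exprn_ge0// mulrCA.
Qed.

Lemma slowZ (c : R[i]) f : slow f -> slow (fun x => c * f x).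
Proof.
move=> hf n; have [A [k [A0 hA]]] := hf n; exists (nrm c * A), k.
split; first by rewrite mulr_ge0 ?nrm_ge0.
by apply: dle_mono (dleZ c hA) => x; rewrite mulrA.
Qed.

Lemma slow_Fplus : slow (Fplus hbar : E -> R[i]).
Proof.
have := slowZ (((2 * pi * hbar) `^ (- (d%:R / 2)))%:C%C * cis (- (pi * d%:R / 4)))
  slow_chirp.
exact.
Qed.

(** The value is O(eps) by the mean value inequality at 0, which costs one power of the weight; a
    derivative of phi (eps x) carries its own factor eps. The restriction eps <= 1 keeps the
    remaining chain-rule factors below 2 ^ n. *)
Lemma dle_dilate_sub1 n phi : rapid phi -> phi 0 = 1 ->
  exists2 A, 0 <= A & forall eps : R, 0 < eps <= 1 ->
    dle n (fun x => dilate eps phi x - 1) (fun x => eps * A * w x).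
Proof.
move=> hphi phi0; have [A A0 hA] := hphi n.+1 0%N.
have hA1 : dle 1 phi (fun x => A * w x ^- 0) by apply: dle_leq hA.
exists (2 ^+ n.+1 * A); first by rewrite mulr_ge0 ?exprn_ge0.
move=> eps /andP[e0 e1]; have e0' := ltW e0.
have b m x : nrm (dilate eps phi x - 1) <= eps * (2 ^+ m.+1 * A) * w x.
  rewrite -phi0; have := dle_mean_value 0 (eps *: x) A0 hA1.
  rewrite subr0 expr0 invr1 !mulr1 => /le_trans; apply.
  have -> : w (eps *: x) - 1 = eps * (w x - 1).
    have E1 y : w y - 1 = \sum_i `|y ord0 i| by rewrite /w addrAC subrr add0r.
    rewrite !E1 mulr_sumr; apply: eq_bigr => i _.
    by rewrite mxE normrM ger0_norm.
  rewrite [2 * _]mulrCA -!mulrA ler_wpM2l// exprS -!mulrA ler_wpM2l//.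
  rewrite (@le_trans _ _ (w x * A))//; first by rewrite ler_wpM2r// gerDl lerN10.
  by rewrite [A * _]mulrC ler_peMl ?mulr_ge0 ?weight_ge0// exprn_ege1// ler1n.
have cc : contC (fun x => dilate eps phi x - 1).
  exact: contCD (rapid_cont (rapid_dilate e0 hphi)) (contC_cst _ _).
case: n hA => [|n] hA; first by split=> //; split=> // x; exact: b.
split=> //; split=> [x|i]; first exact: b.
have [p1 p2] := dle_pderiv i (dle_leq (leqnSn _) hA).
have [h e] : derC i (dilate eps phi) /\ pderiv i (dilate eps phi) =
    (fun x => eps%:C%C * pderiv i phi (0 + eps *: x)).
  have := pderiv_affine 0 eps p1.
  by rewrite (_ : (fun y => phi (0 + eps *: y)) = dilate eps phi)//;
    apply/funext => y; rewrite add0r.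
have [h' e'] := pderiv_cst i (-1 : R[i]).
have [h'' e''] := pderivD h h'.
split=> //; rewrite e'' e e'.
rewrite (_ : (fun x => _) = (fun x => eps%:C%C * pderiv i phi (0 + eps *: x))); last first.
  by apply/funext => x; rewrite addr0.
apply: dle_mono (dleZ _ (dle_affine 0 eps p2)) => x.
rewrite nrm_real ger0_norm// -mulrA ler_wpM2l// invr1 mulr1.
rewrite -mulrA; apply: (@le_trans _ _ (2 ^+ n.+2 * A)).
  rewrite ler_wpM2r// (@le_trans _ _ (2 ^+ n))//.
    by rewrite lerXn2r ?nnegrE ?addr_ge0//; lra.
  by rewrite ler_weXn2l ?ler1n// (leq_trans (leqnSn n)).
by rewrite mulrA ler_peMr ?weight_ge1// mulr_ge0// exprn_ge0.
Qed.

(** Continuity through majorants: any A admissible in [dle] bounds u f, so no supremum has to be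
    computed. The same N serves as order of differentiation and as rate of decay. *)
Definition temp (u : (E -> R[i]) -> R[i]) : Prop :=
  (forall (c : R[i]) f g, rapid f -> rapid g ->
     u (fun y => c * f y + g y) = c * u f + u g) /\
  (exists (N : nat) (c : R), 0 <= c /\ forall f A, rapid f -> 0 <= A ->
     dle N f (fun x => A * w x ^- N) -> nrm (u f) <= c * A).

Lemma tempered_temp u : tempered u -> temp u.
Proof.
move=> [lin [N [c hc]]]; split.
  by move=> a f g hf hg; apply: lin; exact: rapid_schwartz.
exists N, `|c|; split=> // f A hf A0 hA.
have S0 : (0 <= seminorm N f)%E.
  apply: (@le_trans _ _ ((1 + enorm (0 : E)) ^+ N * nrm (pderivs [::] f 0))%:E).
    by rewrite lee_fin mulr_ge0 ?nrm_ge0// exprn_ge0// addr_ge0// sqrtr_ge0.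
  by apply: ereal_sup_ubound; exists [::], 0.
have SA : (seminorm N f <= A%:E)%E.
  apply: ge_ereal_sup => _ [s [x [sN ->]]]; rewrite lee_fin.
  apply: (@le_trans _ _ (w x ^+ N * nrm (pderivs s f x))).
    rewrite ler_wpM2r ?nrm_ge0// lerXn2r ?nnegrE ?weight_ge0 ?enorm_le_weight//.
    by rewrite addr_ge0// sqrtr_ge0.
  rewrite mulrC -ler_pdivlMr ?weightX_gt0//; exact: dle_pderivs_nrm hA sN.
rewrite -lee_fin (le_trans (hc _ (rapid_schwartz hf)))// EFinM.
apply: (@le_trans _ _ (`|c|%:E * seminorm N f)%E).
  by rewrite lee_wpmul2r// lee_fin ler_norm.
by rewrite lee_wpmul2l// lee_fin.
Qed.

Lemma temp_mul u phi : temp u -> slow phi -> temp (mul_distr u phi).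
Proof.
move=> [lin [N [c [c0 hc]]]] hphi; split.
  move=> a f g hf hg; rewrite /mul_distr -lin; last 2 first.
  - by under eq_fun do rewrite mulrC; exact: rapid_slowM.
  - by under eq_fun do rewrite mulrC; exact: rapid_slowM.
  by congr u; apply/funext => y; ring.
have [B [m [B0 hB]]] := hphi N; exists (N + m)%N, (c * (2 ^+ N * B)).
split; first by rewrite !mulr_ge0// exprn_ge0.
move=> f A hf A0 hA; rewrite -mulrA; apply: hc.
- by under eq_fun do rewrite mulrC; exact: rapid_slowM.
- by rewrite !mulr_ge0// exprn_ge0.
apply: dle_mono (dleM hB (dle_leq (leq_addr _ _) hA)) => x.
rewrite exprD invfM -!mulrA ler_wpM2l ?exprn_ge0// ler_wpM2l//.
by rewrite mulrCA ler_wpM2l// mulrCA mulrV ?mulr1// unitfE gt_eqF ?weightX_gt0.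
Qed.

Lemma temp0 u : temp u -> u (fun=> 0) = 0.
Proof.
move=> [lin _]; have e := lin (-1) _ _ rapid0 rapid0.
have -> : u (fun=> 0) = u (fun _ : E => -1 * 0 + 0).
  by congr u; apply/funext => y; rewrite mulr0 addr0.
by rewrite e mulN1r addNr.
Qed.

Lemma tempZ u (c : R[i]) f : temp u -> rapid f -> u (fun y => c * f y) = c * u f.
Proof.
move=> tu hf; have [lin _] := tu; rewrite -[RHS]addr0 -(temp0 tu) -(lin c _ _ hf rapid0).
by congr u; apply/funext => y; rewrite addr0.
Qed.

Lemma tempB u f g : temp u -> rapid f -> rapid g ->
  u (fun y => f y - g y) = u f - u g.
Proof.
move=> [lin _] hf hg; have := lin (-1) g f hg hf; rewrite mulN1r addrC => <-.
by congr u; apply/funext => y; rewrite mulN1r addrC.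
Qed.

Lemma temp_sum u (I : Type) (s : seq I) (F : I -> E -> R[i]) (a : I -> R[i]) : temp u ->
  (forall i, rapid (F i)) ->
  rapid (fun y => \sum_(i <- s) a i * F i y) /\
  u (fun y => \sum_(i <- s) a i * F i y) = \sum_(i <- s) a i * u (F i).
Proof.
move=> tu hF; have [lin _] := tu; have r0 := @rapid0 R d; have u0 := temp0 tu.
elim: s => [|i s [IH1 IH2]].
  split; first by under eq_fun do rewrite big_nil.
  by under eq_fun do rewrite big_nil; rewrite big_nil.
split.
  by under eq_fun do rewrite big_cons; apply: rapidD => //; exact: rapidZ.
by under eq_fun do rewrite big_cons; rewrite lin// IH2 big_cons.
Qed.

End phases.

(** * The Fourier transform *)

Lemma cvg0_squeeze (R : realType) (f u : R^nat) (C : R) :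
  (forall n, 0 <= f n <= C * u n) -> u n @[n --> \oo] --> (0 : R) ->
  f n @[n --> \oo] --> (0 : R).
Proof.
move=> fu u0; apply: (@squeeze_cvgr _ _ _ _ (fun=> 0) (fun n => C * u n)).
- by near=> n; exact: fu.
- exact: cvg_cst.
- by rewrite -[X in _ --> X](mulr0 C); apply: cvgM => //; exact: cvg_cst.
Unshelve. all: by end_near. Qed.

Lemma cvg_natSinv (R : realType) : (n.+1%:R^-1 : R) @[n --> \oo] --> (0 : R).
Proof. exact: cvg_harmonic. Qed.

Lemma complex_cvg_unique (R : realType) (z : (R[i])^nat) (a b : R[i]) :
  nrm (z n - a) @[n --> \oo] --> (0 : R) -> nrm (z n - b) @[n --> \oo] --> (0 : R) ->
  a = b.
Proof.
move=> za zb; apply/eqP; rewrite -subr_eq0 -nrm_eq0.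
have h : (fun=> nrm (a - b)) n @[n --> \oo] --> (0 : R).
  apply: (@squeeze_cvgr _ _ _ _ (fun=> 0) (fun n => nrm (z n - a) + nrm (z n - b))).
  - near=> n; rewrite nrm_ge0 andTb (nrm_distC (z n) a).
    by rewrite (le_trans _ (nrmD _ _))// addrA subrK.
  - exact: cvg_cst.
  - by rewrite -[X in _ --> X]addr0; exact: cvgD.
by apply/eqP; exact: (cvg_unique (@Rhausdorff R) (cvg_cst _) h).
Unshelve. all: by end_near. Qed.

Section lipschitz.
Context {R : realType} {d : nat}.
Local Notation E := 'rV[R]_d.
Local Notation w := (@weight R d).

Lemma weight_cube (x y : E) r : cube x r y -> w (x - y) - 1 <= d%:R * r.
Proof.
move=> h; rewrite /w addrAC subrr add0r.
apply: (@le_trans _ _ (\sum_(i < d) r)); last by rewrite sumr_const card_ord mulr_natl.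
by apply: ler_sum => i _; rewrite !mxE ltW.
Qed.

(** Since w (x - y) - 1 is an l1 distance, the hypothesis is a local Lipschitz condition; its
    constant may depend on x in any way. *)
Lemma contC_lipschitz (f : E -> R[i]) (B : E -> R) :
  (forall x y, cube x 1 y -> nrm (f x - f y) <= B x * (w (x - y) - 1)) -> contC f.
Proof.
move=> h; have part (p : R[i] -> R) : (forall z, `|p z| <= nrm z) ->
    (forall z z', p (z - z') = p z - p z') -> continuous (fun x => p (f x)).
  move=> pn pB; apply/continuous_cubeP => x e e0.
  have B0 : 0 <= `|B x| * d%:R by rewrite mulr_ge0.
  have B1 : 0 < `|B x| * d%:R + 1 by rewrite ltr_wpDl.
  pose r := Num.min 1 (e / (`|B x| * d%:R + 1)).
  have r0 : 0 < r by rewrite lt_min ltr01 divr_gt0.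
  exists r => // y xy.
  have x1 : cube x 1 y.
    by move=> i; apply: (lt_le_trans (xy i)); rewrite ge_min lexx.
  rewrite -pB (le_lt_trans (pn _))// (le_lt_trans (h _ _ x1))//.
  apply: (@le_lt_trans _ _ (`|B x| * (d%:R * r))).
    apply: (@le_trans _ _ (`|B x| * (w (x - y) - 1))).
      by rewrite ler_wpM2r ?ler_norm// subr_ge0 weight_ge1.
    by rewrite ler_wpM2l// weight_cube.
  apply: (@le_lt_trans _ _ ((`|B x| * d%:R) * (e / (`|B x| * d%:R + 1)))).
    by rewrite mulrA ler_wpM2l// ge_min lexx orbT.
  by rewrite mulrCA gtr_pMr// ltr_pdivrMr// mul1r ltrDl.
split.
  exact: part Re_le_nrm (fun z w => etrans (ReD _ _) (congr1 _ (ReN _))).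
exact: part Im_le_nrm (fun z w => etrans (ImD _ _) (congr1 _ (ImN _))).
Qed.

End lipschitz.

Section fourier.
Context {R : realType} {d : nat}.
Local Notation E := 'rV[R]_d.
Local Notation w := (@weight R d).
Local Notation mu := (leb R d).
Variable hbar : R.
Hypothesis hbar01 : 0 < hbar <= 1.
Implicit Types (f g m : E -> R[i]) (x y eta : E).
Local Notation chr := (chr hbar).

Let h0 : 0 < hbar. Proof. by case/andP: hbar01. Qed.

(** The factor (2 pi hbar)^(-d/2) is left out, as it would only change the constant K in
    [fourier_inversion]. *)
Definition FT m eta : R[i] := integralC mu (fun y => m y * chr (- eta) y).

Lemma measC_chr eta : measC (chr eta).
Proof. exact/contC_measC/contC_chr. Qed.

Lemma integrableC_chr f eta : integrableC mu f ->
  integrableC mu (fun y => f y * chr eta y).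
Proof.
move=> hf; apply: (integrableC_dom _ (integrable_nrm hf)).
  by apply: measCM; [exact: integrableC_measC hf|exact: measC_chr].
by move=> x; rewrite nrmM nrm_chr mulr1.
Qed.

Lemma measC_chr2 : measC (fun z : E * E => chr z.1 z.2).
Proof.
have mdot : measurable_fun setT (fun z : E * E => dot z.1 z.2 / hbar).
  apply: measurable_funM => //; apply: measurable_sum => i.
  apply: measurable_funM.
    exact: (measurableT_comp (measurable_coord i) measurable_fst).
  exact: (measurableT_comp (measurable_coord i) measurable_snd).
split.
  apply: (measurableT_comp (f := cos) _ mdot).
  by apply: continuous_measurable_fun; exact: continuous_cos.
apply: (measurableT_comp (f := sin) _ mdot).
by apply: continuous_measurable_fun; exact: continuous_sin.
Qed.

(** Fubini for a bounded kernel. With a character as kernel this is the multiplication formula for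
    [FT]; with the conjugate of the function as g, it also gives the Plancherel-type identity used
    in [fourier_inversion]. *)
Lemma integralC_kernel (f g : E -> R[i]) (k : E * E -> R[i]) :
  integrableC mu f -> integrableC mu g -> measC k -> (forall z, nrm (k z) <= 1) ->
  integralC mu (fun x => f x * integralC mu (fun y => g y * k (x, y))) =
  integralC mu (fun y => g y * integralC mu (fun x => f x * k (x, y))).
Proof.
move=> hf hg mk k1.
have mf := integrableC_measC hf; have mg := integrableC_measC hg.
pose h (z : E * E) := f z.1 * (g z.2 * k z).
have mh : measC h.
  apply: measCM; first exact: measC_comp measurable_fst mf.
  by apply: measCM => //; exact: measC_comp measurable_snd mg.
have hle x y : nrm (h (x, y)) <= nrm (f x) * nrm (g y).
  by rewrite !nrmM ler_wpM2l ?nrm_ge0// ler_piMr ?nrm_ge0.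
have ig x : integrableC mu (fun y => g y * k (x, y)).
  apply: (integrableC_dom _ (integrable_nrm hg)).
    by apply: measCM => //; exact: measC_comp (pair1_measurable x) mk.
  by move=> y; rewrite lee_fin nrmM ler_piMr ?nrm_ge0.
have if_ y : integrableC mu (fun x => f x * k (x, y)).
  apply: (integrableC_dom _ (integrable_nrm hf)).
    by apply: measCM => //; exact: measC_comp (pair2_measurable y) mk.
  by move=> x; rewrite lee_fin nrmM ler_piMr ?nrm_ge0.
have ih : integrableC (mu \x mu)%E h.
  apply: integrableC_prod1 => //.
  have /integrableP[_] := integrable_nrm hf; have /integrableP[_] := integrable_nrm hg.
  under eq_integral do rewrite gee0_abs ?lee_fin ?nrm_ge0//.
  move=> goo; under eq_integral do rewrite gee0_abs ?lee_fin ?nrm_ge0//.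
  move=> foo.
  apply: (@le_lt_trans _ _ (\int[mu]_x ((nrm (f x))%:E * \int[mu]_y (nrm (g y))%:E))%E).
    apply: ge0_le_integral => //.
    - by move=> x _; apply: integral_ge0 => y _; rewrite lee_fin nrm_ge0.
    - apply: (measurable_fun_fubini_tonelli_F (fun z => (nrm (h z))%:E)).
        by apply/measurable_EFinP; exact: measurable_nrm.
      by move=> z; rewrite lee_fin nrm_ge0.
    - apply: emeasurable_funM => //; apply/measurable_EFinP; exact: measurable_nrm.
    - move=> x _; rewrite -ge0_integralZl//.
      + apply: ge0_le_integral => //.
        * by move=> y _; rewrite lee_fin nrm_ge0.
        * apply/measurable_EFinP; apply: measurable_nrm.
          exact: measC_comp (pair1_measurable x) mh.
        * by apply: emeasurable_funM => //; apply/measurable_EFinP; exact: measurable_nrm.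
        * by move=> y _; rewrite -EFinM lee_fin hle.
      + by apply/measurable_EFinP; exact: measurable_nrm.
      + by move=> y _; rewrite lee_fin nrm_ge0.
      + by rewrite lee_fin nrm_ge0.
  have g0 : (0 <= \int[mu]_y (nrm (g y))%:E)%E.
    by apply: integral_ge0 => y _; rewrite lee_fin nrm_ge0.
  rewrite ge0_integralZr//; last 2 first.
  - by apply/measurable_EFinP; exact: measurable_nrm.
  - by move=> x _; rewrite lee_fin nrm_ge0.
  rewrite lte_mul_pinfty//.
    by apply: integral_ge0 => y _; rewrite lee_fin nrm_ge0.
  rewrite ge0_fin_numE//.
  by apply: integral_ge0 => y _; rewrite lee_fin nrm_ge0.
transitivity (integralC (mu \x mu)%E h).
  rewrite integralC_prod1//; last by move=> x; exact: (integrableCZ (f x) (ig x)).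
  by apply: eq_integralC => x; rewrite -(integralCZ (f x) (ig x)).
have hE y : (fun x => h (x, y)) = (fun x => g y * (f x * k (x, y))).
  by apply/funext => x; rewrite /h /=; ring.
rewrite integralC_prod2//; last by move=> y; rewrite hE; exact: integrableCZ.
by apply: eq_integralC => y; rewrite hE integralCZ.
Qed.

Lemma FT_le m (W : E -> R) eta : rapid m -> (forall x, nrm (m x) <= W x) ->
  mu.-integrable setT (EFin \o W) -> nrm (FT m eta) <= 2 * \int[mu]_x W x.
Proof.
move=> hm mW iW; apply: nrm_integralC_le => //.
  exact/integrableC_chr/rapid_integrable.
by move=> x; rewrite nrmM nrm_chr mulr1.
Qed.

Lemma contC_FT m : rapid m -> contC (FT m).
Proof.
(* One power of decay more than integrability requires: it absorbs the weight lost in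
   [dle_chr_sub1]. *)
move=> hm; have [A A0 hA] := hm 0%N (1 + 2 * d)%N.
pose W x := 2 / hbar * A * wint x.
have iW : mu.-integrable setT (EFin \o W).
  exact: (integrableZl measurableT (2 / hbar * A) (integrable_wint d)).
pose B := 2 * \int[mu]_x W x.
apply: (@contC_lipschitz _ _ _ (fun=> B)) => x y _.
have im := rapid_integrable hm.
rewrite -integralCB; [|exact: integrableC_chr|exact: integrableC_chr].
have iWw : mu.-integrable setT (EFin \o (fun z => (w (x - y) - 1) * W z)).
  exact: (integrableZl measurableT (w (x - y) - 1) iW).
apply: (@le_trans _ _ (2 * \int[mu]_z ((w (x - y) - 1) * W z))).
  apply: nrm_integralC_le => //.
    by apply: integrableCB; exact: integrableC_chr.
  move=> z; rewrite -mulrBr (_ : - x = - y + (y - x)); last by rewrite addrA addNr add0r.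
  rewrite chrDl -[X in _ * (_ - X)]mulr1 -mulrBr !nrmM nrm_chr mul1r.
  have := dle_nrm (dle_chr_sub1 hbar01 0 (y - x)) z.
  rewrite expr0 mulr1 (_ : w (y - x) = w (x - y)) => [h|]; last by rewrite -weightN opprB.
  apply: (@le_trans _ _ (A * w z ^- (1 + 2 * d) * (2 * (w (x - y) - 1) / hbar * w z))).
    by rewrite ler_pM ?nrm_ge0// (dle_nrm hA).
  rewrite /W /wint exprD expr1 invfM le_eqVlt; apply/orP; left; apply/eqP.
  rewrite -[RHS]mulr1 -[X in _ = _ * X](mulVf (weight_neq0 z)); ring.
by rewrite RintegralZl// mulrCA mulrC.
Qed.

(** By translation invariance every difference quotient has integral 0, and dominated convergence
    passes this on to the derivative; no integration by parts is involved. *)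
Lemma integralC_pderiv0 i f : rapid f -> integralC mu (pderiv i f) = 0.
Proof.
move=> hf; have [df hdf] := rapid_pderiv i hf.
have [A A0 hA] := hf 1%N (2 * d)%N.
pose t (n : nat) : R := n.+1%:R^-1.
have t0 n : 0 < t n by rewrite invr_gt0 ltr0n.
have t0' n : 0 <= t n by exact: ltW.
have t1 n : t n <= 1 by rewrite invf_le1 ?ler1n// ltr0n.
pose q n x : R[i] := (t n)^-1%:C%C * (f (x + t n *: 'e_i) - f x).
have wt n : w (t n *: 'e_i) = 1 + t n.
  congr (_ + _); rewrite (bigD1 i)//= !mxE !eqxx mulr1 big1 ?addr0 ?ger0_norm// 1?ltW//.
  by move=> j /negbTE ji; rewrite !mxE ji andbF mulr0 normr0.
have iT n : integrableC mu (fun x => f (x + t n *: 'e_i)).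
  have := integrableC_affine (t n *: 'e_i) (oner_neq0 R) (rapid_integrable hf).
  by congr integrableC; apply/funext => x; rewrite scale1r addrC.
have q0 n : integralC mu (q n) = 0.
  rewrite integralCZ; last by apply: integrableCB => //; exact: rapid_integrable.
  rewrite integralCB//; last exact: rapid_integrable.
  rewrite (integralC_affine (t n *: 'e_i) (oner_neq0 R) (rapid_integrable hf)).
  rewrite normr1 expr1n mul1r.
  rewrite (_ : (fun x => f (_ + 1 *: x)) = (fun x => f (x + t n *: 'e_i))).
    by rewrite subrr mulr0.
  by apply/funext => x; rewrite scale1r addrC.
have mq n : measC (q n).
  apply: measCM; first exact: measC_cst.
  by apply: measCB; [exact: integrableC_measC (iT n)|exact/contC_measC/rapid_cont].
have qf x : nrm (q n x - pderiv i f x) @[n --> \oo] --> (0 : R).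
  have part (p : R[i] -> R) : (forall r z z', p (r%:C%C * (z - z')) = r * (p z - p z')) ->
      derivable (fun y => p (f y)) x 'e_i ->
      'D_('e_i) (fun y => p (f y)) x = p (pderiv i f x) ->
      p (q n x) @[n --> \oo] --> p (pderiv i f x).
    move=> pE dp <-; have := dp; rewrite /derivable /derive => /cvgP.
    move=> /cvg_ex[l hl].
    have := cvg_lim (@Rhausdorff R) hl => ->.
    have := (cvgr_dnbhsP (fun h => h^-1 *: (((fun y => p (f y)) \o shift x) (h *: 'e_i) - p (f x))) 0 l).1 hl t.
    have tt : (forall n, t n != 0) /\ t n @[n --> \oo] --> (0 : R).
      by split=> [n|]; [rewrite gt_eqF|exact: cvg_natSinv].
    move/(_ tt); apply: cvg_trans; apply: near_eq_cvg; near=> n.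
    by rewrite pE /= [_ *: 'e_i + x]addrC.
  have hR := part (@complex.Re R)
    (fun r z z' => ltac:(by rewrite ReM ReD ReN /= mul0r subr0)) (df x).1 erefl.
  have hI := part (@complex.Im R)
    (fun r z z' => ltac:(by rewrite ImM ImD ImN /= mul0r addr0)) (df x).2 erefl.
  apply: (@squeeze_cvgr _ _ _ _ (fun=> 0)
    (fun n => `|complex.Re (q n x) - complex.Re (pderiv i f x)| +
     `|complex.Im (q n x) - complex.Im (pderiv i f x)|)).
  - near=> n; rewrite nrm_ge0 andTb; apply: (le_trans (nrm_le_ReIm _)).
    by rewrite ReD ReN ImD ImN.
  - exact: cvg_cst.
  - rewrite -[X in _ --> X]addr0; apply: cvgD.
      by apply/norm_cvg0P; apply/subr_cvg0.
    by apply/norm_cvg0P; apply/subr_cvg0.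
(* The steps t n are at most 1, so w (t n e_i) is at most 2; the first factor 2 is that of
   [dle_mean_value]. *)
pose C := 2 * 2 ^+ (2 * d) * A.
have qW n x : ((nrm (q n x))%:E <= (C%:E * (wint x)%:E))%E.
  rewrite -EFinM lee_fin nrmM nrm_real ger0_norm ?invr_ge0//.
  rewrite mulrC ler_pdivrMr//; have := dle_mean_value x (x + t n *: 'e_i) A0 hA.
  rewrite (_ : x + t n *: 'e_i - x = t n *: 'e_i); last by rewrite addrC addKr.
  rewrite wt => /le_trans; apply.
  rewrite [1 + _]addrC addrK /C -!mulrA [X in _ <= X](_ : _ =
    2 * (t n * (2 ^+ (2 * d) * (A * wint x)))); last by ring.
  rewrite ler_wpM2l// ler_wpM2l// ler_wpM2r ?mulr_ge0 ?wint_ge0//.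
  by rewrite lerXn2r ?nnegrE ?addr_ge0//; have := t1 n; lra.
have mdf : measC (pderiv i f) by exact/contC_measC/rapid_cont.
have := nrm_integralC_cvg mq mdf qf (integrableZl measurableT C (integrable_wint d)) qW.
under eq_fun do rewrite q0 sub0r nrmN.
move/(cvg_unique (@Rhausdorff R)) => /(_ _ (cvg_cst _)) /esym/eqP.
by rewrite nrm_eq0 => /eqP.
Unshelve. all: by end_near. Qed.

End fourier.

(** * Decay of the Fourier transform and inversion up to a constant *)

Section fourier_inversion.
Context {R : realType} {d : nat}.
Local Notation E := 'rV[R]_d.
Local Notation w := (@weight R d).
Local Notation mu := (leb R d).
Variable hbar : R.
Hypothesis hbar01 : 0 < hbar <= 1.
Implicit Types (f g m : E -> R[i]) (x y eta : E).
Local Notation chr := (chr hbar).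
Local Notation FT := (FT hbar).

Let h0 : 0 < hbar. Proof. by case/andP: hbar01. Qed.
Let h1 : hbar <= 1. Proof. by case/andP: hbar01. Qed.

Lemma rapid_chr f eta : rapid f -> rapid (fun y => f y * chr eta y).
Proof. by move=> hf; apply: rapid_slowM => //; exact: slow_chr. Qed.

(** This is [integralC_pderiv0] applied to m times the character. *)
Lemma FT_pderiv i m eta : rapid m ->
  FT (pderiv i m) eta = Complex 0 (eta ord0 i / hbar) * FT m eta.
Proof.
move=> hm; have [dm hdm] := rapid_pderiv i hm.
have := integralC_pderiv0 i (rapid_chr (- eta) hm).
have [_ ->] := pderivM dm (pderiv_chr hbar i (- eta)).1.
rewrite (pderiv_chr hbar i (- eta)).2.
rewrite (_ : (fun y => _) = (fun y => pderiv i m y * chr (- eta) y +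
    Complex 0 (- (eta ord0 i / hbar)) * (m y * chr (- eta) y))); last first.
  by apply/funext => y; rewrite !mxE mulNr; ring.
rewrite integralCD; last 2 first.
- exact/integrableC_chr/rapid_integrable.
- exact/integrableCZ/integrableC_chr/rapid_integrable.
rewrite integralCZ; last exact/integrableC_chr/rapid_integrable.
move/eqP; rewrite addr_eq0 => /eqP; rewrite /FT => ->.
by rewrite -mulNr; congr (_ * _); apply: complexP => /=; rewrite ?oppr0 ?opprK.
Qed.

(** One factor of the weight is expanded as 1 plus the sum of the |eta_i|. Each |eta_i| turns into a
    derivative of m, with a factor hbar at most 1. The d + 1 terms account for the power of d.+1. *)
Lemma FT_decay k m (W : E -> R) eta : rapid m -> dle k m W ->
  mu.-integrable setT (EFin \o W) ->
  w eta ^+ k * nrm (FT m eta) <= d.+1%:R ^+ k * (2 * \int[mu]_x W x).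
Proof.
move=> + + iW; elim: k m => [|k IH] m hm hW.
  by rewrite !expr0 !mul1r; exact: FT_le (dle_nrm hW) iW.
rewrite exprSr -mulrA {2}/weight mulrDl mul1r mulrDr mulr_suml mulr_sumr.
rewrite exprS -mulrA -{1}[d.+1]addn1 natrD mulrDl mul1r addrC.
apply: lerD; last exact: IH (dle_leq (leqnSn _) hW).
apply: (@le_trans _ _ (\sum_(i < d) (d.+1%:R ^+ k * (2 * \int[mu]_x W x)))); last first.
  by rewrite sumr_const card_ord [leRHS]mulr_natl.
apply: ler_sum => i _.
have [_ hdm] := rapid_pderiv i hm; have [_ hW'] := dle_pderiv i hW.
rewrite (le_trans _ (IH _ hdm hW'))// ler_wpM2l ?exprn_ge0 ?weight_ge0//.
rewrite FT_pderiv// nrmM nrm_imag_div// ler_wpM2r ?nrm_ge0//.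
by rewrite ler_peMr// invf_ge1.
Qed.

Lemma FT_rapid_decay k m : rapid m ->
  exists2 A, 0 <= A & forall eta, nrm (FT m eta) <= A * w eta ^- k.
Proof.
move=> hm; have [A A0 hA] := hm k (2 * d)%N.
have iW : mu.-integrable setT (EFin \o (fun x => A * wint x)).
  exact: (integrableZl measurableT A (integrable_wint d)).
exists (d.+1%:R ^+ k * (2 * \int[mu]_x (A * wint x))).
  by rewrite !mulr_ge0 ?exprn_ge0// Rintegral_ge0// => x _; rewrite mulr_ge0 ?wint_ge0.
move=> eta; rewrite ler_pdivlMr ?weightX_gt0// mulrC.
exact: FT_decay.
Qed.

Lemma integrableC_FT m : rapid m -> integrableC mu (FT m).
Proof.
move=> hm; have [A A0 hA] := FT_rapid_decay (2 * d) hm.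
apply: (integrableC_dom _ (integrableZl measurableT A (integrable_wint d))).
  exact/contC_measC/contC_FT.
by move=> x; rewrite /= -EFinM lee_fin hA.
Qed.

Lemma FT_translate m a eta : rapid m ->
  FT (fun y => m (y + a)) eta = chr eta a * FT m eta.
Proof.
move=> hm; have hm' : rapid (fun y => m (y + a)).
  by have := rapid_translate (- a) hm; under eq_fun do rewrite opprK.
rewrite /FT (integralC_affine (- a) (oner_neq0 R)); last first.
  exact/integrableC_chr/rapid_integrable.
rewrite normr1 expr1n mul1r -integralCZ; last exact/integrableC_chr/rapid_integrable.
apply: eq_integralC => y; rewrite scale1r addrAC addNr add0r.
by rewrite chrDr -chrNr opprK; ring.
Qed.

Lemma conj_FT m eta : rapid m -> conjc (FT m eta) = FT (fun y => conjc (m y)) (- eta).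
Proof.
move=> hm; rewrite -integralC_conj; last exact/integrableC_chr/rapid_integrable.
by apply: eq_integralC => y; rewrite conjM conj_chr.
Qed.

Lemma FT_dilate P (c : R) y : 0 < c -> rapid P ->
  FT P y = (c ^+ d)%:C%C * FT (dilate c P) (c *: y).
Proof.
move=> c0 hP; rewrite /FT (integralC_affine 0 (lt0r_neq0 c0)); last first.
  exact/integrableC_chr/rapid_integrable.
rewrite ger0_norm ?(ltW c0)//; congr (_ * _); apply: eq_integralC => x.
by rewrite add0r /dilate /chr dotZr -scalerN dotZl.
Qed.

(** The multiplication formula moves the transform onto the dilated P, and the substitution y = eps
    z moves the dilation onto m. *)
Lemma integralC_FT_dilate m P (eps : R) : 0 < eps -> rapid m -> rapid P ->
  integralC mu (fun eta => FT m eta * dilate eps P eta) =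
  integralC mu (fun z => m (eps *: z) * FT P z).
Proof.
move=> e0 hm hP; have hPe := rapid_dilate e0 hP.
have im := rapid_integrable hm; have iP := rapid_integrable hPe.
have mk : measC (fun z : E * E => chr (- z.1) z.2).
  rewrite (_ : (fun z => _) = (fun z : E * E => conjc (chr z.1 z.2))).
    exact/measC_conj/measC_chr2.
  by apply/funext => z; rewrite conj_chr.
transitivity (integralC mu (fun eta => dilate eps P eta *
    integralC mu (fun y => m y * chr (- eta) y))).
  by apply: eq_integralC => eta; rewrite mulrC.
rewrite (integralC_kernel iP im mk); last by move=> z; rewrite nrm_chr.
have E1 y : integralC mu (fun x => dilate eps P x * chr (- x) y) = FT (dilate eps P) y.
  by apply: eq_integralC => x; rewrite chrC -chrNr.
rewrite /=; under eq_integralC do rewrite E1.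
rewrite (integralC_affine 0 (lt0r_neq0 e0)); last first.
  apply: (integrableC_dom _ (integrable_nrm (integrableCZ (2 * \int[mu]_x nrm (dilate eps P x))%:C%C im))).
    by apply: measCM; [exact: integrableC_measC im|exact/contC_measC/contC_FT].
  move=> y; rewrite lee_fin !nrmM mulrC ler_wpM2r ?nrm_ge0//.
  rewrite nrm_real (le_trans _ (ler_norm _))//.
  exact: FT_le hPe (fun x => lexx _) (integrable_nrm iP).
rewrite -integralCZ; last first.
  have [A A0 hA] := FT_rapid_decay (2 * d) hP.
  have [B B0 hB] := hm 0%N 0%N.
  apply: (integrableC_dom _ (integrableZl measurableT ((eps ^- d) * (B * A)) (integrable_wint d))).
    apply: measCM; apply: contC_measC.
      by apply: contC_comp (rapid_cont hm); exact: continuous_affine.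
    by apply: contC_comp (contC_FT hbar01 hPe); exact: continuous_affine.
  move=> x; rewrite /= -EFinM lee_fin add0r.
  have -> : FT (dilate eps P) (eps *: x) = (eps ^- d)%:C%C * FT P x.
    rewrite (FT_dilate x e0 hP) mulrA.
    suff -> : (eps ^- d)%:C%C * (eps ^+ d)%:C%C = 1 by rewrite mul1r.
    by rewrite -rmorphM /= mulVf ?rmorph1// gt_eqF// exprn_gt0.
  rewrite !nrmM nrm_real ger0_norm ?invr_ge0 ?exprn_ge0 ?(ltW e0)// mulrCA -!mulrA.
  rewrite ler_wpM2l ?invr_ge0 ?exprn_ge0 ?(ltW e0)//.
  rewrite ler_pM ?nrm_ge0//; have := dle_nrm hB (eps *: x).
  by rewrite invr1 mulr1.
apply: eq_integralC => x; rewrite add0r (FT_dilate x e0 hP).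
by rewrite ger0_norm ?(ltW e0)//; ring.
Qed.

Lemma rapid_dilate_cvg P x : rapid P ->
  nrm (P (n.+1%:R^-1 *: x) - P 0) @[n --> \oo] --> (0 : R).
Proof.
move=> hP; have [A A0 hA] := hP 1%N 0%N.
apply: (@cvg0_squeeze _ _ (fun n => n.+1%:R^-1) (2 * A * w x)); last exact: cvg_natSinv.
move=> n; rewrite nrm_ge0 andTb.
have := dle_mean_value 0 (n.+1%:R^-1 *: x) A0 hA.
rewrite subr0 expr0 invr1 !mulr1 => /le_trans; apply.
have E1 y : w y - 1 = \sum_i `|y ord0 i| by rewrite /weight addrAC subrr add0r.
have -> : w (n.+1%:R^-1 *: x) - 1 = n.+1%:R^-1 * (w x - 1).
  rewrite !E1 mulr_sumr; apply: eq_bigr => i _.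
  by rewrite mxE normrM ger0_norm// invr_ge0.
rewrite -!mulrA ler_wpM2l// [leRHS]mulrA [leRHS]mulrC ler_wpM2l ?invr_ge0//.
by rewrite mulrC ler_wpM2l// gerBl.
Qed.

(* Both sides are the limit, as [t] tends to 0, of the integral of
   [FT m * P (t *: _)], which by Fubini is that of [m (t *: _) * FT P]. *)
Let FT_pairing m P : rapid m -> rapid P ->
  P 0 * integralC mu (FT m) = m 0 * integralC mu (FT P).
Proof.
move=> hm hP; have iFm := integrableC_FT hm; have iFP := integrableC_FT hP.
have [A A0 hA] := hP 0%N 0%N; have [B B0 hB] := hm 0%N 0%N.
have PA x : nrm (P x) <= A by have := dle_nrm hA x; rewrite invr1 mulr1.
have mB x : nrm (m x) <= B by have := dle_nrm hB x; rewrite invr1 mulr1.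
pose t n : R := n.+1%:R^-1.
have t0 n : 0 < t n by rewrite invr_gt0 ltr0n.
pose z n := integralC mu (fun eta => FT m eta * dilate (t n) P eta).
apply: (@complex_cvg_unique _ z).
- rewrite -integralCZ//; apply: (nrm_integralC_cvg (W := fun x => (A%:E * (nrm (FT m x))%:E)%E)).
  + move=> n; apply: measCM; first exact: integrableC_measC iFm.
    exact/contC_measC/rapid_cont/rapid_dilate.
  + by apply: measCM; [exact: measC_cst|exact: integrableC_measC iFm].
  + move=> x; apply: (@cvg0_squeeze _ _ (fun n => nrm (P (t n *: x) - P 0)) (nrm (FT m x))).
      by move=> n; rewrite nrm_ge0 andTb [P 0 * _]mulrC -mulrBr nrmM.
    exact: rapid_dilate_cvg.
  + exact: (integrableZl measurableT A (integrable_nrm iFm)).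
  + by move=> n x; rewrite -EFinM lee_fin nrmM mulrC ler_wpM2r ?nrm_ge0 ?PA.
- rewrite -integralCZ//; rewrite /z; under eq_fun do rewrite integralC_FT_dilate//.
  apply: (nrm_integralC_cvg (W := fun x => (B%:E * (nrm (FT P x))%:E)%E)).
  + move=> n; apply: measCM; last exact: integrableC_measC iFP.
    exact/contC_measC/rapid_cont/rapid_dilate.
  + by apply: measCM; [exact: measC_cst|exact: integrableC_measC iFP].
  + move=> x; apply: (@cvg0_squeeze _ _ (fun n => nrm (m (t n *: x) - m 0)) (nrm (FT P x))).
      by move=> n; rewrite nrm_ge0 andTb -mulrBl nrmM mulrC.
    exact: rapid_dilate_cvg.
  + exact: (integrableZl measurableT B (integrable_nrm iFP)).
  + by move=> n x; rewrite -EFinM lee_fin nrmM ler_wpM2r ?nrm_ge0 ?mB.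
Qed.

(** The integrand is |f|^2, continuous and nonnegative, so a zero integral would force f to vanish
    everywhere. *)
Lemma integralC_sqr_neq0 f : contC f -> integrableC mu (fun y => f y * conjc (f y)) ->
  (exists y, f y != 0) -> integralC mu (fun y => f y * conjc (f y)) != 0.
Proof.
move=> cf [i1 _] [y fy]; apply/eqP => h.
have E1 x : complex.Re (f x * conjc (f x)) = nrm (f x) ^+ 2 by rewrite mul_conjc.
have : (\int[mu]_x (nrm (f x) ^+ 2)%:E = 0)%E.
  have := congr1 (@complex.Re R) h; rewrite /= /Rintegral.
  under eq_integral do rewrite E1.
  have : (\int[mu]_x (nrm (f x) ^+ 2)%:E)%E \is a fin_num.
    by have := integrable_fin_num measurableT i1; under eq_integral do rewrite E1.
  by case: (\int[mu]_x _)%E => // r _ /= ->.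
move/(continuous_integral_eq0 (h := fun x => nrm (f x) ^+ 2)).
have cn : continuous (fun x => nrm (f x) ^+ 2).
  by have [c _] := contCM cf (contC_conj cf); move: c; under eq_fun do rewrite E1.
move/(_ cn (fun x => exprn_ge0 _ (nrm_ge0 _)) y)/eqP.
by rewrite sqrf_eq0 nrm_eq0 (negbTE fy).
Qed.

(* The value of K is irrelevant.  By [FT_pairing] some nonzero K exists unless
   [FT P] has integral 0 for every P; in that case, so does [FT P * conjc (FT P)],
   hence [FT P = 0] for every P, which is absurd at the frequency 0. *)
Lemma fourier_inversion g : rapid g -> (exists y, g y != 0) ->
  exists2 K : R[i], K != 0 & forall m y, rapid m ->
    integralC mu (fun eta => FT m eta * chr eta y) = K * m y.
Proof.
move=> hg [y0 gy0].
have shift m y : rapid m -> rapid (fun x => m (x + y)).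
  by move=> hm; have := rapid_translate (- y) hm; under eq_fun do rewrite opprK.
(* [FT_pairing] for the translate of m by y, whose transform is [FT m] times the character at y. *)
have inv m P y : rapid m -> rapid P ->
    P 0 * integralC mu (fun eta => FT m eta * chr eta y) = m y * integralC mu (FT P).
  move=> hm hP; have := FT_pairing (shift _ y hm) hP; rewrite add0r => <-.
  by congr (_ * _); apply: eq_integralC => eta; rewrite FT_translate// mulrC.
have [[P [hP IP0]]|noP] := pselect (exists P, rapid P /\ integralC mu (FT P) != 0).
  (* Otherwise the identity for g at y0 would equate 0 with a product of two nonzero numbers. *)
  have P0 : P 0 != 0.
    apply/eqP => P0; have := inv g P y0 hg hP; rewrite P0 mul0r => /esym/eqP.
    by rewrite mulf_eq0 (negbTE gy0) (negbTE IP0).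
  exists (integralC mu (FT P) / P 0); first by rewrite mulf_neq0// invr_eq0.
  move=> m y hm; have := inv m P y hm hP => h.
  by apply: (mulfI P0); rewrite h mulrA mulrCA divff// mulr1 mulrC.
exfalso.
have I0 P : rapid P -> integralC mu (FT P) = 0.
  by move=> hP; apply: contrapT => h; apply: noP; exists P; split=> //; exact/eqP.
have I0y P y : rapid P -> integralC mu (fun eta => FT P eta * chr eta y) = 0.
  move=> hP; rewrite -(I0 _ (shift _ y hP)).
  by apply: eq_integralC => eta; rewrite FT_translate// mulrC.
have F0 P : rapid P -> integralC mu P = 0.
  move=> hP; have iF := integrableC_FT hP.
  have iP := integrableC_conj (rapid_integrable hP).
  have mk : measC (fun z : E * E => chr z.1 z.2) by exact: measC_chr2.
  have kle1 (z : E * E) : nrm (chr z.1 z.2) <= 1 by rewrite nrm_chr.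
  have h := integralC_kernel iF iP mk kle1.
  have cE eta : integralC mu (fun y => conjc (P y) * chr eta y) = conjc (FT P eta).
    by rewrite (conj_FT _ hP) /FT opprK.
  have FF : integralC mu (fun eta => FT P eta * conjc (FT P eta)) = 0.
    transitivity (integralC mu (fun=> 0 : R[i])); last exact: integralC0.
    rewrite -[LHS](_ : integralC mu (fun eta => FT P eta *
      integralC mu (fun y => conjc (P y) * chr eta y)) = _); last first.
      by apply: eq_integralC => eta; rewrite cE.
    rewrite h; apply: eq_integralC => y; rewrite -[RHS](mulr0 (conjc (P y))).
    by congr (_ * _); exact: I0y.
  have [A A0 hA] := FT_rapid_decay 0 hP.
  have iFF : integrableC mu (fun eta => FT P eta * conjc (FT P eta)).
    apply: (integrableC_dom _ (integrableZl measurableT A (integrable_nrm iF))).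
      by apply: measCM; [|apply: measC_conj]; exact: integrableC_measC iF.
    move=> x; rewrite -EFinM lee_fin nrmM nrm_conj.
    apply: ler_wpM2r; first exact: nrm_ge0.
    by have := hA x; rewrite invr1 mulr1.
  have FP0 : FT P 0 = 0.
    apply: contrapT => /eqP F0.
    have := integralC_sqr_neq0 (contC_FT hbar01 hP) iFF (ex_intro _ 0 F0).
    by rewrite FF eqxx.
  by rewrite -FP0; apply: eq_integralC => y; rewrite oppr0 chr0 mulr1.
have hgg : rapid (fun y => g y * conjc (g y)) by exact/rapidM/rapid_conj.
have := integralC_sqr_neq0 (rapid_cont hg) (rapid_integrable hgg) (ex_intro _ y0 gy0).
by rewrite F0// eqxx.
Qed.

End fourier_inversion.

(** * Exchanging a tempered distribution with an integral *)

Lemma leb_cube_lty (R : realType) d (x : 'rV[R]_d) e : 0 < e ->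
  (leb R d (cube x e) < +oo)%E.
Proof.
move=> e0; pose B := [set y : 'rV[R]_d | forall i,
  x ord0 i - e < y ord0 i <= x ord0 i + e].
have mB : measurable B by exact: measurable_box.
apply: (@le_lt_trans _ _ (leb R d B)); last first.
  by rewrite leb_box ?ltry// => i; lra.
apply: le_measure; rewrite ?inE//; first exact: measurable_cube.
by move=> y /= h i; have := h i; rewrite ltr_distlC; lra.
Qed.

Section quadrature.
Context {R : realType} {d : nat}.
Local Notation E := 'rV[R]_d.
Local Notation w := (@weight R d).
Local Notation mu := (leb R d).
Variables (a : E -> R[i]) (B : R).
Hypothesis (ma : measC a) (aB : forall p, nrm (a p) <= B).
Variables (W : E -> R) (W0 : forall p, 0 <= W p).
Hypothesis iW : mu.-integrable setT (fun p => (nrm (a p) * W p)%:E).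
Variable delta : R.
Hypothesis delta01 : 0 < delta <= 1.

(** Making the rational cubes disjoint yields a countable measurable partition in which each point
    of cell k is within delta of the sample point [rational_row k]. *)
Definition cell k : set E := seqDU (fun j => cube (rational_row j) delta) k.

Lemma cell_ex p : exists k, cell k p.
Proof.
have d0 : 0 < delta by case/andP: delta01.
have [k hk] := rational_row_dense p d0.
have : (\bigcup_j cube (rational_row j) delta) p by exists k.
by rewrite seqDU_bigcup_eq => -[j _ hj]; exists j.
Qed.

Lemma cell_inj p j k : cell j p -> cell k p -> j = k.
Proof.
move=> hj hk; apply: (trivIset_seqDU (fun j => cube (rational_row j) delta)) => //.
by exists p.
Qed.

Definition cell_indic k p : R[i] := (\1_(cell k) p)%:C%C.

Lemma cell_indicE j k p : cell j p -> cell_indic k p = (k == j)%:R.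
Proof.
move=> hj; rewrite /cell_indic indicE; have [->|kj] := eqVneq k j.
  by rewrite mem_set.
by rewrite memNset// => hk; move/eqP: kj; apply; exact: cell_inj hk hj.
Qed.

Lemma measurable_cell k : measurable (cell k).
Proof. by apply: seqDU_measurable => j; exact: measurable_cube. Qed.

Lemma measC_cell_indic k : measC (cell_indic k).
Proof. by apply: measC_real; apply: measurable_indic; exact: measurable_cell. Qed.

Definition cell_mass k : R[i] := integralC mu (fun p => a p * cell_indic k p).

Lemma integrableC_cell k : integrableC mu (fun p => a p * cell_indic k p).
Proof.
have d0 : 0 < delta by case/andP: delta01.
apply: (@integrableC_dom _ _ _ mu _ (fun p => B%:E * (\1_(cell k) p)%:E)%E).
- by apply: measCM => //; exact: measC_cell_indic.
- apply: integrableZl => //; apply/integrableP; split.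
    by apply/measurable_EFinP; apply: measurable_indic; exact: measurable_cell.
  under eq_integral do rewrite gee0_abs ?lee_fin//.
  rewrite integral_indic//; last exact: measurable_cell.
  rewrite setIT; apply: (le_lt_trans _ (leb_cube_lty (rational_row k) d0)).
  apply: le_measure; rewrite ?inE; [exact: measurable_cell|exact: measurable_cube|].
  exact: subset_seqDU.
- move=> p; rewrite -EFinM lee_fin nrmM /cell_indic nrm_real ger0_norm ?indicE//.
  by rewrite ler_wpM2r.
Qed.

(** The indicator of what the first n cells leave uncovered. *)
Definition tail n p : R := 1 - \sum_(k < n) \1_(cell k) p.

Lemma tailE n j p : cell j p -> tail n p = (n <= j)%:R.
Proof.
move=> hj; have E1 k : \1_(cell k) p = (k == j)%:R :> R.
  by have := congr1 (@complex.Re R) (cell_indicE k hj); case: (k == j).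
rewrite /tail; under eq_bigr do rewrite E1.
have [nj|jn] := leqP n j.
  rewrite big1 ?subr0// => k _; rewrite ltn_eqF//.
  exact: leq_trans (ltn_ord k) nj.
rewrite (bigD1 (Ordinal jn))//= eqxx big1 ?addr0 ?subrr// => k.
by rewrite -val_eqE/= => /negbTE ->.
Qed.

Lemma tail01 n p : 0 <= tail n p <= 1.
Proof. by have [j hj] := cell_ex p; rewrite (tailE n hj); case: leqP => _; rewrite ?ler01 ?lexx. Qed.

Lemma measurable_tail n : measurable_fun setT (tail n).
Proof.
apply: measurable_funB => //; apply: measurable_sum => k.
by apply: measurable_indic; exact: measurable_cell.
Qed.

Lemma integrable_tail n : mu.-integrable setT (fun p => (nrm (a p) * W p * tail n p)%:E).
Proof.
apply: (le_integrable _ _ _ iW) => //.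
  apply/measurable_EFinP; apply: measurable_funM; last exact: measurable_tail.
  by have /integrableP[/measurable_EFinP] := iW.
move=> p _; have /andP[t0 t1] := tail01 n p.
rewrite !abse_EFin lee_fin normrM ler_piMr// ger0_norm//.
Qed.

(** Every point lies in some cell, so the tail vanishes there eventually; nrm (a p) * W p dominates.
    The real integrals are viewed in R[i] in order to reuse [nrm_integralC_cvg]. *)
Lemma tail_cvg : \int[mu]_p (nrm (a p) * W p * tail n p) @[n --> \oo] --> (0 : R).
Proof.
have maW : measurable_fun setT (fun p => nrm (a p) * W p).
  by have /integrableP[/measurable_EFinP] := iW.
have E1 n : nrm (integralC mu (fun p => (nrm (a p) * W p * tail n p)%:C%C) -
    integralC mu (fun=> 0)) = \int[mu]_p (nrm (a p) * W p * tail n p).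
  rewrite integralC0 subr0.
  have -> : integralC mu (fun p => (nrm (a p) * W p * tail n p)%:C%C) =
      (\int[mu]_p (nrm (a p) * W p * tail n p))%:C%C.
    by apply: complexP => //=; rewrite /Rintegral integral0.
  rewrite nrm_real ger0_norm// Rintegral_ge0// => p _.
  by have /andP[t0 _] := tail01 n p; rewrite !mulr_ge0 ?nrm_ge0.
under eq_fun do rewrite -E1.
apply: (nrm_integralC_cvg (W := fun p => (nrm (a p) * W p)%:E)).
- move=> n; apply: measC_real; apply: measurable_funM => //; exact: measurable_tail.
- exact: measC_cst.
- move=> p; have [j hj] := cell_ex p.
  apply: cvg_near_cst; near=> n; rewrite subr0 (tailE n hj) leqNgt.
  have -> : (j < n)%N by near: n; exists j.+1.
  by rewrite mulr0 nrm0.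
- exact: iW.
- move=> n p; have /andP[t0 t1] := tail01 n p.
  rewrite lee_fin nrm_real ger0_norm ?mulr_ge0 ?nrm_ge0//.
  by rewrite ler_piMr// mulr_ge0 ?nrm_ge0.
Unshelve. all: by end_near. Qed.

(** On the first n cells the error is the oscillation of v, over an l1 distance of at most d *
    delta; elsewhere it is v itself. The bound depends on v only through c, and this uniformity is
    what later gives convergence in a seminorm. *)
Lemma quadrature (v : E -> R[i]) (c : R) n : 0 <= c ->
  (forall p, nrm (v p) <= c * W p) ->
  (forall p p', cube p 1 p' -> nrm (v p' - v p) <= c * W p * (w (p - p') - 1)) ->
  integrableC mu (fun p => a p * v p) /\
  nrm (integralC mu (fun p => a p * v p) -
    \sum_(k < n) cell_mass k * v (rational_row k)) <=
  c * (2 * (d%:R * delta * \int[mu]_p (nrm (a p) * W p) +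
            \int[mu]_p (nrm (a p) * W p * tail n p))).
Proof.
move=> c0 vW vL; have [d0 d1] := andP delta01.
have mv : measC v.
  apply/contC_measC/(@contC_lipschitz _ _ _ (fun p => c * W p)) => p p' pp'.
  by rewrite nrm_distC; exact: vL.
have iav : integrableC mu (fun p => a p * v p).
  apply: (@integrableC_dom _ _ _ mu _ (fun p => c%:E * (nrm (a p) * W p)%:E)%E).
  - exact: measCM.
  - exact: integrableZl.
  - by move=> p; rewrite -EFinM lee_fin nrmM mulrCA ler_wpM2l ?nrm_ge0.
split=> //.
have iS k : integrableC mu (fun p => v (rational_row k) * (a p * cell_indic k p)).
  exact/integrableCZ/integrableC_cell.
have -> : \sum_(k < n) cell_mass k * v (rational_row k) =
    integralC mu (fun p => \sum_(k < n) v (rational_row k) * (a p * cell_indic k p)).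
  rewrite integralC_sum; last by move=> k; exact: iS.
  apply: eq_bigr => k _; rewrite [LHS]mulrC.
  exact/esym/(integralCZ (v (rational_row k)) (integrableC_cell k)).
have iSS : integrableC mu (fun p => \sum_(k < n) v (rational_row k) * (a p * cell_indic k p)).
  by apply: integrableC_sum => k; exact: iS.
rewrite -(integralCB iav iSS) mulrCA.
have i1 := integrableZl measurableT (d%:R * delta) iW.
have i2 := integrable_tail n.
have i12 : mu.-integrable setT (EFin \o (fun p => c * (d%:R * delta * (nrm (a p) * W p) +
    nrm (a p) * W p * tail n p))).
  exact: (integrableZl measurableT c (integrableD measurableT i1 i2)).
rewrite -RintegralZl// -RintegralD//.
rewrite -RintegralZl//; last exact: (integrableD measurableT i1 i2).
apply: nrm_integralC_le => //; first exact: integrableCB.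
move=> p; have [j hj] := cell_ex p.
(* At a given p at most one cell contributes to the Riemann sum. *)
have -> : \sum_(k < n) v (rational_row k) * (a p * cell_indic k p) =
    a p * (if (j < n)%N then v (rational_row j) else 0).
  under eq_bigr do rewrite (cell_indicE _ hj) mulrCA.
  rewrite -mulr_sumr; congr (_ * _); case: ltnP => jn.
    rewrite (bigD1 (Ordinal jn))//= eqxx mulr1 big1 ?addr0// => k.
    by rewrite -val_eqE/= => /negbTE ->; rewrite mulr0.
  rewrite big1// => k _; rewrite ltn_eqF ?mulr0//.
  exact: leq_trans (ltn_ord k) jn.
rewrite -mulrBr nrmM (tailE n hj).
have dd : 0 <= d%:R * delta * (nrm (a p) * W p).
  by rewrite !mulr_ge0 ?ler0n ?nrm_ge0// ltW.
case: (leqP n j) => jn.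
  rewrite subr0 mulr1 (@le_trans _ _ (c * (nrm (a p) * W p)))//.
    by rewrite mulrCA ler_wpM2l ?nrm_ge0.
  by rewrite ler_wpM2l// lerDr.
have pj : cube p delta (rational_row j).
  by move=> i; rewrite distrC; exact: (subset_seqDU hj).
have pj1 : cube p 1 (rational_row j) by move=> i; exact: lt_le_trans (pj i) d1.
rewrite mulr0 addr0 nrm_distC.
have h := vL _ _ pj1.
rewrite (@le_trans _ _ (nrm (a p) * (c * W p * (d%:R * delta))))//.
  rewrite ler_wpM2l ?nrm_ge0// (le_trans h)// ler_wpM2l ?mulr_ge0//.
  exact: weight_cube.
by rewrite le_eqVlt; apply/orP; left; apply/eqP; ring.
Qed.

End quadrature.

(** * Convergence of Riemann sums in Schwartz seminorms *)

Section exchange.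
Context {R : realType} {d : nat}.
Local Notation E := 'rV[R]_d.
Local Notation w := (@weight R d).
Local Notation mu := (leb R d).

Lemma rapid_dle n (f : E -> R[i]) W : rapid f ->
  (forall s x, (size s <= n)%N -> nrm (pderivs s f x) <= W x) -> dle n f W.
Proof.
elim: n f => [|n IH] f hf hW; split; try exact: rapid_cont.
  by split=> // x; exact: (hW [::]).
split=> [x|i]; first exact: (hW [::]).
have [h1 h2] := rapid_pderiv i hf; split=> //; apply: IH => // s x sn.
by rewrite -pderivs_rcons; apply: hW; rewrite size_rcons.
Qed.

Lemma pderivsB s (f g : E -> R[i]) : rapid f -> rapid g ->
  pderivs s (fun y => f y - g y) = (fun y => pderivs s f y - pderivs s g y).
Proof.
move=> hf hg; have [A _ hA] := hf (size s) 0%N; have [B _ hB] := hg (size s) 0%N.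
have := pderivs_linear (-1) hB hA.
rewrite (_ : (fun y => -1 * g y + f y) = (fun y => f y - g y)); last first.
  by apply/funext => y; rewrite mulN1r addrC.
by move=> ->; apply/funext => y; rewrite mulN1r addrC.
Qed.

Lemma pderivs_lin s (a : R[i]) (f g : E -> R[i]) : rapid f -> rapid g ->
  pderivs s (fun y => a * f y + g y) = (fun y => a * pderivs s f y + pderivs s g y).
Proof.
move=> hf hg; have [A _ hA] := hf (size s) 0%N; have [B _ hB] := hg (size s) 0%N.
exact: pderivs_linear hA hB.
Qed.

Lemma pderivs0 s (y : E) : pderivs s (fun _ : E => 0 : R[i]) y = 0.
Proof.
elim/last_ind: s => [//|s i IH].
by rewrite pderivs_rcons (pderiv_cst i (0 : R[i])).2.
Qed.

Lemma rapid_sum (I : Type) (r : seq I) (c : I -> R[i]) (F : I -> E -> R[i]) :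
  (forall k, rapid (F k)) -> rapid (fun y => \sum_(k <- r) c k * F k y).
Proof.
move=> hF; elim: r => [|k r IH].
  by under eq_fun do rewrite big_nil; exact: rapid0.
by under eq_fun do rewrite big_cons; apply: rapidD => //; exact: rapidZ.
Qed.

Lemma pderivs_sum s (I : Type) (r : seq I) (c : I -> R[i]) (F : I -> E -> R[i]) y :
  (forall k, rapid (F k)) ->
  pderivs s (fun y => \sum_(k <- r) c k * F k y) y =
  \sum_(k <- r) c k * pderivs s (F k) y.
Proof.
move=> hF; elim: r => [|k r IH].
  by under eq_fun do rewrite big_nil; rewrite big_nil pderivs0.
under eq_fun do rewrite big_cons.
by rewrite pderivs_lin//; [rewrite big_cons IH|exact: rapid_sum].
Qed.

(** For each N, the map from p to Theta p is bounded and locally Lipschitz in the N-th seminorm,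
    with a constant W p that is integrable against |a|. *)
Definition exchange_bounds (a : E -> R[i]) (Theta : E -> E -> R[i]) :=
  forall N, exists W : E -> R, [/\ forall p, 0 <= W p,
     mu.-integrable setT (fun p => (nrm (a p) * W p)%:E),
     forall p, dle N (Theta p) (fun y => W p * w y ^- N) &
     forall p p', cube p 1 p' -> dle N (fun y => Theta p' y - Theta p y)
       (fun y => W p * (w (p - p') - 1) * w y ^- N)].

(* Stands in for a vector-valued integral: Riemann sums over small cubes converge
   in each seminorm, and [u] is continuous for one of them. *)
Lemma temp_exchange (u : (E -> R[i]) -> R[i]) (a : E -> R[i]) (B : R)
    (Theta : E -> E -> R[i]) (Psi : E -> R[i]) :
  temp u -> measC a -> (forall p, nrm (a p) <= B) ->
  rapid Psi -> (forall p, rapid (Theta p)) ->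
  exchange_bounds a Theta ->
  (forall s y, pderivs s Psi y = integralC mu (fun p => a p * pderivs s (Theta p) y)) ->
  integrableC mu (fun p => a p * u (Theta p)) /\
  u Psi = integralC mu (fun p => a p * u (Theta p)).
Proof.
move=> tu ma aB hPsi hTh hN dPsi; have [lin [N [c [c0 hc]]]] := tu.
have [W [W0 iW WT WL]] := hN N.
have uW p : nrm (u (Theta p)) <= c * W p by exact: hc.
have uL p p' : cube p 1 p' -> nrm (u (Theta p') - u (Theta p)) <= c * W p * (w (p - p') - 1).
  move=> pp'; rewrite -tempB// -mulrA; apply: hc; first exact: rapidB.
    by rewrite mulr_ge0// subr_ge0 weight_ge1.
  exact: WL.
have q01 : ((0 : R) < (1 : R)) && ((1 : R) <= (1 : R)) by rewrite ltr01 lexx.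
split; first by have [] := quadrature ma aB W0 iW q01 0 c0 uW uL.
have I0 : 0 <= \int[mu]_p (nrm (a p) * W p).
  by apply: Rintegral_ge0 => p _; rewrite mulr_ge0 ?nrm_ge0.
apply/eqP; rewrite -subr_eq0 -nrm_eq0 eq_le nrm_ge0 andbT; apply/ler_addgt0Pr => e e0.
rewrite add0r.
(* The target is e / 2 from the mesh and e / 2 from the tail. The coefficient 4 is the factor 2 of
   [quadrature] times the two errors below, and the added 1 keeps the denominator positive. *)
pose delta := Num.min 1 (e / 2 / (4 * c * d%:R * \int[mu]_p (nrm (a p) * W p) + 1)).
have X0 : 0 <= 4 * c * d%:R * \int[mu]_p (nrm (a p) * W p) by rewrite !mulr_ge0.
have X1 : 0 < 4 * c * d%:R * \int[mu]_p (nrm (a p) * W p) + 1 by rewrite ltr_wpDl.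
have delta01 : 0 < delta <= 1.
  by rewrite lt_min ltr01 /= !divr_gt0//= ge_min lexx.
have tn : exists n, 4 * c * \int[mu]_p (nrm (a p) * W p * tail delta n p) <= e / 2.
  have Y1 : 0 < 4 * c + 1 by rewrite ltr_wpDl// mulr_ge0.
  have /cvgrPdist_le/(_ (e / 2 / (4 * c + 1))) := tail_cvg W0 iW delta01.
  have e1 : 0 < e / 2 / (4 * c + 1) by rewrite !divr_gt0.
  move=> /(_ e1) [n _ /(_ n (leqnn n))] /=; rewrite sub0r normrN => h; exists n.
  have /le_trans -> // : 4 * c * \int[mu]_p (nrm (a p) * W p * tail delta n p) <=
      (4 * c) * (e / 2 / (4 * c + 1)).
    by rewrite ler_wpM2l ?mulr_ge0// (le_trans (ler_norm _) h).
  by rewrite mulrCA ger_pMr ?divr_gt0// ler_pdivrMr// mul1r lerDl.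
have [n hn] := tn.
pose t := \int[mu]_p (nrm (a p) * W p * tail delta n p).
pose Bd := 2 * (d%:R * delta * \int[mu]_p (nrm (a p) * W p) + t).
have t0 : 0 <= t.
  apply: Rintegral_ge0 => p _; have /andP[t0 _] := tail01 delta01 n p.
  by rewrite !mulr_ge0 ?nrm_ge0.
have Bd0 : 0 <= Bd by rewrite mulr_ge0// addr_ge0// !mulr_ge0// ltW//; case/andP: delta01.
pose A k := cell_mass a delta k.
pose S y := \sum_(k < n) A k * Theta (rational_row k) y.
have hS : rapid S by exact: rapid_sum.
have uS : u S = \sum_(k < n) A k * u (Theta (rational_row k)).
  exact: (temp_sum (index_enum 'I_n) (fun k : 'I_n => A k) tu
    (fun k : 'I_n => hTh (rational_row k))).2.
have [_ Q1] := quadrature ma aB W0 iW delta01 n c0 uW uL.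
(* Each derivative of Psi - S at y is a quadrature error with constant w y ^- N, which makes Bd a
   bound for the N-th seminorm of Psi - S. *)
have Q2 : nrm (u Psi - u S) <= c * Bd.
  rewrite -tempB//; apply: hc => //; first exact: rapidB.
  apply: rapid_dle; first exact: rapidB.
  move=> s y sN; rewrite pderivsB// dPsi pderivs_sum//.
  rewrite [leRHS]mulrC; have w0 : 0 <= w y ^- N by rewrite invr_ge0 exprn_ge0// weight_ge0.
  have vW p : nrm (pderivs s (Theta p) y) <= w y ^- N * W p.
    by rewrite mulrC; exact: dle_pderivs_nrm (WT p) sN.
  have vL p p' : cube p 1 p' -> nrm (pderivs s (Theta p') y - pderivs s (Theta p) y) <=
      w y ^- N * W p * (w (p - p') - 1).
    move=> pp'; have := dle_pderivs_nrm y (WL p p' pp') sN; rewrite pderivsB//.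
    by move=> /le_trans; apply; rewrite le_eqVlt; apply/orP; left; apply/eqP; ring.
  exact: (quadrature ma aB W0 iW delta01 n w0 vW vL).2.
rewrite -[X in nrm X](subrKA (u S)) (le_trans (nrmD _ _))//.
rewrite (@le_trans _ _ (c * Bd + c * Bd))//.
  by apply: lerD => //; rewrite uS nrm_distC.
have hd : 4 * c * d%:R * \int[mu]_p (nrm (a p) * W p) * delta <= e / 2.
  apply: (@le_trans _ _ (4 * c * d%:R * \int[mu]_p (nrm (a p) * W p) *
    (e / 2 / (4 * c * d%:R * \int[mu]_p (nrm (a p) * W p) + 1)))).
    by rewrite ler_wpM2l// ge_min lexx orbT.
  by rewrite mulrCA ger_pMr ?divr_gt0// ler_pdivrMr// mul1r lerDl.
have hn' : 4 * c * t <= e / 2 by [].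
by rewrite /Bd; lra.
Qed.

End exchange.

(** * Averages over translations and over modulations *)

Section exchange_instances.
Context {R : realType} {d : nat}.
Local Notation E := 'rV[R]_d.
Local Notation w := (@weight R d).
Local Notation mu := (leb R d).
Implicit Types (u : (E -> R[i]) -> R[i]) (f g m A B : E -> R[i]).

(** The first conclusion of [quadrature], for the empty sum and mesh 1. *)
Lemma exchange_integrable (a : E -> R[i]) (b : R) (Theta : E -> E -> R[i]) s y :
  measC a -> (forall p, nrm (a p) <= b) -> (forall p, rapid (Theta p)) ->
  exchange_bounds a Theta ->
  integrableC mu (fun p => a p * pderivs s (Theta p) y).
Proof.
move=> ma ab hTh /(_ (size s))[W [W0 iW WT WL]].
have q01 : ((0 : R) < (1 : R)) && ((1 : R) <= (1 : R)) by rewrite ltr01 lexx.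
have w0 : 0 <= w y ^- size s by rewrite invr_ge0 exprn_ge0// weight_ge0.
have vW p : nrm (pderivs s (Theta p) y) <= w y ^- size s * W p.
  by rewrite mulrC; exact: dle_pderivs_nrm (WT p) (leqnn _).
have vL p p' : cube p 1 p' -> nrm (pderivs s (Theta p') y - pderivs s (Theta p) y) <=
    w y ^- size s * W p * (w (p - p') - 1).
  move=> pp'; have := dle_pderivs_nrm y (WL p p' pp') (leqnn _); rewrite pderivsB//.
  by move=> /le_trans; apply; rewrite le_eqVlt; apply/orP; left; apply/eqP; ring.
exact: (quadrature ma ab W0 iW q01 0 w0 vW vL).1.
Qed.

Lemma weight_cube1 (p p' : E) : cube p 1 p' -> w (p - p') <= 1 + d%:R.
Proof. by move=> /weight_cube; rewrite mulr1; lra. Qed.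

Section translation.
Variables (A B : E -> R[i]).

Lemma weightXV_conv k (x y : E) : w y ^- k * w (y - x) ^- k <= w x ^- k.
Proof.
rewrite -invfM -exprMn lef_pV2 ?posrE ?exprn_gt0 ?mulr_gt0 ?weight_gt0//.
rewrite lerXn2r ?nnegrE ?mulr_ge0 ?weight_ge0//.
by have := weightB y (y - x); rewrite opprB addrC subrK.
Qed.

(** Decay of order 2 d in both y and y - x gives [wint x], by [weightXV_conv]; the other N powers of
    A remain as decay in y. B is taken with one more derivative because differences of translates
    consume one. In C, the term 1 serves the bound and the other term the Lipschitz estimate. *)
Lemma translation_bounds : rapid A -> rapid B ->
  exchange_bounds (fun=> 1) (fun x y => A y * B (y - x)).
Proof.
move=> hA hB N; have [a a0 ha] := hA N (N + 2 * d)%N.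
have [b b0 hb] := hB N.+1 (2 * d)%N.
pose C := 2 ^+ N * a * b * (1 + 2 * (1 + d%:R) ^+ (2 * d)).
have D0 : 0 <= 2 * (1 + d%:R) ^+ (2 * d) :> R by rewrite mulr_ge0// exprn_ge0// addr_ge0.
have C00 : 0 <= 2 ^+ N * a * b by rewrite !mulr_ge0 ?exprn_ge0.
have C0 : 0 <= C by rewrite mulr_ge0// addr_ge0.
have conv (x y : E) : a * w y ^- (N + 2 * d) * (b * w (y - x) ^- (2 * d)) <=
    a * b * (w y ^- N * wint x).
  rewrite exprD invfM [leLHS](_ : _ = a * b * (w y ^- N *
    (w y ^- (2 * d) * w (y - x) ^- (2 * d)))); last by ring.
  rewrite ler_wpM2l ?mulr_ge0// ler_wpM2l ?weightXV_conv//.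
  by rewrite invr_ge0 exprn_ge0// weight_ge0.
exists (fun x => C * wint x); split.
- by move=> p; rewrite mulr_ge0// wint_ge0.
- rewrite nrm1; under eq_fun do rewrite mul1r.
  exact: (integrableZl measurableT C (integrable_wint d)).
- move=> p; apply: dle_mono (dleM ha (dle_translate p (dle_leq (leqnSn _) hb))) => y.
  rewrite (@le_trans _ _ (2 ^+ N * (a * b * (w y ^- N * wint p))))//.
    by rewrite ler_wpM2l ?exprn_ge0.
  rewrite [leLHS](_ : _ = 2 ^+ N * a * b * 1 * (wint p * w y ^- N)); last by ring.
  rewrite /C -[leRHS]mulrA ler_wpM2r ?mulr_ge0 ?wint_ge0 ?invr_ge0 ?exprn_ge0 ?weight_ge0//.
  by rewrite ler_wpM2l// lerDl.
- move=> p p' pp'.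
  rewrite (_ : (fun y => A y * B (y - p') - A y * B (y - p)) =
    (fun y => A y * (B (y - p') - B (y - p)))); last by apply/funext => y; rewrite mulrBr.
  apply: dle_mono (dleM ha (dle_translateB p' p b0 hb)) => y.
  have w1 : 0 <= w (p - p') - 1 by rewrite subr_ge0 weight_ge1.
  have wd : w (p - p') ^+ (2 * d) <= (1 + d%:R) ^+ (2 * d).
    by rewrite lerXn2r ?nnegrE ?weight_ge0 ?addr_ge0// weight_cube1.
  rewrite [leLHS](_ : _ = 2 ^+ N * (2 * (w (p - p') - 1)) * (w (p - p') ^+ (2 * d) *
    (a * w y ^- (N + 2 * d) * (b * w (y - p) ^- (2 * d))))); last by ring.
  rewrite (@le_trans _ _ (2 ^+ N * (2 * (w (p - p') - 1)) * ((1 + d%:R) ^+ (2 * d) *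
    (a * b * (w y ^- N * wint p)))))//.
    rewrite ler_wpM2l ?mulr_ge0 ?exprn_ge0//.
    rewrite ler_pM ?exprn_ge0 ?weight_ge0//.
    by rewrite !mulr_ge0 ?invr_ge0 ?exprn_ge0 ?weight_ge0.
  rewrite /C [leRHS](_ : _ = 2 ^+ N * a * b * (1 + 2 * (1 + d%:R) ^+ (2 * d)) *
    (wint p * (w (p - p') - 1) * w y ^- N)); last by ring.
  rewrite [leLHS](_ : _ = 2 ^+ N * a * b * (2 * (1 + d%:R) ^+ (2 * d)) *
    (wint p * (w (p - p') - 1) * w y ^- N)); last by ring.
  rewrite ler_wpM2r//.
    by rewrite !mulr_ge0 ?wint_ge0 ?invr_ge0 ?exprn_ge0 ?weight_ge0.
  by rewrite ler_wpM2l// lerDr.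
Qed.

Lemma rapid_translationM (x : E) : rapid A -> rapid B ->
  rapid (fun y => A y * B (y - x)).
Proof. by move=> hA hB; apply: rapidM => //; exact: rapid_translate. Qed.

End translation.

Let pderivsD s f g : rapid f -> rapid g ->
  pderivs s (fun y => f y + g y) = (fun y => pderivs s f y + pderivs s g y).
Proof.
move=> hf hg; have := pderivs_lin s 1 hf hg.
under eq_fun do rewrite mul1r.
by move=> ->; apply/funext => y; rewrite mul1r.
Qed.

Lemma integrableC_translation A B s y : rapid A -> rapid B ->
  integrableC mu (fun x => pderivs s (fun y => A y * B (y - x)) y).
Proof.
move=> hA hB; have n1 (p : E) : nrm (1 : R[i]) <= 1 by rewrite nrm1.
have := exchange_integrable s y (measC_cst 1) n1
  (fun x => rapid_translationM x hA hB) (translation_bounds hA hB).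
by under eq_fun do rewrite mul1r.
Qed.

(** Without derivatives this is invariance under reflection and translation. A derivative splits by
    Leibniz, and the term in which it falls on B vanishes since a derivative has integral 0. *)
Lemma pderivs_translation A B s y : rapid A -> rapid B ->
  pderivs s (fun y => integralC mu B * A y) y =
  integralC mu (fun x => pderivs s (fun y => A y * B (y - x)) y).
Proof.
elim/last_ind: s A B => [|s i IH] A B hA hB /=.
  have ih := integrableC_affine y (_ : -1 != 0) (rapid_integrable hB).
  have N1 : -1 != 0 :> R by rewrite oppr_eq0 oner_eq0.
  rewrite (integralC_affine y N1 (rapid_integrable hB)).
  rewrite normrN1 expr1n mul1r mulrC -integralCZ; last exact: ih.
  by apply: eq_integralC => x; rewrite scaleN1r.
have [dA hA'] := rapid_pderiv i hA; have [dB hB'] := rapid_pderiv i hB.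
have E1 x : pderivs (rcons s i) (fun y => A y * B (y - x)) y =
    pderivs s (fun y => pderiv i A y * B (y - x)) y +
    pderivs s (fun y => A y * pderiv i B (y - x)) y.
  have [dBx eBx] := pderiv_translate x dB.
  rewrite pderivs_rcons (pderivM dA dBx).2 eBx pderivsD//.
    exact: rapid_translationM.
  exact: rapid_translationM.
under [RHS]eq_integralC do rewrite E1.
rewrite integralCD; [|exact: integrableC_translation|exact: integrableC_translation].
rewrite -!IH// integralC_pderiv0// pderivs_rcons (pderivZ _ dA).2.
rewrite [X in _ + X](_ : _ = 0) ?addr0//.
under eq_fun do rewrite mul0r.
exact: pderivs0.
Qed.

Lemma temp_translation u A B : temp u -> rapid A -> rapid B ->
  integrableC mu (fun x => u (fun y => A y * B (y - x))) /\
  integralC mu B * u A = integralC mu (fun x => u (fun y => A y * B (y - x))).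
Proof.
move=> tu hA hB; have n1 (p : E) : nrm (1 : R[i]) <= 1 by rewrite nrm1.
have dP s y : pderivs s (fun y => integralC mu B * A y) y =
    integralC mu (fun x => 1 * pderivs s (fun y => A y * B (y - x)) y).
  by rewrite pderivs_translation//; apply: eq_integralC => x; rewrite mul1r.
have [h1 h2] := temp_exchange tu (measC_cst 1) n1 (rapidZ (integralC mu B) hA)
  (fun x => rapid_translationM x hA hB) (translation_bounds hA hB) dP.
split; first by move: h1; under eq_fun do rewrite mul1r.
by rewrite -(tempZ _ tu hA) h2; apply: eq_integralC => x; rewrite mul1r.
Qed.

Variable hbar : R.
Hypothesis hbar01 : 0 < hbar <= 1.
Local Notation chr := (chr hbar).
Local Notation FT := (FT hbar).

Let h0 : 0 < hbar. Proof. by case/andP: hbar01. Qed.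
Let hV0 : 0 <= hbar^-1. Proof. by rewrite invr_ge0 ltW. Qed.

(** The decay N.+1 of f covers the Lipschitz part, where [dle_chr_sub1] costs one power of w y. The
    price in the frequency p is a polynomial of degree N. *)
Lemma dle_chrM N f a (p p' : E) : 0 <= a -> dle N f (fun y => a * w y ^- N.+1) ->
  let C := 2 ^+ N * a * (1 + 2 ^+ N * (2 / hbar * ((1 + d%:R) / hbar) ^+ N)) in
  dle N (fun y => chr p y * f y) (fun y => C * (w p / hbar) ^+ N * w y ^- N) /\
  (cube p 1 p' -> dle N (fun y => chr p' y * f y - chr p y * f y)
    (fun y => C * (w p / hbar) ^+ N * (w (p - p') - 1) * w y ^- N)).
Proof.
move=> a0 hf C.
have D0 : 0 <= 2 ^+ N * (2 / hbar * ((1 + d%:R) / hbar) ^+ N).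
  by rewrite !mulr_ge0 ?exprn_ge0 ?mulr_ge0 ?addr_ge0.
have S0 : 0 <= (w p / hbar) ^+ N by rewrite exprn_ge0 ?mulr_ge0 ?weight_ge0.
have wN0 y : 0 <= w y ^- N by rewrite invr_ge0 exprn_ge0 ?weight_ge0.
have wS y : w y ^- N.+1 <= w y ^- N.
  by rewrite lef_pV2 ?posrE ?weightX_gt0// weightX_le.
split.
  apply: dle_mono (dleM (dle_chr hbar01 N p) hf) => y.
  rewrite (@le_trans _ _ (2 ^+ N * a * 1 * ((w p / hbar) ^+ N * w y ^- N)))//.
    rewrite [leLHS](_ : _ = 2 ^+ N * a * 1 * ((w p / hbar) ^+ N * w y ^- N.+1)); last by ring.
    by rewrite ler_wpM2l ?mulr_ge0 ?exprn_ge0// ler_wpM2l.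
  by rewrite -[leRHS]mulrA ler_wpM2r ?mulr_ge0// ler_wpM2l ?mulr_ge0 ?exprn_ge0// lerDl.
move=> pp'; have wE : w (p' - p) = w (p - p') by rewrite -weightN opprB.
rewrite (_ : (fun y => _) = (fun y => chr p y * ((chr (p' - p) y - 1) * f y))); last first.
  apply/funext => y; rewrite (_ : chr p' y = chr p y * chr (p' - p) y); first by ring.
  by rewrite -chrDl addrC subrK.
apply: dle_mono (dleM (dle_chr hbar01 N p) (dleM (dle_chr_sub1 hbar01 N (p' - p)) hf)) => y.
rewrite wE; have w1 : 0 <= w (p - p') - 1 by rewrite subr_ge0 weight_ge1.
have wd : (w (p - p') / hbar) ^+ N <= ((1 + d%:R) / hbar) ^+ N.
  rewrite lerXn2r ?nnegrE ?mulr_ge0 ?weight_ge0 ?addr_ge0//.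
  by rewrite ler_wpM2r// weight_cube1.
have wwE : w y ^- N.+1 * w y = w y ^- N.
  by rewrite exprS invfM mulrAC mulVf ?mul1r// weight_neq0.
rewrite [leLHS](_ : _ = 2 ^+ N * a * (2 ^+ N * (2 / hbar * (w (p - p') / hbar) ^+ N)) *
  ((w p / hbar) ^+ N * (w (p - p') - 1) * (w y ^- N.+1 * w y))); last by ring.
rewrite wwE [leRHS](_ : _ = C * ((w p / hbar) ^+ N * (w (p - p') - 1) * w y ^- N)); last by ring.
rewrite ler_wpM2r ?mulr_ge0// /C ler_wpM2l ?mulr_ge0 ?exprn_ge0//.
rewrite (@le_trans _ _ (2 ^+ N * (2 / hbar * ((1 + d%:R) / hbar) ^+ N)))//; last by rewrite lerDr.
by rewrite ler_wpM2l ?exprn_ge0// ler_wpM2l ?mulr_ge0.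
Qed.

Lemma rapid_chrM p f : rapid f -> rapid (fun y => chr p y * f y).
Proof.
by move=> hf; have := rapid_chr hbar01 p hf; under eq_fun do rewrite mulrC.
Qed.

(** The growth of order N in p is beaten by the decay N + 2 d of [FT m], and [wint p] is left
    over. *)
Lemma modulation_bounds m f : rapid m -> rapid f ->
  exchange_bounds (FT m) (fun p y => chr p y * f y).
Proof.
move=> hm hf N; have [a a0 ha] := hf N N.+1.
pose C := 2 ^+ N * a * (1 + 2 ^+ N * (2 / hbar * ((1 + d%:R) / hbar) ^+ N)).
have C0 : 0 <= C.
  rewrite mulr_ge0 ?mulr_ge0 ?exprn_ge0// addr_ge0// mulr_ge0 ?exprn_ge0//.
  by rewrite !mulr_ge0 ?exprn_ge0 ?mulr_ge0 ?addr_ge0.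
have W0 p : 0 <= C * (w p / hbar) ^+ N.
  by rewrite mulr_ge0// exprn_ge0 ?mulr_ge0 ?weight_ge0.
exists (fun p => C * (w p / hbar) ^+ N); split=> //.
- have [b b0 hb] := FT_rapid_decay hbar01 (N + 2 * d) hm.
  apply: (le_integrable _ _ _ (integrableZl measurableT (b * C * hbar^-1 ^+ N) (integrable_wint d))) => //.
    apply/measurable_EFinP; apply: measurable_funM.
      by apply: measurable_nrm; exact: contC_measC (contC_FT hbar01 hm).
    apply: measurable_funM => //; apply: measurable_funX; apply: measurable_funM => //.
    by apply: continuous_measurable_row; exact: continuous_weight.
  move=> p _; rewrite -EFinM !abse_EFin lee_fin.
  rewrite (ger0_norm (mulr_ge0 (nrm_ge0 (FT m p)) (W0 p))) [leRHS]ger0_norm; last first.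
    exact: mulr_ge0 (mulr_ge0 (mulr_ge0 b0 C0) (exprn_ge0 _ hV0)) (wint_ge0 p).
  rewrite (@le_trans _ _ (b * w p ^- (N + 2 * d) * (C * (w p / hbar) ^+ N)))//.
    by rewrite ler_wpM2r.
  rewrite exprD invfM exprMn [leLHS](_ : _ =
    (b * C * hbar^-1 ^+ N * w p ^- (2 * d)) * (w p ^- N * w p ^+ N)); last by ring.
  by rewrite mulVf ?mulr1// gt_eqF// weightX_gt0.
- by move=> p; exact: (dle_chrM p p a0 ha).1.
- by move=> p p'; exact: (dle_chrM p p' a0 ha).2.
Qed.

Lemma FT_bounded m : rapid m -> exists b : R, forall p, nrm (FT m p) <= b.
Proof.
move=> hm; have [b b0 hb] := FT_rapid_decay hbar01 0 hm; exists b => p.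
by have := hb p; rewrite invr1 mulr1.
Qed.

Lemma integrableC_modulation m f s y : rapid m -> rapid f ->
  integrableC mu (fun p => FT m p * pderivs s (fun y => chr p y * f y) y).
Proof.
move=> hm hf; have [b hb] := FT_bounded hm.
apply: exchange_integrable hb _ (modulation_bounds hm hf).
  exact: contC_measC (contC_FT hbar01 hm).
by move=> p; exact: rapid_chrM.
Qed.

Section modulation.
Variable K : R[i].
Hypothesis inv : forall m y, rapid m ->
  integralC mu (fun eta => FT m eta * chr eta y) = K * m y.

(** Differentiating the character brings down i p_i / hbar, which turns [FT m] into the transform of
    the derivative of m. Both sides then obey the Leibniz rule, so the induction runs over all m and
    f. *)
Lemma pderivs_modulation m f s y : rapid m -> rapid f ->
  pderivs s (fun y => K * (m y * f y)) y =
  integralC mu (fun p => FT m p * pderivs s (fun y => chr p y * f y) y).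
Proof.
elim/last_ind: s m f => [|s i IH] m f hm hf /=.
  rewrite mulrA -inv// mulrC -integralCZ; last first.
    have := integrableC_chr hbar y (integrableC_FT hbar01 hm).
    by under eq_fun do rewrite chrC.
  by apply: eq_integralC => p; ring.
have [dm hm'] := rapid_pderiv i hm; have [df hf'] := rapid_pderiv i hf.
have E1 p : pderivs (rcons s i) (fun y => chr p y * f y) y =
    Complex 0 (p ord0 i / hbar) * pderivs s (fun y => chr p y * f y) y +
    pderivs s (fun y => chr p y * pderiv i f y) y.
  have [dc ec] := pderiv_chr hbar i p.
  rewrite pderivs_rcons (pderivM dc df).2 ec.
  rewrite (_ : (fun y => _) = (fun y => Complex 0 (p ord0 i / hbar) * (chr p y * f y) +
    chr p y * pderiv i f y)); last by apply/funext => z; ring.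
  by rewrite pderivs_lin//; exact: rapid_chrM.
under [RHS]eq_integralC do rewrite E1 mulrDr mulrA [FT m _ * Complex _ _]mulrC -FT_pderiv//.
rewrite integralCD; [|exact: integrableC_modulation|exact: integrableC_modulation].
rewrite -!IH// pderivs_rcons.
have [dmf emf] := pderivM dm df.
rewrite (pderivZ K dmf).2 emf.
under eq_fun do rewrite mulrDr.
by rewrite pderivsD//; apply: rapidZ; exact: rapidM.
Qed.

Lemma temp_modulation u m f : temp u -> rapid m -> rapid f ->
  integrableC mu (fun p => FT m p * u (fun y => chr p y * f y)) /\
  K * u (fun y => m y * f y) =
  integralC mu (fun p => FT m p * u (fun y => chr p y * f y)).
Proof.
move=> tu hm hf; have [b hb] := FT_bounded hm.
have hmf : rapid (fun y => m y * f y) by exact: rapidM.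
rewrite -tempZ//; apply: (temp_exchange tu _ hb (rapidZ K hmf)).
- exact: contC_measC (contC_FT hbar01 hm).
- by move=> p; exact: rapid_chrM.
- exact: modulation_bounds.
- by move=> s y; exact: pderivs_modulation.
Qed.

End modulation.

End exchange_instances.

(** * Change of window *)

Section window.
Context {R : realType} {d : nat}.
Local Notation E := 'rV[R]_d.
Local Notation w := (@weight R d).
Local Notation mu := (leb R d).
Variable hbar : R.
Hypothesis hbar01 : 0 < hbar <= 1.
Local Notation chr := (chr hbar).
Local Notation FT := (FT hbar).
Implicit Types (u : (E -> R[i]) -> R[i]) (f g m gam : E -> R[i]).

Let h0 : 0 < hbar. Proof. by case/andP: hbar01. Qed.
Let hV0 : 0 <= hbar^-1. Proof. by rewrite invr_ge0 ltW. Qed.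

(** The transform in the convention of [gabor_conj], stripped of its constant: linear in the window
    and with positive frequency. [gabor] is recovered from the conjugate window at - xi. *)
Definition stft u gam (x xi : E) : R[i] := u (fun y => chr xi y * gam (y - x)).

Lemma contC_lipschitz2 (F : E * E -> R[i]) (B : E * E -> R) :
  (forall z z', cube z.1 1 z'.1 -> cube z.2 1 z'.2 ->
     nrm (F z - F z') <= B z * ((w (z.1 - z'.1) - 1) + (w (z.2 - z'.2) - 1))) ->
  contC F.
Proof.
move=> h; have part (p : R[i] -> R) : (forall z, `|p z| <= nrm z) ->
    (forall z z', p (z - z') = p z - p z') -> continuous (fun z => p (F z)).
  move=> pn pB z; apply/(@cvgrPdist_lt _ _ _ (nbhs z) (nbhs_filter z)) => e e0.
  pose c := `|B z| * (2 * d%:R) + 1.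
  have c1 : 0 < c by rewrite ltr_wpDl// !mulr_ge0.
  pose r := Num.min 1 (e / c).
  have r0 : 0 < r by rewrite lt_min ltr01 divr_gt0.
  have nb (x : E) : nbhs x (cube x r) by apply/nbhs_cubeP; exists r.
  exists (cube z.1 r, cube z.2 r) => [|z' [/= z1 z2]]; first by split; exact: nb.
  have r1 (x y : E) : cube x r y -> cube x 1 y.
    by move=> xy i; apply: (lt_le_trans (xy i)); rewrite ge_min lexx.
  rewrite -pB (le_lt_trans (pn _))// (le_lt_trans (h _ _ (r1 _ _ z1) (r1 _ _ z2)))//.
  have w0 (x : E) : 0 <= w x - 1 by rewrite subr_ge0 weight_ge1.
  apply: (@le_lt_trans _ _ (`|B z| * (d%:R * r + d%:R * r))).
    apply: (@le_trans _ _ (`|B z| * ((w (z.1 - z'.1) - 1) + (w (z.2 - z'.2) - 1)))).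
      by rewrite ler_wpM2r ?ler_norm// addr_ge0.
    by rewrite ler_wpM2l// lerD// weight_cube.
  apply: (@le_lt_trans _ _ ((`|B z| * (2 * d%:R)) * (e / c))).
    rewrite [leLHS](_ : _ = (`|B z| * (2 * d%:R)) * r); last by ring.
    by rewrite ler_wpM2l ?mulr_ge0// ge_min lexx orbT.
  by rewrite mulrCA gtr_pMr// ltr_pdivrMr// mul1r ltrDl.
split.
  exact: part Re_le_nrm (fun z w => etrans (ReD _ _) (congr1 _ (ReN _))).
exact: part Im_le_nrm (fun z w => etrans (ImD _ _) (congr1 _ (ImN _))).
Qed.

(** With u controlled by its N-th seminorm, a move of x costs one derivative of the window and a
    move of xi one power of its decay, hence the two bounds b and a0. The position is moved first,
    at frequency z'.2, and the frequency afterwards, at position z.1. *)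
Lemma contC_stft u gam : temp u -> rapid gam ->
  contC (fun z : E * E => stft u gam z.1 z.2).
Proof.
move=> tu hg; have [lin [N [c [c0 hc]]]] := tu.
have [b b0 hb] := hg N.+1 N.
have [a0 ha0 ha] := hg N N.+1.
have rt x : rapid (fun y => gam (y - x)) by exact: rapid_translate.
pose C1 (z : E * E) := 2 ^+ N * (w z.2 * (1 + d%:R) / hbar) ^+ N *
  (2 * (1 + d%:R) ^+ N * b * w z.1 ^+ N).
pose a1 (x : E) := a0 * w x ^+ N.+1.
pose C2 (z : E * E) := 2 ^+ N * a1 z.1 * (1 + 2 ^+ N * (2 / hbar * ((1 + d%:R) / hbar) ^+ N)) *
   (w z.2 / hbar) ^+ N.
have d1 : 0 <= 1 + d%:R :> R by rewrite addr_ge0.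
have a10 x : 0 <= a1 x by rewrite mulr_ge0// exprn_ge0// weight_ge0.
have C10 z : 0 <= C1 z.
  by rewrite /C1 !mulr_ge0 ?exprn_ge0 ?mulr_ge0 ?weight_ge0.
have C20 z : 0 <= C2 z.
  rewrite /C2 mulr_ge0 ?exprn_ge0 ?mulr_ge0 ?exprn_ge0 ?weight_ge0 ?a10//.
  by rewrite addr_ge0// !mulr_ge0 ?exprn_ge0 ?mulr_ge0.
have w0 (x : E) : 0 <= w x - 1 by rewrite subr_ge0 weight_ge1.
apply: (@contC_lipschitz2 _ (fun z => c * (C1 z + C2 z))) => z z' z1 z2.
rewrite nrm_distC.
have e1 : nrm (u (fun y => chr z'.2 y * (gam (y - z'.1) - gam (y - z.1)))) <=
    c * (C1 z * (w (z.1 - z'.1) - 1)).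
  apply: hc.
  - by apply: rapid_chrM => //; exact: rapidB.
  - by rewrite mulr_ge0.
  apply: dle_mono (dleM (dle_chr hbar01 N z'.2) (dle_translateB z'.1 z.1 b0 hb)) => y.
  have q1 : (w z'.2 / hbar) ^+ N <= (w z.2 * (1 + d%:R) / hbar) ^+ N.
    rewrite lerXn2r ?nnegrE ?mulr_ge0 ?weight_ge0// ler_wpM2r//.
    rewrite (le_trans (weight_le_shift z'.2 z.2))// mulrC ler_wpM2l ?weight_ge0//.
    by rewrite -weightN opprB weight_cube1.
  have q2 : w (z.1 - z'.1) ^+ N <= (1 + d%:R) ^+ N.
    by rewrite lerXn2r ?nnegrE ?weight_ge0// weight_cube1.
  have q3 := weightXV_shift N y z.1.
  rewrite /C1 [leRHS](_ : _ = 2 ^+ N * (w z.2 * (1 + d%:R) / hbar) ^+ N *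
    (2 * (w (z.1 - z'.1) - 1) * (1 + d%:R) ^+ N * (b * (w z.1 ^+ N * w y ^- N)))); last by ring.
  rewrite -[leRHS]mulrA ler_wpM2l ?exprn_ge0//.
  apply: ler_pM => //.
  - by rewrite exprn_ge0 ?mulr_ge0 ?weight_ge0.
  - rewrite !mulr_ge0 ?exprn_ge0 ?weight_ge0 ?invr_ge0 ?exprn_ge0 ?weight_ge0//.
  apply: ler_pM => //.
  - by rewrite !mulr_ge0 ?exprn_ge0 ?weight_ge0.
  - by rewrite mulr_ge0// invr_ge0 exprn_ge0// weight_ge0.
  - by rewrite ler_wpM2l// mulr_ge0.
  - by rewrite ler_wpM2l.
have hgx : dle N (fun y => gam (y - z.1)) (fun y => a1 z.1 * w y ^- N.+1).
  apply: dle_mono (dle_translate z.1 ha) => y.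
  by rewrite /a1 -mulrA ler_wpM2l// weightXV_shift.
have e2 : nrm (u (fun y => chr z'.2 y * gam (y - z.1) - chr z.2 y * gam (y - z.1))) <=
    c * (C2 z * (w (z.2 - z'.2) - 1)).
  apply: hc.
  - by apply: rapidB; exact: rapid_chrM.
  - by rewrite mulr_ge0.
  exact: (dle_chrM hbar01 z.2 z'.2 (a10 z.1) hgx).2.
have -> : stft u gam z'.1 z'.2 - stft u gam z.1 z.2 =
    u (fun y => chr z'.2 y * (gam (y - z'.1) - gam (y - z.1))) +
    u (fun y => chr z'.2 y * gam (y - z.1) - chr z.2 y * gam (y - z.1)).
  rewrite (_ : (fun y => chr z'.2 y * (gam (y - z'.1) - gam (y - z.1))) =
    (fun y => chr z'.2 y * gam (y - z'.1) - chr z'.2 y * gam (y - z.1))); last first.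
    by apply/funext => y; rewrite mulrBr.
  by rewrite !tempB /stft//; [ring|exact: rapid_chrM..].
rewrite (le_trans (nrmD _ _))// (le_trans (lerD e1 e2))//.
rewrite -mulrDr -[leRHS]mulrA ler_wpM2l// mulrDl.
by apply: lerD; apply: ler_wpM2l => //; rewrite ?lerDl ?lerDr w0.
Qed.

Lemma measC_stft u gam : temp u -> rapid gam ->
  measC (fun z : E * E => stft u gam z.1 z.2).
Proof.
move=> tu hg; have [c1 c2] := contC_stft tu hg.
by split; exact: continuous_measurable_row2.
Qed.

Lemma contC_stft1 u gam xi : temp u -> rapid gam -> contC (fun x => stft u gam x xi).
Proof.
move=> tu hg; apply: (contC_comp (L := fun x : E => (x, xi))
  (f := fun z : E * E => stft u gam z.1 z.2)); last exact: contC_stft.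
move=> x A [[P Q] /= [Px Qxi] PQA]; apply: filterS Px => y Py.
by apply: PQA; split => //=; exact: nbhs_singleton Qxi.
Qed.

Definition stft_sup u gam (x : E) : \bar R :=
  ereal_sup [set (nrm (stft u gam x xi))%:E | xi in setT].

Lemma stft_le_sup u gam x xi : ((nrm (stft u gam x xi))%:E <= stft_sup u gam x)%E.
Proof. by apply: ereal_sup_ubound; exists xi. Qed.

Lemma stft_sup_ge0 u gam x : (0 <= stft_sup u gam x)%E.
Proof. by apply: le_trans (stft_le_sup u gam x 0); rewrite lee_fin nrm_ge0. Qed.

(** The supremum is uncountable but lower semicontinuous: each set where it exceeds a is a union of
    open sets, one for every xi. *)
Lemma measurable_stft_sup u gam : temp u -> rapid gam ->
  measurable_fun setT (stft_sup u gam).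
Proof.
move=> tu hg; apply: (measurability _ (ErealGenOInfty.measurableE R)).
move=> _ [_ [a ->] <-]; rewrite setTI; apply: open_measurable_row.
rewrite (_ : _ @^-1` _ = \bigcup_(xi in setT)
    [set x | a < nrm (stft u gam x xi)]); last first.
  apply/seteqP; split=> x /=; rewrite in_itv/= andbT.
    by move=> /ereal_sup_gt[_ [xi _ <-]]; rewrite lte_fin => h; exists xi.
  move=> [xi _ /= h]; apply: lt_le_trans (stft_le_sup u gam x xi).
  by rewrite lte_fin.
apply: bigcup_open => xi _.
rewrite (_ : [set x | _] = (fun x => nrm (stft u gam x xi)) @^-1` `]a, +oo[%classic); last first.
  by apply/seteqP; split=> x /=; rewrite in_itv/= andbT.
apply: open_comp => [x _|]; first exact: contC_nrm (contC_stft1 xi tu hg) x.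
exact: interval_open.
Qed.

Lemma integral_wint_translate (x : E) :
  (\int[mu]_y (wint (y - x))%:E = \int[mu]_y (wint y)%:E :> \bar R)%E.
Proof.
have mw : measurable_fun setT (fun y : E => (wint y)%:E).
  by have /integrableP[] := @integrable_wint R d.
rewrite [RHS](ge0_integral_affine (- x) (oner_neq0 R) mw); last first.
  by move=> y; rewrite lee_fin wint_ge0.
rewrite normr1 expr1n mul1e; apply: eq_integral => y _.
by rewrite scale1r addrC.
Qed.

Lemma integrable_wint_translate (x : E) :
  mu.-integrable setT (EFin \o (fun y => wint (y - x))).
Proof.
apply/integrableP; split.
  apply/measurable_EFinP; apply: continuous_measurable_row => y.
  apply: (@continuous_comp _ _ _ (fun y : E => y - x) wint).
    exact: (cvgB (@cvg_id _ _) (cvg_cst x)).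
  exact: continuous_weightXV.
under eq_integral do rewrite gee0_abs ?lee_fin ?wint_ge0//.
rewrite integral_wint_translate; have /integrableP[_] := @integrable_wint R d.
by under eq_integral do rewrite gee0_abs ?lee_fin ?wint_ge0//.
Qed.

(** In the modulation formula the character at p merges with the one at xi into the character at p +
    xi, and a supremum over all frequencies does not see this shift. *)
Lemma temp_mul_bound u (K : R[i]) m gam x xi : K != 0 ->
  (forall m y, rapid m -> integralC mu (fun eta => FT m eta * chr eta y) = K * m y) ->
  temp u -> rapid m -> rapid gam ->
  ((nrm (u (fun y => m y * (chr xi y * gam (y - x)))))%:E <=
   (2 / nrm K)%:E * ((\int[mu]_p nrm (FT m p))%:E * stft_sup u gam x))%E.
Proof.
move=> K0 inv tu hm hg; have Kgt0 : 0 < nrm K.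
  by rewrite lt_def nrm_eq0 K0 nrm_ge0.
have hgx : rapid (fun y => chr xi y * gam (y - x)).
  by apply: rapid_chrM => //; exact: rapid_translate.
have [i1 e1] := temp_modulation hbar01 inv tu hm hgx.
have iFm := integrable_nrm (integrableC_FT hbar01 hm).
have := @nrm_integralC_lee _ _ _ mu _
  (fun p => ((nrm (FT m p))%:E * stft_sup u gam x)%E) i1.
rewrite -e1 nrmM.
have mFm : measurable_fun setT (fun p => (nrm (FT m p))%:E) by have /integrableP[] := iFm.
have H1 : measurable_fun setT (fun p => ((nrm (FT m p))%:E * stft_sup u gam x)%E).
  by apply: emeasurable_funM => //; exact: measurable_cst.
move=> /(_ H1); rewrite ge0_integralZr//; last 2 first.
- by move=> p _; rewrite lee_fin nrm_ge0.
- exact: stft_sup_ge0.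
have -> : (\int[mu]_p (nrm (FT m p))%:E = (\int[mu]_p nrm (FT m p))%:E)%E.
  by rewrite /Rintegral fineK//; exact: integrable_fin_num.
move=> H2.
have H3 : ((nrm K * nrm (u (fun y => (m y * (chr xi y * gam (y - x)))%R)))%:E <=
  2%:E * ((\int[mu]_p nrm (FT m p))%:E * stft_sup u gam x))%E.
  apply: H2 => p; rewrite nrmM EFinM lee_wpmul2l ?lee_fin ?nrm_ge0//.
  rewrite (_ : (fun y => _) = (fun y => chr (p + xi) y * gam (y - x))); last first.
    by apply/funext => y; rewrite chrDl mulrA.
  exact: stft_le_sup.
apply: (@le_trans _ _ ((nrm K)^-1%:E *
    (nrm K * nrm (u (fun y => (m y * (chr xi y * gam (y - x)))%R)))%:E)%E).
  by rewrite -EFinM mulrA mulVf ?gt_eqF// mul1r.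
have -> : (2 / nrm K)%:E = ((nrm K)^-1%:E * 2%:E)%E by rewrite -EFinM mulrC.
by rewrite -[leRHS]muleA lee_wpmul2l// lee_fin invr_ge0 nrm_ge0.
Qed.

Lemma measurable_rowB : measurable_fun setT (fun z : E * E => z.1 - z.2).
Proof.
apply/measurable_fun_coordP => i; under eq_fun do rewrite !mxE.
apply: measurable_funB.
  exact: (measurableT_comp (measurable_coord i) measurable_fst).
exact: (measurableT_comp (measurable_coord i) measurable_snd).
Qed.

(** Of the 4 d powers of decay of f, half combine with those of g into [wint (x - z)] and half stay
    integrable in y. The 2 d derivatives make the transform integrable in p, uniformly otherwise. *)
Lemma integral_FT_window f g : rapid f -> rapid g -> exists2 C : R, 0 <= C &
  forall x z, \int[mu]_p nrm (FT (fun y => f (y - x) * conjc (g (y - z))) p) <=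
    C * wint (x - z).
Proof.
move=> hf hg; have [a a0 ha] := hf (2 * d)%N (2 * d + 2 * d)%N.
have [b b0 hb] := rapid_conj hg (2 * d)%N (2 * d)%N.
pose I0 : R := \int[mu]_y wint y.
have I00 : 0 <= I0 by apply: Rintegral_ge0 => y _; exact: wint_ge0.
pose c := 2 ^+ (2 * d) * (a * b).
have c0 : 0 <= c by rewrite mulr_ge0 ?exprn_ge0 ?mulr_ge0.
exists (d.+1%:R ^+ (2 * d) * (2 * (c * I0)) * I0).
  by apply: mulr_ge0 => //; apply: mulr_ge0; [exact: exprn_ge0|rewrite !mulr_ge0].
move=> x z; pose m y := f (y - x) * conjc (g (y - z)).
have hm : rapid m.
  by apply: rapidM; [exact: rapid_translate|exact/(rapid_translate z (rapid_conj hg))].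
have dm : dle (2 * d) m (fun y => c * wint (x - z) * wint (y - x)).
  apply: dle_mono (dleM (dle_translate x ha) (dle_translate z hb)) => y.
  rewrite exprD invfM [leLHS](_ : _ = c * (w (y - x) ^- (2 * d) *
    (w (y - x) ^- (2 * d) * w (y - z) ^- (2 * d)))); last by rewrite /c; ring.
  rewrite -mulrA ler_wpM2l// mulrC ler_wpM2r ?wint_ge0//.
  have := weightXV_conv (2 * d) (z - x) (y - x).
  rewrite (_ : y - x - (z - x) = y - z); last by rewrite opprB addrA subrK.
  by rewrite -(weightN (z - x)) opprB.
have iW : mu.-integrable setT (EFin \o (fun y => c * wint (x - z) * wint (y - x))).
  exact: (integrableZl measurableT (c * wint (x - z)) (integrable_wint_translate x)).
have WE : \int[mu]_y (c * wint (x - z) * wint (y - x)) = c * wint (x - z) * I0.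
  rewrite RintegralZl//; last exact: integrable_wint_translate.
  by congr (_ * _); rewrite /Rintegral integral_wint_translate.
have FW p : nrm (FT m p) <= d.+1%:R ^+ (2 * d) * (2 * (c * wint (x - z) * I0)) * wint p.
  rewrite ler_pdivlMr ?weightX_gt0// mulrC -WE; exact: FT_decay.
have iR := integrableZl measurableT
  (d.+1%:R ^+ (2 * d) * (2 * (c * wint (x - z) * I0))) (@integrable_wint R d).
apply: (@le_trans _ _ (\int[mu]_p
    (d.+1%:R ^+ (2 * d) * (2 * (c * wint (x - z) * I0)) * wint p))).
  apply: le_Rintegral => //; first exact: integrable_nrm (integrableC_FT hbar01 hm).
rewrite RintegralZl//; last exact: integrable_wint.
by rewrite le_eqVlt; apply/orP; left; apply/eqP; rewrite -/I0; ring.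
Qed.

(* Average [stft u gam x xi] over the translates [g (y - z) * conjc (g (y - z))]:
   by [temp_mul_bound] with [m y = gam (y - x) * conjc (g (y - z))] it is bounded by
   the convolution of [wint] with [stft_sup u g]. *)
Lemma change_window u g gam : temp u -> rapid g -> rapid gam -> (exists y, g y != 0) ->
  (\int[mu]_x stft_sup u g x < +oo)%E -> (\int[mu]_x stft_sup u gam x < +oo)%E.
Proof.
move=> tu hg hgam g0 Hoo.
have [K K0 inv] := fourier_inversion hbar01 hg g0.
have [C C0 hC] := integral_FT_window hgam hg.
have hgg : rapid (fun y => g y * conjc (g y)) by exact/rapidM/rapid_conj.
pose N2 := integralC mu (fun y => g y * conjc (g y)).
have N20 : N2 != 0 by exact: integralC_sqr_neq0 (rapid_cont hg) (rapid_integrable hgg) g0.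
have N2gt0 : 0 < nrm N2 by rewrite lt_def nrm_eq0 N20 nrm_ge0.
have Kgt0 : 0 < nrm K by rewrite lt_def nrm_eq0 K0 nrm_ge0.
pose H := stft_sup u g; have H0 z : (0 <= H z)%E by exact: stft_sup_ge0.
have mH : measurable_fun setT H by exact: measurable_stft_sup.
pose D := 2 / nrm K * C; have D0 : 0 <= D by rewrite mulr_ge0// divr_ge0// ltW.
pose k (x z : E) := ((wint (x - z))%:E * H z)%E.
have k0 x z : (0 <= k x z)%E by rewrite mule_ge0// lee_fin wint_ge0.
have mwint : measurable_fun setT (@wint R d).
  exact: continuous_measurable_row (@continuous_weightXV R d (2 * d)).
have mk : measurable_fun setT (fun z : E * E => k z.1 z.2).
  apply: emeasurable_funM.
    by apply/measurable_EFinP; exact: (measurableT_comp mwint measurable_rowB).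
  exact: (measurableT_comp mH measurable_snd).
have mkx x : measurable_fun setT (k x) by exact: (measurable_fun_pair2 x mk).
have bound x xi : ((nrm (stft u gam x xi))%:E <=
    (2 * D / nrm N2)%:E * \int[mu]_z k x z)%E.
  have hA : rapid (fun y => chr xi y * gam (y - x)).
    by apply: rapid_chrM => //; exact: rapid_translate.
  have [i1 e1] := temp_translation tu hA hgg.
  have mDk : measurable_fun setT (fun z => (D%:E * k x z)%E).
    by apply: emeasurable_funM => //; exact: measurable_cst.
  have := nrm_integralC_lee i1 mDk; rewrite -e1 -/N2 nrmM => h.
  have {}h : ((nrm N2 * nrm (stft u gam x xi))%:E <= 2%:E * \int[mu]_z (D%:E * k x z))%E.
    apply: h => z.
    have hm : rapid (fun y => gam (y - x) * conjc (g (y - z))).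
      by apply: rapidM; [exact: rapid_translate|exact/(rapid_translate z (rapid_conj hg))].
    have := temp_mul_bound z xi K0 inv tu hm hg.
    rewrite (_ : (fun y => gam (y - x) * conjc (g (y - z)) * (chr xi y * g (y - z))) =
      (fun y => chr xi y * gam (y - x) * (g (y - z) * conjc (g (y - z))))); last first.
      by apply/funext => y; ring.
    move=> /le_trans; apply.
    have -> : D%:E = ((2 / nrm K)%:E * C%:E)%E by rewrite -EFinM.
    rewrite -[leRHS]muleA; apply: lee_wpmul2l; first by rewrite lee_fin divr_ge0// ltW.
    by rewrite /k [leRHS]muleA; apply: lee_wpmul2r => //; rewrite -EFinM lee_fin.
  rewrite ge0_integralZl// in h.
  apply: (@le_trans _ _ ((nrm N2)^-1%:E * (nrm N2 * nrm (stft u gam x xi))%:E)%E).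
    by rewrite -EFinM mulrA mulVf ?gt_eqF// mul1r.
  have -> : (2 * D / nrm N2)%:E = ((nrm N2)^-1%:E * (2%:E * D%:E))%E.
    by rewrite -!EFinM mulrC.
  rewrite -[leRHS]muleA; apply: lee_wpmul2l.
    by rewrite lee_fin invr_ge0 nrm_ge0.
  by rewrite -[leRHS]muleA.
have E0 : 0 <= 2 * D / nrm N2 by exact: divr_ge0 (mulr_ge0 (ler0n _ 2) D0) (ltW N2gt0).
have mI : measurable_fun setT (fun x => \int[mu]_z k x z)%E.
  by apply: (measurable_fun_fubini_tonelli_F (fun z : E * E => k z.1 z.2)) => //= z; exact: k0.
apply: (@le_lt_trans _ _ (\int[mu]_x ((2 * D / nrm N2)%:E * \int[mu]_z k x z))%E).
  apply: ge0_le_integral => //.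
  - by move=> x _; exact: stft_sup_ge0.
  - exact: measurable_stft_sup.
  - by apply: emeasurable_funM => //; exact: measurable_cst.
  - by move=> x _; apply: ge_ereal_sup => _ [xi _ <-]; exact: bound.
have Ik0 : (0 <= \int[mu]_x \int[mu]_z k x z)%E.
  by apply: integral_ge0 => x _; exact: integral_ge0.
rewrite ge0_integralZl//; last by move=> x _; exact: integral_ge0.
rewrite lte_mul_pinfty//.
(* Young's inequality for L1 norms: integrating in x first, translation invariance leaves the
   integral of [wint] times that of H. *)
rewrite (fubini_tonelli (fun z : E * E => k z.1 z.2))//=.
have kE z : (\int[mu]_x k x z = (\int[mu]_y (wint y)%:E) * H z)%E.
  rewrite /k ge0_integralZr//; first by rewrite integral_wint_translate.
  - by have /integrableP[] := integrable_wint_translate z.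
  - by move=> x _; rewrite lee_fin wint_ge0.
under eq_integral do rewrite kE.
have w0 : (0 <= \int[mu]_y (@wint R d y)%:E)%E.
  by apply: integral_ge0 => y _; rewrite lee_fin wint_ge0.
rewrite ge0_integralZl//.
rewrite lte_mul_pinfty// ge0_fin_numE//.
have /integrableP[_] := @integrable_wint R d.
by under eq_integral do rewrite gee0_abs ?lee_fin ?wint_ge0//.
Qed.

End window.

(** * The Gabor pairing *)

Section fresnel.
Context {R : realType} {d : nat}.
Local Notation E := 'rV[R]_d.
Local Notation w := (@weight R d).
Local Notation mu := (leb R d).
Variable hbar : R.
Hypothesis hbar01 : 0 < hbar <= 1.
Local Notation chr := (chr hbar).
Local Notation FT := (FT hbar).
Local Notation stft := (stft hbar).
Local Notation stft_sup := (stft_sup hbar).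
Local Notation Fplus := (Fplus hbar : E -> R[i]).
Implicit Types (u : (E -> R[i]) -> R[i]) (f g m gam phi : E -> R[i]).

Let h0 : 0 < hbar. Proof. by case/andP: hbar01. Qed.

Let c : R := (2 * pi * hbar) `^ (- (d%:R / 2)).

Let c_gt0 : 0 < c.
Proof. by rewrite /c powR_gt0// !mulr_gt0// pi_gt0. Qed.

Lemma tf_shiftE x xi g :
  tf_shift hbar x xi g = (fun y => c%:C%C * (chr xi y * g (y - x))).
Proof. by apply/funext => y; rewrite /tf_shift -mulrA. Qed.

Lemma rapid_tf x xi g : rapid g -> rapid (fun y => chr xi y * g (y - x)).
Proof. by move=> hg; apply: rapid_chrM => //; exact: rapid_translate. Qed.

Lemma gabor_stft u g x xi : temp u -> rapid g ->
  gabor hbar g u x xi = c%:C%C * stft u (fun y => conjc (g y)) x (- xi).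
Proof.
move=> tu hg; rewrite /gabor /bracket tf_shiftE /stft.
rewrite -(tempZ _ tu (rapid_tf x (- xi) (rapid_conj hg))).
by congr u; apply/funext => y; rewrite !conjM conj_realc conj_chr.
Qed.

Lemma gabor_conj_stft u gam x xi : temp u -> rapid gam ->
  gabor_conj hbar gam u x xi = c%:C%C * stft u gam x xi.
Proof.
move=> tu hg; rewrite /gabor_conj /gabor /bracket /conj_distr conjcK tf_shiftE.
rewrite /stft -(tempZ _ tu (rapid_tf x xi hg)).
by congr u; apply/funext => y; rewrite conjcK.
Qed.

Lemma rapid_Fplus g : rapid g -> rapid (fun y => Fplus y * g y).
Proof.
move=> hg; have := rapid_slowM hg (slow_Fplus hbar01).
by congr rapid; apply/funext => y; rewrite mulrC.
Qed.

Lemma gabor_Fplus g x xi : rapid g -> gabor hbar g (regular Fplus) x xi =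
  c%:C%C * FT (fun y => Fplus y * conjc (g (y - x))) xi.
Proof.
move=> hg; rewrite /gabor /bracket /regular tf_shiftE -integralCZ; last first.
  apply/integrableC_chr/rapid_integrable/rapid_Fplus.
  exact/(rapid_translate x (rapid_conj hg)).
by apply: eq_integralC => y; rewrite !conjM conj_realc conj_chr; ring.
Qed.

Lemma FplusD x y : Fplus (x + y) = chirp hbar x * chr x y * Fplus y.
Proof.
rewrite /Fplus -[RHS]mulrC -!mulrA; congr (_ * (_ * _)).
rewrite [RHS]mulrC /chirp /chr -!cisD; congr cis.
by rewrite dotDl !dotDr (dotC y x); field; rewrite gt_eqF.
Qed.

Lemma FT_Fplus_translate g x xi : rapid g ->
  FT (fun y => Fplus y * conjc (g (y - x))) xi =
  chirp hbar x * chr (- xi) x * FT (fun y => Fplus y * conjc (g y)) (xi - x).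
Proof.
move=> hg; have hm : rapid (fun y => Fplus y * conjc (g (y - x))).
  exact/rapid_Fplus/(rapid_translate x (rapid_conj hg)).
have hm0 : rapid (fun y => Fplus y * conjc (g y)) by exact/rapid_Fplus/rapid_conj.
rewrite /FT (integralC_affine x (oner_neq0 R)); last first.
  exact/integrableC_chr/rapid_integrable.
rewrite normr1 expr1n mul1r -integralCZ; last exact/integrableC_chr/rapid_integrable.
apply: eq_integralC => y; rewrite scale1r [x + y - x]addrAC subrr add0r.
by rewrite FplusD opprB chrDl chrDr; ring.
Qed.

Lemma measurable_rowBC : measurable_fun setT (fun z : E * E => z.2 - z.1).
Proof.
apply/measurable_fun_coordP => i; under eq_fun do rewrite !mxE.
apply: measurable_funB.
  exact: (measurableT_comp (measurable_coord i) measurable_snd).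
exact: (measurableT_comp (measurable_coord i) measurable_fst).
Qed.

(** After completing the square the transform is that of one fixed function, evaluated at z.2 - z.1,
    so measurability follows from its continuity. *)
Lemma measC_gabor_integrand u g gam : temp u -> rapid g -> rapid gam ->
  measC (gabor_integrand hbar g gam u).
Proof.
move=> tu hg hgam.
have hm0 : rapid (fun y => Fplus y * conjc (g y)) by exact/rapid_Fplus/rapid_conj.
rewrite (_ : gabor_integrand _ _ _ _ = (fun z : E * E =>
  c%:C%C * (chirp hbar z.1 * conjc (chr z.1 z.2) *
    FT (fun y => Fplus y * conjc (g y)) (z.2 - z.1)) *
  (c%:C%C * stft u gam z.1 z.2))); last first.
  apply/funext => z; rewrite /gabor_integrand gabor_Fplus// gabor_conj_stft//.
  by rewrite FT_Fplus_translate// conj_chr chrC -chrNr chrC.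
have mFT : measC (fun z : E * E => FT (fun y => Fplus y * conjc (g y)) (z.2 - z.1)).
  apply: (measC_comp (f := fun z : E * E => z.2 - z.1)); first exact: measurable_rowBC.
  exact: contC_measC (contC_FT hbar01 hm0).
apply: measCM; apply: measCM; try exact: measC_cst; last exact: measC_stft.
apply: measCM => //; apply: measCM.
  apply: measC_comp measurable_fst _; exact: contC_measC (contC_chirp hbar).
exact/measC_conj/measC_chr2.
Qed.

Lemma FT_norm_translate m x : rapid m ->
  (\int[mu]_xi (nrm (FT m (xi - x)))%:E = (\int[mu]_xi nrm (FT m xi))%:E)%E.
Proof.
move=> hm; have iF := integrable_nrm (integrableC_FT hbar01 hm).
have mF : measurable_fun setT (fun p => (nrm (FT m p))%:E) by have /integrableP[] := iF.
rewrite /Rintegral fineK; last exact: integrable_fin_num.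
rewrite [RHS](ge0_integral_affine (- x) (oner_neq0 R) mF); last first.
  by move=> y; rewrite lee_fin nrm_ge0.
rewrite normr1 expr1n mul1e; apply: eq_integral => y _.
by rewrite scale1r addrC.
Qed.

Section dominated.
Variables (g gam : E -> R[i]) (hg : rapid g) (hgam : rapid gam).
Variables (H : E -> \bar R) (mH : measurable_fun setT H) (H0 : forall x, (0 <= H x)%E).
Hypothesis Hoo : (\int[mu]_x H x < +oo)%E.

Let m0 (y : E) := Fplus y * conjc (g y).
Let hm0 : rapid m0. Proof. exact/rapid_Fplus/rapid_conj. Qed.

(** H stands for any integrable majorant of the transform that is uniform in xi; leaving it abstract
    lets one dominating function serve f together with all its regularisations. *)
Definition gabor_dom (z : E * E) : \bar R :=
  ((c * c * nrm (FT m0 (z.2 - z.1)))%:E * H z.1)%E.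

Lemma integrable_gabor_dom : (mu \x mu)%E.-integrable setT gabor_dom.
Proof.
have mFT : measurable_fun setT (fun z : E * E => c * c * nrm (FT m0 (z.2 - z.1))).
  apply: measurable_funM => //; apply: (measurableT_comp (f := fun p => nrm (FT m0 p))).
    by apply: measurable_nrm; exact: contC_measC (contC_FT hbar01 hm0).
  exact: measurable_rowBC.
have md : measurable_fun setT gabor_dom.
  apply: emeasurable_funM; first exact/measurable_EFinP.
  exact: (measurableT_comp mH measurable_fst).
have d0 z : (0 <= gabor_dom z)%E.
  rewrite mule_ge0// lee_fin !mulr_ge0 ?(ltW c_gt0)//; exact: nrm_ge0.
apply/integrableP; split=> //.
under eq_integral do rewrite gee0_abs//.
rewrite fubini_tonelli1//.
have E1 x : (\int[mu]_xi gabor_dom (x, xi) =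
    (c * c * \int[mu]_xi nrm (FT m0 xi))%:E * H x)%E.
  rewrite [LHS](_ : _ = (\int[mu]_xi ((c * c * nrm (FT m0 (xi - x)%R))%R%:E * H x))%E)//.
  rewrite ge0_integralZr//; last 2 first.
  - by apply/measurable_EFinP; exact: (measurable_fun_pair2 x mFT).
  - move=> xi _; rewrite lee_fin !mulr_ge0 ?(ltW c_gt0)//; exact: nrm_ge0.
  congr (_ * _)%E; under eq_integral do rewrite EFinM.
  rewrite ge0_integralZl//; last 3 first.
  - apply/measurable_EFinP; apply: measurable_nrm.
    apply: measC_comp (contC_measC (contC_FT hbar01 hm0)).
    have h : continuous (fun xi : E => xi - x).
      by move=> y; exact: (cvgB (@cvg_id _ _) (cvg_cst x)).
    apply/measurable_fun_coordP => i; under eq_fun do rewrite !mxE.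
    by apply: measurable_funB => //; exact: measurable_coord.
  - by move=> xi _; rewrite lee_fin nrm_ge0.
  - by rewrite lee_fin mulr_ge0 ?(ltW c_gt0).
  by rewrite FT_norm_translate// EFinM.
rewrite /fubini_F; under eq_integral do rewrite E1.
rewrite ge0_integralZl//; last first.
  rewrite lee_fin !mulr_ge0 ?(ltW c_gt0)// Rintegral_ge0// => p _; exact: nrm_ge0.
rewrite lte_mul_pinfty// lee_fin !mulr_ge0 ?(ltW c_gt0)// Rintegral_ge0// => p _.
exact: nrm_ge0.
Qed.

Lemma gabor_integrand_dom u z : temp u ->
  (forall x xi, ((nrm (stft u gam x xi))%:E <= H x)%E) ->
  ((nrm (gabor_integrand hbar g gam u z))%:E <= gabor_dom z)%E.
Proof.
move=> tu uH; rewrite /gabor_integrand gabor_Fplus// gabor_conj_stft//.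
rewrite FT_Fplus_translate// !nrmM nrm_real (ger0_norm (ltW c_gt0)) nrm_cis nrm_chr !mul1r.
rewrite (_ : c * _ * _ = c * c * nrm (FT m0 (z.2 - z.1)) * nrm (stft u gam z.1 z.2)); last by ring.
rewrite EFinM; apply: lee_wpmul2l => //.
by rewrite lee_fin !mulr_ge0 ?(ltW c_gt0)//; exact: nrm_ge0.
Qed.

Lemma integrableC_gabor_integrand u : temp u ->
  (forall x xi, ((nrm (stft u gam x xi))%:E <= H x)%E) ->
  integrableC (mu \x mu)%E (gabor_integrand hbar g gam u).
Proof.
move=> tu uH; apply: (integrableC_dom _ integrable_gabor_dom).
  exact: measC_gabor_integrand.
by move=> z; exact: gabor_integrand_dom.
Qed.

End dominated.

(* Fourier inversion in xi, then translation invariance in x, collapse the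
   regularised double integral to the value of f at a Schwartz function. *)
Lemma integralC_gabor_integrand (K : R[i]) (f : (E -> R[i]) -> R[i]) phi g gam :
  (forall m y, rapid m -> integralC mu (fun eta => FT m eta * chr eta y) = K * m y) ->
  temp f -> rapid phi -> rapid g -> rapid gam ->
  integrableC (mu \x mu)%E (gabor_integrand hbar g gam (mul_distr f phi)) ->
  integralC (mu \x mu)%E (gabor_integrand hbar g gam (mul_distr f phi)) =
  inner gam g * (c%:C%C * c%:C%C * K * f (fun y => Fplus y * phi y)).
Proof.
move=> inv tf hphi hg hgam iG.
have tu : temp (mul_distr f phi) by exact: temp_mul tf (rapid_slow hphi).
pose m x y := Fplus y * conjc (g (y - x)).
have hm x : rapid (m x) by exact/rapid_Fplus/(rapid_translate x (rapid_conj hg)).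
have hgx x : rapid (fun y => gam (y - x)) by exact: rapid_translate.
have GE x xi : gabor_integrand hbar g gam (mul_distr f phi) (x, xi) =
    c%:C%C * c%:C%C * (FT (m x) xi * mul_distr f phi (fun y => chr xi y * gam (y - x))).
  by rewrite /gabor_integrand gabor_Fplus// gabor_conj_stft//; rewrite /= /stft; ring.
have mods x := temp_modulation hbar01 inv tu (hm x) (hgx x).
rewrite integralC_prod1//; last first.
  move=> x; under eq_fun do rewrite GE; apply: integrableCZ; exact: (mods x).1.
(* The cutoff is what makes this product a Schwartz function, so that f can be evaluated on it. *)
have hA : rapid (fun y => Fplus y * phi y) by exact: rapid_Fplus.
have hB : rapid (fun y => gam y * conjc (g y)) by exact/rapidM/rapid_conj.
have [i1 e1] := temp_translation tf hA hB.
transitivity (integralC mu (fun x => c%:C%C * c%:C%C * K *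
    f (fun y => Fplus y * phi y * (gam (y - x) * conjc (g (y - x)))))).
  apply: eq_integralC => x; under eq_integralC do rewrite GE.
  rewrite integralCZ; last exact: (mods x).1.
  rewrite -(mods x).2 -!mulrA; congr (_ * (_ * (_ * _))).
  by congr f; apply/funext => y; rewrite /m; ring.
by rewrite integralCZ// -e1 /inner; ring.
Qed.

Lemma integral_FT_dilate phi (eps : R) : 0 < eps -> rapid phi ->
  \int[mu]_p nrm (FT (dilate eps phi) p) = \int[mu]_p nrm (FT phi p).
Proof.
move=> e0 hphi; have hd := rapid_dilate e0 hphi.
have iF := integrable_nrm (integrableC_FT hbar01 hd).
have mF : measurable_fun setT (fun p => (nrm (FT (dilate eps phi) p))%:E).
  by have /integrableP[] := iF.
rewrite /Rintegral; congr fine.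
rewrite (ge0_integral_affine 0 (lt0r_neq0 e0) mF); last first.
  by move=> y; rewrite lee_fin nrm_ge0.
rewrite -ge0_integralZl//; last 2 first.
- apply/measurable_EFinP; apply: measurable_nrm.
  exact: measC_comp (measurable_affine 0 eps) (contC_measC (contC_FT hbar01 hd)).
- by move=> p _; rewrite lee_fin nrm_ge0.
apply: eq_integral => p _; rewrite -EFinM (FT_dilate hbar p e0 hphi) add0r nrmM nrm_real.
by rewrite normrX.
Qed.

(** The difference is f evaluated on (phi_eps - 1) times the shifted window, which is O(eps) in the
    N-th seminorm; the weight lost in [dle_dilate_sub1] is paid by the decay N.+1 of the window. The
    rate depends on x and xi, so domination has to do the rest. *)
Lemma stft_dilate_cvg (f : (E -> R[i]) -> R[i]) phi gam x xi (e_ : R^nat) : temp f -> rapid phi -> phi 0 = 1 ->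
  rapid gam -> (forall n, 0 < e_ n) -> e_ n @[n --> \oo] --> (0 : R) ->
  nrm (stft (mul_distr f (dilate (e_ n) phi)) gam x xi - stft f gam x xi)
    @[n --> \oo] --> (0 : R).
Proof.
move=> tf hphi phi0 hgam e0 ecvg; have [lin [N [b [b0 hb]]]] := tf.
have hgx := rapid_tf x xi hgam.
have [A A0 hA] := dle_dilate_sub1 N hphi phi0.
have [B B0 hB] := hgx N N.+1.
have bnd eps : 0 < eps <= 1 ->
    nrm (stft (mul_distr f (dilate eps phi)) gam x xi - stft f gam x xi) <=
    b * (2 ^+ N * (A * B)) * eps.
  move=> eps01; have /andP[eps0 eps1] := eps01.
  have hd := rapid_dilate eps0 hphi.
  have hdg := rapidM hd hgx.
  have -> : stft (mul_distr f (dilate eps phi)) gam x xi - stft f gam x xi =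
      f (fun y => (dilate eps phi y - 1) * (chr xi y * gam (y - x))).
    have := lin (-1) _ _ hgx hdg; rewrite mulN1r addrC => <-.
    by congr f; apply/funext => y; ring.
  rewrite -mulrA; apply: hb.
  - have := rapidD hdg (rapidZ (-1) hgx); congr rapid.
    by apply/funext => y; ring.
  - by rewrite !mulr_ge0 ?exprn_ge0// ltW.
  apply: dle_mono (dleM (hA _ eps01) hB) => y.
  rewrite exprS invfM [leLHS](_ : _ = 2 ^+ N * (A * B) * eps * w y ^- N * (w y / w y)); last by ring.
  by rewrite divff ?weight_neq0// mulr1.
apply: (@squeeze_cvgr _ _ _ _ (fun=> 0) (fun n => b * (2 ^+ N * (A * B)) * e_ n)).
- near=> n; rewrite nrm_ge0 andTb; apply: bnd; rewrite e0 /=.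
  by near: n; exact: (cvgr_le _ ecvg _ ltr01).
- exact: cvg_cst.
- by rewrite -[X in _ --> X](mulr0 (b * (2 ^+ N * (A * B)))); apply: cvgM => //; exact: cvg_cst.
Unshelve. all: by end_near. Qed.

End fresnel.

(** * Removing the cutoff *)

Section fresnel_limit.
Context {R : realType} {d : nat}.
Local Notation E := 'rV[R]_d.
Local Notation mu := (leb R d).
Variable hbar : R.
Hypothesis hbar01 : 0 < hbar <= 1.
Variable f : (E -> R[i]) -> R[i].
Hypothesis tf : temp f.
Variable g0 : E -> R[i].
Hypotheses (hg0 : rapid g0) (g0_neq0 : exists y, g0 y != 0).
Hypothesis f_window : (\int[mu]_x stft_sup hbar f g0 x < +oo)%E.

(** Uniqueness of the limit needs at least one admissible cutoff; a translate of the nonzero window,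
    normalised at the origin, provides it. *)
Let cutoff_ex : exists phi : E -> R[i], rapid phi /\ phi 0 = 1.
Proof.
have [y0 gy0] := g0_neq0; exists (fun y => (g0 y0)^-1 * g0 (y + y0)); split.
  by apply: rapidZ; have := rapid_translate (- y0) hg0; under eq_fun do rewrite opprK.
by rewrite add0r mulVf.
Qed.

Lemma integrableC_pairing g gam : rapid g -> rapid gam ->
  integrableC (mu \x mu)%E (gabor_integrand hbar g gam f).
Proof.
move=> hg hgam; exact: (integrableC_gabor_integrand hbar01 hg hgam
  (measurable_stft_sup hbar01 tf hgam) (stft_sup_ge0 hbar f gam)
  (change_window hbar01 tf hg0 hgam g0_neq0 f_window) tf (stft_le_sup hbar f gam)).
Qed.

Section regularized.
Variables (phi g gam : E -> R[i]).
Hypotheses (hphi : rapid phi) (hg : rapid g) (hgam : rapid gam).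

Let temp_eps eps : 0 < eps -> temp (mul_distr f (dilate eps phi)).
Proof. by move=> e0; apply: temp_mul => //; exact/rapid_slow/rapid_dilate. Qed.

Lemma stft_dilate_bound : exists2 D : R, 0 <= D & forall eps x xi, 0 < eps ->
  ((nrm (stft hbar (mul_distr f (dilate eps phi)) gam x xi))%:E <=
   D%:E * stft_sup hbar f gam x)%E.
Proof.
have [K K0 inv] := fourier_inversion hbar01 hg0 g0_neq0.
have J0 : 0 <= \int[mu]_p nrm (FT hbar phi p).
  by apply: Rintegral_ge0 => p _; exact: nrm_ge0.
exists (2 / nrm K * \int[mu]_p nrm (FT hbar phi p)).
  by apply: mulr_ge0 => //; apply: divr_ge0 => //; exact: nrm_ge0.
move=> eps x xi e0.
have := temp_mul_bound hbar01 x xi K0 inv tf (rapid_dilate e0 hphi) hgam.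
by rewrite (integral_FT_dilate hbar01 e0 hphi) muleA -EFinM.
Qed.

(** In the factor 1 + D, the 1 covers f itself and D its regularisations, for all eps at once. *)
Let dominating : exists H : E -> \bar R, [/\ measurable_fun setT H,
  forall x, (0 <= H x)%E, (\int[mu]_x H x < +oo)%E,
  forall x xi, ((nrm (stft hbar f gam x xi))%:E <= H x)%E &
  forall eps x xi, 0 < eps ->
    ((nrm (stft hbar (mul_distr f (dilate eps phi)) gam x xi))%:E <= H x)%E].
Proof.
have [D D0 hD] := stft_dilate_bound.
have mS := measurable_stft_sup hbar01 tf hgam.
have S0 x : (0 <= stft_sup hbar f gam x)%E by exact: stft_sup_ge0.
have Soo := change_window hbar01 tf hg0 hgam g0_neq0 f_window.
exists (fun x => (1 + D)%:E * stft_sup hbar f gam x)%E; split.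
- by apply: emeasurable_funM => //; exact: measurable_cst.
- by move=> x; rewrite mule_ge0// lee_fin addr_ge0.
- rewrite ge0_integralZl//; last by rewrite lee_fin addr_ge0.
  rewrite lte_mul_pinfty// lee_fin addr_ge0//.
- move=> x xi; rewrite (le_trans (stft_le_sup _ _ _ _ xi))//.
  by rewrite -[leLHS]mul1e lee_wpmul2r// lee_fin lerDl.
- move=> eps x xi e0; rewrite (le_trans (hD _ _ _ e0))//.
  by rewrite lee_wpmul2r// lee_fin lerDr.
Qed.

Lemma integrableC_pairing_dilate eps : 0 < eps ->
  integrableC (mu \x mu)%E (gabor_integrand hbar g gam (mul_distr f (dilate eps phi))).
Proof.
move=> e0; have [H [mH H0 Hoo _ hH]] := dominating.
apply: (integrableC_gabor_integrand hbar01 hg hgam mH H0 Hoo) => //.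
  exact: temp_eps.
by move=> x xi; exact: hH.
Qed.

(** Stated along sequences, as dominated convergence requires; [cvg_at_rightP] turns it into the
    limit at 0 from the right. *)
Lemma gabor_pairing_cvg (e_ : R^nat) : phi 0 = 1 ->
  (forall n, 0 < e_ n) -> e_ n @[n --> \oo] --> (0 : R) ->
  nrm (gabor_pairing hbar g gam (mul_distr f (dilate (e_ n) phi)) -
       gabor_pairing hbar g gam f) @[n --> \oo] --> (0 : R).
Proof.
move=> phi0 e0 ecvg; have [H [mH H0 Hoo hf hH]] := dominating.
have icvg : nrm (integralC (mu \x mu)%E
    (gabor_integrand hbar g gam (mul_distr f (dilate (e_ n) phi))) -
    integralC (mu \x mu)%E (gabor_integrand hbar g gam f)) @[n --> \oo] --> (0 : R).
  apply: (nrm_integralC_cvg (W := gabor_dom hbar g H)).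
  - by move=> n; apply: measC_gabor_integrand => //; exact: temp_eps.
  - exact: measC_gabor_integrand.
  - move=> z; pose q := nrm (gabor hbar g (regular (Fplus hbar)) z.1 z.2 *
      ((2 * pi * hbar) `^ (- (d%:R / 2)))%:C%C).
    apply: (@cvg0_squeeze _ _ (fun n =>
      nrm (stft hbar (mul_distr f (dilate (e_ n) phi)) gam z.1 z.2 -
           stft hbar f gam z.1 z.2)) q).
      move=> n; rewrite nrm_ge0 andTb /q /gabor_integrand.
      rewrite !gabor_conj_stft//; last exact: temp_eps.
      by rewrite -mulrBr -mulrBr mulrA !nrmM.
    exact: stft_dilate_cvg.
  - exact: integrable_gabor_dom.
  - move=> n z; apply: gabor_integrand_dom => //; first exact: temp_eps.
    by move=> x xi; exact: hH.
apply: (@cvg0_squeeze _ _ (fun n => nrm (integralC (mu \x mu)%E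
    (gabor_integrand hbar g gam (mul_distr f (dilate (e_ n) phi))) -
    integralC (mu \x mu)%E (gabor_integrand hbar g gam f))) (nrm (inner gam g)^-1)) => //.
by move=> n; rewrite nrm_ge0 andTb /gabor_pairing -mulrBr nrmM.
Qed.

End regularized.

Lemma gabor_pairing_unique g gam g' gam' :
  rapid g -> rapid gam -> inner gam g != 0 ->
  rapid g' -> rapid gam' -> inner gam' g' != 0 ->
  gabor_pairing hbar g gam f = gabor_pairing hbar g' gam' f.
Proof.
move=> hg hgam I0 hg' hgam' I0'.
have [K K0 inv] := fourier_inversion hbar01 hg0 g0_neq0.
have [phi [hphi phi0]] := cutoff_ex.
pose t n : R := n.+1%:R^-1.
have t0 n : 0 < t n by rewrite invr_gt0 ltr0n.
have tc : t n @[n --> \oo] --> (0 : R) by exact: cvg_natSinv.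
have c1 := gabor_pairing_cvg hphi hg hgam phi0 t0 tc.
have c2 := gabor_pairing_cvg hphi hg' hgam' phi0 t0 tc.
have e n : gabor_pairing hbar g' gam' (mul_distr f (dilate (t n) phi)) =
    gabor_pairing hbar g gam (mul_distr f (dilate (t n) phi)).
  have hd := rapid_dilate (t0 n) hphi.
  rewrite /gabor_pairing (integralC_gabor_integrand hbar01 inv tf hd hg hgam); last first.
    exact: integrableC_pairing_dilate.
  rewrite (integralC_gabor_integrand hbar01 inv tf hd hg' hgam'); last first.
    exact: integrableC_pairing_dilate.
  by rewrite (mulKf I0) (mulKf I0').
by move: c2; under eq_fun do rewrite e; move=> c2; exact: complex_cvg_unique c1 c2.
Qed.

Lemma has_fresnel_integral_pairing g gam : rapid g -> rapid gam -> inner gam g != 0 ->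
  has_fresnel_integral hbar f (gabor_pairing hbar g gam f).
Proof.
move=> hg hgam I0 phi g' gam' /schwartz_rapid hphi phi0 /schwartz_rapid hg'
  /schwartz_rapid hgam' I0'; split.
  by move=> eps e0; exact: integrableC_pairing_dilate.
apply/cvg_at_rightP => e_ [e0 ecvg].
rewrite (gabor_pairing_unique hg hgam I0 hg' hgam' I0').
exact: gabor_pairing_cvg.
Qed.

(** [xget] returns some limit; comparing it with the pairing along one cutoff and eps = 1/(n+1)
    already forces equality. *)
Lemma fresnel_integralE g gam : rapid g -> rapid gam -> inner gam g != 0 ->
  fresnel_integral hbar f = gabor_pairing hbar g gam f.
Proof.
move=> hg hgam I0; have hL := has_fresnel_integral_pairing hg hgam I0.
have := @xgetPex _ (0 : R[i]) [set L | has_fresnel_integral hbar f L]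
  (ex_intro _ _ hL) => /= hL'.
have [phi [hphi phi0]] := cutoff_ex.
have [sphi sg sgam] := And3 (rapid_schwartz hphi) (rapid_schwartz hg) (rapid_schwartz hgam).
pose t n : R := n.+1%:R^-1.
have tc : (forall n, t n > 0) /\ t n @[n --> \oo] --> (0 : R).
  by split=> [n|]; [rewrite invr_gt0 ltr0n|exact: cvg_natSinv].
have /cvg_at_rightP/(_ t tc) c1 := (hL phi g gam sphi phi0 sg sgam I0).2.
have /cvg_at_rightP/(_ t tc) c2 := (hL' phi g gam sphi phi0 sg sgam I0).2.
exact: complex_cvg_unique c2 c1.
Qed.

End fresnel_limit.

(** The two transforms differ by a positive constant and the sign of xi, which the supremum over xi
    ignores. The window is conjugated in the passage. *)
Lemma W_infty_1_window (R : realType) (d : nat) (hbar : R)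
    (f : ('rV[R]_d -> R[i]) -> R[i]) (g : 'rV[R]_d -> R[i]) :
  0 < hbar <= 1 -> temp f -> rapid g ->
  (\int[leb R d]_x
     ereal_sup [set (nrm (gabor hbar g f x xi))%:E | xi in setT] < +oo)%E ->
  (\int[leb R d]_x stft_sup hbar f (fun y => conjc (g y)) x < +oo)%E.
Proof.
move=> hbar01 tf hg; have h0 : 0 < hbar by case/andP: hbar01.
pose c : R := (2 * pi * hbar) `^ (- (d%:R / 2)).
have c0 : 0 < c by rewrite /c powR_gt0// !mulr_gt0// pi_gt0.
have gE x xi : nrm (gabor hbar g f x xi) =
    c * nrm (stft hbar f (fun y => conjc (g y)) x (- xi)).
  by rewrite gabor_stft// nrmM nrm_real ger0_norm// ltW.
have SE x : (ereal_sup [set (nrm (gabor hbar g f x xi))%:E | xi in setT] =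
    c%:E * stft_sup hbar f (fun y => conjc (g y)) x)%E.
  apply/le_anti/andP; split.
    apply: ge_ereal_sup => _ [xi _ <-]; rewrite gE EFinM lee_wpmul2l ?lee_fin ?(ltW c0)//.
    exact: stft_le_sup.
  rewrite -[leRHS]mul1e -(@divff _ c) ?gt_eqF// EFinM -[leRHS]muleA.
  rewrite lee_wpmul2l ?lee_fin ?(ltW c0)//; apply: ge_ereal_sup => _ [xi _ <-].
  apply: (@le_trans _ _ (c^-1%:E * (nrm (gabor hbar g f x (- xi)))%:E)%E).
    by rewrite gE opprK -EFinM mulrA mulVf ?gt_eqF// mul1r.
  rewrite lee_wpmul2l ?lee_fin ?invr_ge0 ?(ltW c0)//.
  by apply: ereal_sup_ubound; exists (- xi).
under eq_integral do rewrite SE.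
have S0 x : (0 <= stft_sup hbar f (fun y => conjc (g y)) x)%E by exact: stft_sup_ge0.
have mS := measurable_stft_sup hbar01 tf (rapid_conj hg).
rewrite ge0_integralZl ?lee_fin ?(ltW c0)//.
set I := (\int[_]_x _)%E => h; rewrite ltey; apply/eqP => Iy; move: h.
by rewrite Iy gt0_muley// ltxx.
Qed.

Theorem theorem3p6 (R : realType) (d : nat) (hbar : R)
    (f : ('rV[R]_d -> R[i]) -> R[i]) :
  (0 < d)%N -> 0 < hbar <= 1 -> W_infty_1 hbar f ->
  fresnel_integrable hbar f /\
  forall g gamma : 'rV[R]_d -> R[i],
    schwartz g -> schwartz gamma -> inner gamma g != 0 ->
    integrableC (leb R d \x leb R d)%E (gabor_integrand hbar g gamma f) /\
    fresnel_integral hbar f =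
      (inner gamma g)^-1 *
      integralC (leb R d \x leb R d)%E (fun z : 'rV[R]_d * 'rV[R]_d =>
        gabor hbar g (regular (Fplus hbar)) z.1 z.2 *
        gabor_conj hbar gamma f z.1 z.2).
Proof.
move=> _ hbar01 [/tempered_temp tf [g [/schwartz_rapid hg [y gy] fW]]].
have hg' := rapid_conj hg.
have g'0 : exists y, conjc (g y) != 0 by exists y; rewrite -nrm_eq0 nrm_conj nrm_eq0.
have {}fW := W_infty_1_window hbar01 tf hg fW.
split.
  (* Any admissible pair of windows gives the same value; for g with itself the inner product is the
     squared L2 norm of g, hence nonzero. *)
  exists (gabor_pairing hbar g g f).
  apply: (has_fresnel_integral_pairing hbar01 tf hg' g'0 fW) => //.
  apply: integralC_sqr_neq0; [exact: rapid_cont|exact/rapid_integrable/rapidM|by exists y].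
move=> g1 gam /schwartz_rapid hg1 /schwartz_rapid hgam I0; split.
  exact: (integrableC_pairing hbar01 tf hg' g'0 fW).
exact: (fresnel_integralE hbar01 tf hg' g'0 fW).
Qed.
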